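(* Let $f\in L^2((0,T);\mathbb{H}^{-s}(\Omega))$ and $\rho_0\in L^2(\Omega)$. Then there exists a unique weak solution $\rho\in W(0,T;\mathbb{H}^s_0(\Omega))$ to $$\rho_t+(-\Delta)^s\rho=f\ \text{ in }Q,\qquad \rho=0\ \text{ in }\Sigma,\qquad \rho(\cdot,0)=\rho_0\ \text{ in }\Omega,$$ in the following sense: for all $\phi\in H(Q)$, $$-\int_0^T\langle\phi_t,\rho\rangle_{\mathbb{H}^{-s}(\Omega),\mathbb{H}^s_0(\Omega)}\,dt+\int_0^T\mathcal{F}(\rho,\phi)\,dt=\int_0^T\langle f,\phi\rangle_{\mathbb{H}^{-s}(\Omega),\mathbb{H}^s_0(\Omega)}\,dt+\int_\Omega\rho_0\,\phi(0)\,dx,$$ where $H(Q)=\{\xi\in W(0,T;\mathbb{H}^s_0(\Omega)):\xi(\cdot,T)=0\text{ a.e. in }\Omega\}$. In addition, the following estimates hold: $$\|\rho\|^2_{C([0,T];L^2(\Omega))}\le \|\rho_0\|^2_{L^2(\Omega)}+\|f\|^2_{L^2((0,T);\mathbb{H}^{-s}(\Omega))},$$ $$\|\rho\|^2_{L^2((0,T);\mathbb{H}^s_0(\Omega))}\le \|\rho_0\|^2_{L^2(\Omega)}+\|f\|^2_{L^2((0,T);\mathbb{H}^{-s}(\Omega))},$$ and $$\|\rho\|^2_{W(0,T;\mathbb{H}^s_0(\Omega))}\le C\left[\|\rho_0\|^2_{L^2(\Omega)}+\|f\|^2_{L^2((0,T);\mathbb{H}^{-s}(\Omega))}\right]$$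 for some constant $C>0$.
   Context: Setting: $N\ge 1$, $\Omega\subset\mathbb{R}^N$ is a bounded open domain with Lipschitz continuous boundary, $0<s<1$, $T>0$, $Q=\Omega\times(0,T)$, $\Sigma=(\mathbb{R}^N\setminus\Omega)\times(0,T)$, and $C_{N,s}=\frac{s2^{2s}\Gamma((2s+N)/2)}{\pi^{N/2}\Gamma(1-s)}$. Formally, $(-\Delta)^s w(x)=C_{N,s}\,\mathrm{P.V.}\int_{\mathbb{R}^N}\frac{w(x)-w(y)}{|x-y|^{N+2s}}\,dy$. Spaces: $\mathbb{H}^s_0(\Omega)=\{\rho\in H^s(\mathbb{R}^N):\rho=0\text{ in }\mathbb{R}^N\setminus\Omega\}$ is a Hilbert space with norm $\|\rho\|_{\mathbb{H}^s_0(\Omega)}=\mathcal{F}(\rho,\rho)^{1/2}$, where $$\mathcal{F}(\rho,\psi)=\frac{C_{N,s}}{2}\int_{\mathbb{R}^N}\int_{\mathbb{R}^N}\frac{(\rho(x)-\rho(y))(\psi(x)-\psi(y))}{|x-y|^{N+2s}}\,dx\,dy.$$ $\mathbb{H}^{-s}(\Omega)$ is its dual with respect to the pivot space $L^2(\Omega)$, so $\mathbb{H}^s_0(\Omega)\hookrightarrow L^2(\Omega)\hookrightarrow\mathbb{H}^{-s}(\Omega)$ continuously. $W(0,T;\mathbb{H}^s_0(\Omega))=\{\zeta\in L^2(0,T;\mathbb{H}^s_0(\Omega)):\zeta_t\in L^2(0,T;\mathbb{H}^{-s}(\Omega))\}$ with norm $\|\psi\|^2_{W(0,T;\mathbb{H}^s_0(\Omega))}=\|\psi\|^2_{L^2(0,T;\mathbb{H}^s_0(\Omega))}+\|\psi_t\|^2_{L^2(0,T;\mathbb{H}^{-s}(\Omega))}$.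 It embeds continuously in $C([0,T];L^2(\Omega))$, so values at fixed times make sense in $L^2(\Omega)$. *)

(* Defs.v *)
From HB Require Import structures.
From mathcomp Require Import all_boot all_order all_algebra.
From mathcomp Require Import all_classical all_reals all_analysis.

Set Implicit Arguments.
Unset Strict Implicit.
Unset Printing Implicit Defensive.
Import Order.TTheory GRing.Theory Num.Theory.
Import numFieldNormedType.Exports.
Local Open Scope classical_set_scope.
Local Open Scope ring_scope.

(* The sigma-algebra generated by the coordinates, i.e. the Borel one. *)
Section measurable_rV.
Context {R : realType} (n : nat).

Let coord (i : 'I_n) (x : 'rV[R]_n) : R := x ord0 i.

Let rV_set0 : g_sigma_preimage coord set0.
Proof. exact: sigma_algebra0. Qed.

Let rV_setC A : g_sigma_preimage coord A -> g_sigma_preimage coord (~` A).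
Proof. exact: sigma_algebraC. Qed.

Let rV_bigcup (F : _^nat) : (forall i, g_sigma_preimage coord (F i)) ->
  g_sigma_preimage coord (\bigcup_i (F i)).
Proof. exact: sigma_algebra_bigcup. Qed.

HB.instance Definition _ := @isMeasurable.Build default_measure_display
  'rV[R]_n (g_sigma_preimage coord) rV_set0 rV_setC rV_bigcup.

End measurable_rV.

Section rV_measurability.
Context {R : realType}.

Lemma measurable_rV_coord n (i : 'I_n) :
  measurable_fun [set: 'rV[R]_n] (fun x : 'rV[R]_n => x ord0 i : R).
Proof.
move=> _ Y mY; rewrite setTI; apply: sub_sigma_algebra => /=.
rewrite -bigcup_seq/=; exists i => /=; first by rewrite mem_index_enum.
by exists Y => //; rewrite setTI.
Qed.

Lemma measurable_fun_rV d (T : measurableType d) n (f : T -> 'rV[R]_n) :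
  (forall i, measurable_fun [set: T] (fun t => f t ord0 i : R)) ->
  measurable_fun [set: T] f.
Proof.
move=> mf.
have sub : g_sigma_preimage (fun (i : 'I_n) (x : 'rV[R]_n) => x ord0 i : R)
    `<=` [set A | measurable (f @^-1` A)].
  apply: smallest_sub.
    split => /=.
    - by rewrite preimage_set0.
    - by move=> A mA; rewrite setTD -preimage_setC; exact: measurableC.
    - by move=> F mF; rewrite preimage_bigcup; exact: bigcup_measurable.
  rewrite -bigcup_seq => A [i _ [B mB <-]] /=.
  rewrite setTI -[X in measurable X]setTI.
  exact: (mf i).
by move=> _ Y mY; rewrite setTI; exact: sub.
Qed.

Definition cons_rV n (p : measurableTypeR R * 'rV[R]_n) : 'rV[R]_n.+1 :=
  row_mx p.1%:M p.2.

Definition uncons_rV n (x : 'rV[R]_n.+1) : measurableTypeR R * 'rV[R]_n :=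
  (x ord0 ord0, rsubmx (x : 'rV[R]_(1 + n))).

Lemma measurable_cons_rV n : measurable_fun setT (@cons_rV n).
Proof.
apply: measurable_fun_rV => i.
have [j ij|j ij] := split_ordP (i : 'I_(1 + n)).
- rewrite (_ : (fun _ => _) = fst); first exact: measurable_fst.
  apply/funext => p; rewrite /cons_rV.
  rewrite ij; apply: etrans (row_mxEl _ _ _ _) _.
  by rewrite mxE !ord1 eqxx mulr1n.
- rewrite (_ : (fun _ => _) = (fun x : 'rV[R]_n => x ord0 j) \o snd).
    exact: (measurableT_comp (measurable_rV_coord j)) measurable_snd.
  by apply/funext => p; rewrite ij; exact: row_mxEr.
Qed.

Lemma measurable_uncons_rV n : measurable_fun setT (@uncons_rV n).
Proof.
apply: measurable_fun_pair; first exact: measurable_rV_coord.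
apply: measurable_fun_rV => i.
under eq_fun do rewrite mxE.
exact: measurable_rV_coord.
Qed.

Lemma cons_rVK n : cancel (@cons_rV n) (@uncons_rV n).
Proof.
move=> [a y]; rewrite /uncons_rV /cons_rV /= row_mxKr; congr pair.
have -> : ord0 = lshift n ord0 :> 'I_(1 + n) by exact: val_inj.
by apply: etrans (row_mxEl _ _ _ _) _; rewrite mxE eqxx mulr1n.
Qed.

Lemma uncons_rVK n : cancel (@uncons_rV n) (@cons_rV n).
Proof.
move=> x; have E : (x ord0 ord0)%:M = lsubmx (x : 'rV[R]_(1 + n)).
  apply/matrixP => i j; rewrite !mxE !ord1 eqxx mulr1n.
  by congr (x _ _); exact: val_inj.
by rewrite /cons_rV [(uncons_rV x).1%:M]E; exact: (hsubmxK (x : 'rV[R]_(1 + n))).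
Qed.

End rV_measurability.

Section lebesgue_rV.
Context {R : realType}.

Section step.
Context (n : nat) (m : {sigma_finite_measure set 'rV[R]_n -> \bar R}).

Definition lebesgue_rVS : set 'rV[R]_n.+1 -> \bar R :=
  pushforward (@lebesgue_measure R \x m)%E (@cons_rV R n).

Let lebesgue_rVS0 : lebesgue_rVS set0 = 0%E.
Proof. by rewrite /lebesgue_rVS /pushforward preimage_set0 measure0. Qed.

Let lebesgue_rVS_ge0 A : (0 <= lebesgue_rVS A)%E.
Proof. by rewrite /lebesgue_rVS /pushforward; exact: measure_ge0. Qed.

Let lebesgue_rVS_sigma_additive : semi_sigma_additive lebesgue_rVS.
Proof.
exact: (@measure_semi_sigma_additive _ _ _
  (measure_function_pushforward__canonical__measure_function_Measure
    (@lebesgue_measure R \x m)%E (@measurable_cons_rV R n))).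
Qed.

HB.instance Definition _ := isMeasure.Build _ _ _ lebesgue_rVS
  lebesgue_rVS0 lebesgue_rVS_ge0 lebesgue_rVS_sigma_additive.

Let lebesgue_rVS_sigma_finite : sigma_finite setT lebesgue_rVS.
Proof.
have /sigma_finiteP[F [TF ndF Foo]] := sigma_finiteT (@lebesgue_measure R).
have /sigma_finiteP[G [TG ndG Goo]] := sigma_finiteT m.
exists (fun k => @uncons_rV R n @^-1` (F k `*` G k)).
  rewrite -preimage_bigcup (_ : \bigcup_k _ = setT) ?preimage_setT//.
  rewrite -subTset -setXTT TF TG => -[x y] [/= [i _ Fx] [j _ Gy]].
  exists (maxn i j) => //; split => /=.
    by move: x Fx; exact/subsetPset/ndF/leq_maxl.
  by move: y Gy; exact/subsetPset/ndG/leq_maxr.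
move=> k; have [mF Fk] := Foo k; have [mG Gk] := Goo k; split.
  rewrite -[X in measurable X]setTI; apply: measurable_uncons_rV => //.
  exact: measurableX.
rewrite /lebesgue_rVS /pushforward -comp_preimage.
rewrite (_ : _ \o _ = id); last by apply/funext => x /=; exact: cons_rVK.
by rewrite preimage_id product_measure1E// lte_mul_pinfty// ge0_fin_numE.
Qed.

HB.instance Definition _ := Measure_isSigmaFinite.Build _ _ _ lebesgue_rVS
  lebesgue_rVS_sigma_finite.

End step.

Fixpoint lebesgue_rV (n : nat) : {sigma_finite_measure set 'rV[R]_n -> \bar R} :=
  match n with
  | 0 => \d_(0 : 'rV[R]_0)
  | k.+1 => lebesgue_rVS (lebesgue_rV k)
  end.

End lebesgue_rV.

(* The norm [`|x|] of the library on ['rV[R]_n] is the sup norm. *)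
Definition enorm {R : realType} n (x : 'rV[R]_n) : R :=
  Num.sqrt (\sum_i x ord0 i ^+ 2).

(* Near each boundary point, in suitable orthonormal coordinates centred at that
   point, [Omega] is the strict epigraph of a Lipschitz function of the first
   [n] coordinates. *)
Definition lipschitz_boundary {R : realType} n (Omega : set 'rV[R]_n.+1) :=
  forall x, (closure Omega `\` Omega°) x ->
  exists (P : 'M[R]_n.+1) (gamma : 'rV[R]_n -> R) (L : R),
    [/\ P *m P^T = 1%:M,
        forall a b, `|gamma a - gamma b| <= L * enorm (a - b) &
        \forall y \near x, let z := (y - x) *m P in
          Omega y <-> gamma (col' ord_max z) < z ord0 ord_max].

(* A normed space is given by a subset [D] of an ambient additive group [V] and
   a function [nrm] on [V], which is meant to be a seminorm on [D]: no quotient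
   is taken, [u] and [v] stand for the same element when [nrm (u - v) = 0]. *)

Section bochner.
Context {R : realType} {V : zmodType} (D : set V) (nrm : V -> R) (I : set R).

Definition bochner_simple (g : R -> V) :=
  [/\ finite_set (range g), range g `<=` D &
      forall v, measurable (g @^-1` [set v])].

Definition strongly_measurable (u : R -> V) :=
  exists2 g : nat -> R -> V, (forall k, bochner_simple (g k)) &
    {ae @lebesgue_measure R, forall t, I t ->
      D (u t) /\ nrm (g k t - u t) @[k --> \oo] --> (0 : R)}.

Definition bochner_eL2norm (u : R -> V) : \bar R :=
  Lnorm (@lebesgue_measure R) 2%:E (EFin \o ((nrm \o u) \_ I)).

Definition bochner_L2 (u : R -> V) :=
  strongly_measurable u /\ (bochner_eL2norm u < +oo)%E.

Definition bochner_L2norm (u : R -> V) : R := fine (bochner_eL2norm u).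

End bochner.

Definition Gamma {R : realType} (z : R) : R :=
  \int[@lebesgue_measure R]_(t in `]0, +oo[) (t `^ (z - 1) * expR (- t)).

Section spaces.
Context {R : realType} (n : nat) (Omega : set 'rV[R]_n) (s T : R).

Local Notation E := 'rV[R]_n.
Local Notation mu := (lebesgue_rV n).
Local Notation lambda := (@lebesgue_measure R).

(* A function on [A] is any function on [E]: its values outside [A] are
   ignored. *)
Definition L2 (A : set E) (u : E -> R) := u \_ A \in Lfun mu 2%:E.

Definition L2norm (A : set E) (u : E -> R) : R :=
  fine (Lnorm mu 2%:E (EFin \o (u \_ A))).

Definition L2prod (A : set E) (u v : E -> R) : R :=
  \int[mu]_(x in A) (u x * v x).

Definition C_Ns : R :=
  s * 2 `^ (2 * s) * Gamma ((2 * s + n%:R) / 2) /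
  (pi `^ (n%:R / 2) * Gamma (1 - s)).

Definition kernel_Ns (p : E * E) : R :=
  (enorm (p.1 - p.2) `^ (n%:R + 2 * s))^-1.

Definition Hs (u : E -> R) :=
  L2 setT u /\
  (\int[mu \x mu]_p ((u p.1 - u p.2) ^+ 2 * kernel_Ns p)%:E < +oo)%E.

Definition Fs (u v : E -> R) : R :=
  C_Ns / 2 *
  \int[(mu \x mu)%E]_p ((u p.1 - u p.2) * (v p.1 - v p.2) * kernel_Ns p).

Definition Hs0 (u : E -> R) :=
  Hs u /\ {ae mu, forall x, ~ Omega x -> u x = 0}.

Definition Hs0_norm (u : E -> R) : R := Num.sqrt (Fs u u).

(* The dual of [Hs0]: only the values of [F] on [Hs0] matter, and the bound
   makes them invariant under a.e. equality. *)
Definition Hms (F : (E -> R) -> R) :=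
  (forall (a : R) u v, Hs0 u -> Hs0 v ->
     F (fun x => a * u x + v x) = a * F u + F v) /\
  (exists M : R, forall u, Hs0 u -> `|F u| <= M * Hs0_norm u).

Definition Hms_norm (F : (E -> R) -> R) : R :=
  sup [set `|F u| | u in [set u | Hs0 u /\ Hs0_norm u <= 1]].

Definition L2Hs0 := bochner_L2 Hs0 Hs0_norm `]0, T[%classic.
Definition L2Hs0_norm := bochner_L2norm Hs0_norm `]0, T[%classic.
Definition L2Hms := bochner_L2 Hms Hms_norm `]0, T[%classic.
Definition L2Hms_norm := bochner_L2norm Hms_norm `]0, T[%classic.

Definition test_fun (theta : R -> R) :=
  (forall k t, derivable (derive1n k theta) t 1) /\
  (exists a b, [/\ 0 < a, b < T & forall t, ~ (a <= t <= b) -> theta t = 0]).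

(* [w] is the distributional derivative of [z] with values in [H^{-s}(Omega)]:
   [\int theta' z = - \int theta w] in [H^{-s}(Omega)], where [z t] is seen as an
   element of [H^{-s}(Omega)] through the pivot space [L^2(Omega)]. *)
Definition is_time_derivative (z : R -> E -> R) (w : R -> (E -> R) -> R) :=
  forall theta, test_fun theta -> forall v, Hs0 v ->
    (\int[lambda]_(t in `]0, T[) (derive1 theta t * L2prod Omega (z t) v)) =
    - (\int[lambda]_(t in `]0, T[) (theta t * w t v)).

Definition W (z : R -> E -> R) (zt : R -> (E -> R) -> R) :=
  [/\ L2Hs0 z, L2Hms zt & is_time_derivative z zt].

Definition W_norm (z : R -> E -> R) (zt : R -> (E -> R) -> R) : R :=
  Num.sqrt (L2Hs0_norm z ^+ 2 + L2Hms_norm zt ^+ 2).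

Definition CL2 (z : R -> E -> R) :=
  (forall t, t \in `[0, T] -> L2 Omega (z t)) /\
  (forall t, t \in `[0, T] ->
     L2norm Omega (z r - z t) @[r --> within `[0, T] (nbhs t)] --> (0 : R)).

Definition CL2_norm (z : R -> E -> R) : R :=
  sup [set L2norm Omega (z t) | t in `[0, T]].

(* [zc] is the representative of [z] in [C([0,T];L^2(Omega))]; the values of an
   element of [W(0,T;Hs0)] at fixed times are those of this representative. *)
Definition continuous_rep (z zc : R -> E -> R) :=
  CL2 zc /\ {ae lambda, forall t, t \in `]0, T[ ->
    {ae mu, forall x, Omega x -> zc t x = z t x}}.

Definition HQ (xi : R -> E -> R) (xit : R -> (E -> R) -> R)
    (xic : R -> E -> R) :=
  [/\ W xi xit, continuous_rep xi xic & {ae mu, forall x, Omega x -> xic T x = 0}].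

Definition weak_solution (f : R -> (E -> R) -> R) (rho0 : E -> R)
    (rho : R -> E -> R) :=
  (exists rhot, W rho rhot) /\
  forall phi phit phic, HQ phi phit phic ->
    - (\int[lambda]_(t in `]0, T[) phit t (rho t)) +
      (\int[lambda]_(t in `]0, T[) Fs (rho t) (phi t)) =
    (\int[lambda]_(t in `]0, T[) f t (phi t)) + L2prod Omega rho0 (phic 0).

End spaces.

(* Main.v *)
Require Import Defs.
From HB Require Import structures.
From mathcomp Require Import all_boot all_order all_algebra.
From mathcomp Require Import all_classical all_reals all_analysis.
From mathcomp Require Import measurable_realfun.
From mathcomp Require Import ring lra.

(** The problem is an evolution equation in a Hilbert space.  Write [V] for [Hs0] with
its form [a] (the Gagliardo form), and [h] for the scalar product of the pivot space,
which the fractional Poincare inequality [poincare] bounds by a multiple of [a].  As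
[V] is complete ([gagliardo_complete]), the Riesz representation identifies the dual
space with [V]: the source [f] becomes a square integrable function [F] with values in
[V] and the same norm, and the equation says that the time derivative of [h (u, w)] is
[a (F - u, w)] for every [w].  In particular the time derivative of the solution is
represented by [F - u].  Spaces of classes of functions are replaced everywhere by
positive semidefinite forms on spaces of functions, for which only the definiteness is
lost.

Explicit solutions are finite sums of [exp ((k+1) t) v_k]; they solve the equation for
the source of same shape with coefficients [r_k], where [r_k] represents [(k+1) + A]
applied to [v_k].  Since [(k+1) + A] is invertible, any finite sum of
[exp ((k+1) t) r_k] is a source.  With Weierstrass' theorem in the variable [exp t],
the data (initial value in [V], source) of explicit solutions are dense
([exponential_density]); the initial value is brought under control by running the
energy estimate from [-oo], where the exponentials vanish.  The energy identity
  [(d/dt) h (u, u) = 2 a (F - u, u) <= a (F, F) - a (u, u)]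
turns convergence of the data into convergence of the solutions, both in [L2(0, T; V)]
and uniformly in time for [h] ([cauchy_approximations]), and the limit inherits the two
bounds by the data with constant one.  As [a (F - u, F - u) <= 2 a (F, F) + 2 a (u, u)],
the squared norm in [W] is at most five times that of the data.

The weak formulation of an explicit solution is, exponential by exponential, an
integration by parts for a scalar function with a weak derivative and a continuous
representative ([weak_integration_by_parts]); smooth cutoffs that tend to the indicator
of [0, T] produce the boundary terms.  It then passes to the limit
([weak_form_limit]).

Uniqueness is by duality.  Let [z] be the difference of two weak solutions and [K] the
operator with [a (K u, w) = h (u, w)].  The same existence theory with time reversed
([backward_solution]) gives a test function [phi] with [phi_t = phi - K z] and
[phi (T) = 0]; tested against it, the weak formulation reads [\int h (z, z) = 0]. *)

Set Implicit Arguments.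
Unset Strict Implicit.
Unset Printing Implicit Defensive.
Import Order.TTheory GRing.Theory Num.Theory.
Import numFieldNormedType.Exports.
Local Open Scope classical_set_scope.
Local Open Scope ring_scope.

(** * Positive semidefinite forms and the Riesz representation *)

(** Functions that agree almost everywhere are not identified, so the forms of
interest are not definite. *)
Record semi_inner (R : realType) (V : lmodType R) (b : V -> V -> R) : Prop :=
  SemiInner {
    sip_linear : forall a u v w, b (a *: u + v) w = a * b u w + b v w ;
    sip_sym : forall u v, b u v = b v u ;
    sip_ge0 : forall u, 0 <= b u u }.

Definition ipnorm (R : realType) (V : lmodType R) (b : V -> V -> R) (u : V) : R :=
  Num.sqrt (b u u).

(** Completeness is asked of geometric Cauchy sequences, together with the rate: it is the
rate that the almost everywhere arguments use, and it spares extracting subsequences. *)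
Definition ip_complete (R : realType) (V : lmodType R) (b : V -> V -> R) : Prop :=
  forall u : nat -> V,
    (forall k i, (k <= i)%N -> ipnorm b (u i - u k) <= 2^-1 ^+ k) ->
    exists l, forall k, ipnorm b (u k - l) <= 2^-1 ^+ k.

Section real_lemmas.
Context {R : realType}.

Lemma le_geometric_eq0 (x c : R) : (forall k, `|x| <= c * 2^-1 ^+ k) -> x = 0.
Proof.
move=> h; apply/eqP; rewrite -normr_le0.
have : c * 2^-1 ^+ k @[k --> \oo] --> c * 0.
  apply: cvgMr; apply: cvg_expr; rewrite ger0_norm; lra.
rewrite mulr0 => /cvgP cc.
have cl : `|x| <= limn (fun k => c * 2^-1 ^+ k).
  by apply: limr_ge cc _; apply: nearW => k; exact: h.
move: cl.
have -> : limn (fun k => c * 2^-1 ^+ k) = 0.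
  apply/cvg_lim => //; rewrite -(mulr0 c).
  apply: cvgMr; apply: cvg_expr; rewrite ger0_norm; lra.
by [].
Qed.

Lemma quadratic_ge0_discr (a b c : R) :
  0 <= a -> (forall t, 0 <= a * t ^+ 2 + 2 * b * t + c) -> b ^+ 2 <= a * c.
Proof.
move=> a0 h; have [a1|a1] := eqVneq a 0.
  have [->|b0] := eqVneq b 0; first by rewrite expr0n/= a1 mul0r.
  have := h (- (c + 1) / (2 * b)); rewrite a1 mul0r add0r.
  have -> : 2 * b * (- (c + 1) / (2 * b)) = - (c + 1) by field.
  lra.
have ap : 0 < a by rewrite lt_neqAle eq_sym a1.
have := h (- b / a).
have -> : a * (- b / a) ^+ 2 + 2 * b * (- b / a) + c = (a * c - b ^+ 2) / a by field.
by rewrite pmulr_lge0 ?invr_gt0// subr_ge0.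
Qed.

End real_lemmas.

Section semi_inner_theory.
Context {R : realType} {V : lmodType R} {b : V -> V -> R} (hb : semi_inner b).

Lemma sipDl u v w : b (u + v) w = b u w + b v w.
Proof. by rewrite -{1}(scale1r u) (sip_linear hb) mul1r. Qed.

Lemma sip0l w : b 0 w = 0.
Proof. by have := sipDl 0 0 w; rewrite addr0; lra. Qed.

Lemma sipZl a u w : b (a *: u) w = a * b u w.
Proof. by rewrite -(addr0 (a *: u)) (sip_linear hb) sip0l addr0. Qed.

Lemma sipNl u w : b (- u) w = - b u w.
Proof. by rewrite -scaleN1r sipZl mulN1r. Qed.

Lemma sipBl u v w : b (u - v) w = b u w - b v w.
Proof. by rewrite sipDl sipNl. Qed.

Lemma sipDr u v w : b u (v + w) = b u v + b u w.
Proof. by rewrite !(sip_sym hb u) sipDl. Qed.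

Lemma sipZr a u w : b u (a *: w) = a * b u w.
Proof. by rewrite !(sip_sym hb u) sipZl. Qed.

Lemma sipNr u w : b u (- w) = - b u w.
Proof. by rewrite !(sip_sym hb u) sipNl. Qed.

Lemma sipBr u v w : b u (v - w) = b u v - b u w.
Proof. by rewrite !(sip_sym hb u) sipBl. Qed.

Lemma sip_suml I (r : seq I) (P : pred I) (F : I -> V) w :
  b (\sum_(i <- r | P i) F i) w = \sum_(i <- r | P i) b (F i) w.
Proof.
elim: r => [|x r ih]; first by rewrite !big_nil sip0l.
by rewrite !big_cons; case: (P x) => //; rewrite sipDl ih.
Qed.

Lemma sip_sumr I (r : seq I) (P : pred I) (F : I -> V) w :
  b w (\sum_(i <- r | P i) F i) = \sum_(i <- r | P i) b w (F i).
Proof. by rewrite (sip_sym hb) sip_suml; under eq_bigr do rewrite (sip_sym hb). Qed.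

Lemma sip_cauchy_schwarz u v : b u v ^+ 2 <= b u u * b v v.
Proof.
rewrite mulrC; apply: quadratic_ge0_discr => [|t]; first exact: (sip_ge0 hb).
have := sip_ge0 hb (u + t *: v).
rewrite !(sipDl, sipDr, sipZl, sipZr) (sip_sym hb v u).
by congr (_ <= _); ring.
Qed.

Lemma sipD_le u v : b (u + v) (u + v) <= 2 * b u u + 2 * b v v.
Proof.
have := sip_ge0 hb (u - v).
rewrite !(sipDl, sipDr, sipNl, sipNr) (sip_sym hb v u); lra.
Qed.

Lemma sip_young u v : 2 * b u v <= b u u + b v v.
Proof.
have := sip_ge0 hb (u - v).
rewrite !(sipDl, sipDr, sipNl, sipNr) (sip_sym hb v u); lra.
Qed.

Lemma ipnorm_ge0 u : 0 <= ipnorm b u. Proof. exact: sqrtr_ge0. Qed.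

Lemma sqr_ipnorm u : ipnorm b u ^+ 2 = b u u.
Proof. by rewrite sqr_sqrtr// (sip_ge0 hb). Qed.

Lemma ipnorm0 : ipnorm b 0 = 0.
Proof. by rewrite /ipnorm sip0l sqrtr0. Qed.

Lemma normr_sip_le u v : `|b u v| <= ipnorm b u * ipnorm b v.
Proof.
rewrite -(@ler_pXn2r _ 2)// ?nnegrE ?mulr_ge0 ?ipnorm_ge0//.
by rewrite exprMn !sqr_ipnorm real_normK ?num_real// sip_cauchy_schwarz.
Qed.

Lemma ipnormD u v : ipnorm b (u + v) <= ipnorm b u + ipnorm b v.
Proof.
rewrite -(@ler_pXn2r _ 2)// ?nnegrE ?addr_ge0 ?ipnorm_ge0//.
have := le_trans (ler_norm _) (normr_sip_le u v).
rewrite sqrrD !sqr_ipnorm !(sipDl, sipDr) (sip_sym hb v u) mulr2n; lra.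
Qed.

Lemma ipnormZ a u : ipnorm b (a *: u) = `|a| * ipnorm b u.
Proof. by rewrite /ipnorm sipZl sipZr mulrA -expr2 sqrtrM ?sqr_ge0// sqrtr_sqr. Qed.

Lemma ipnormN u : ipnorm b (- u) = ipnorm b u.
Proof. by rewrite -scaleN1r ipnormZ normrN1 mul1r. Qed.

Lemma ipnormB u v : ipnorm b (u - v) = ipnorm b (v - u).
Proof. by rewrite -ipnormN opprB. Qed.

Lemma ipnorm_dist u v : `|ipnorm b u - ipnorm b v| <= ipnorm b (u - v).
Proof.
rewrite ler_norml; have := ipnormD (u - v) v; have := ipnormD (v - u) u.
rewrite !subrK (ipnormB v u); lra.
Qed.

Lemma ipnorm_le (c : R) u : 0 <= c -> (ipnorm b u <= c) = (b u u <= c ^+ 2).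
Proof. by move=> c0; rewrite -sqr_ipnorm ler_pXn2r// nnegrE ipnorm_ge0. Qed.

(** Any [v] minimizing [w |-> b w w - 2 L w] up to [e ^+ 2] will do: along the line
[v + t w] this functional is a quadratic polynomial in [t] that cannot drop by more
than [e ^+ 2], and its discriminant says so. *)
Lemma almost_riesz (L : V -> R) (M : R) (e : R) :
  (forall a u v, L (a *: u + v) = a * L u + L v) ->
  (forall u, `|L u| <= M * ipnorm b u) -> 0 < e ->
  exists v, forall w, `|b v w - L w| <= e * ipnorm b w.
Proof.
move=> Llin Lbd e0.
pose J v := b v v - 2 * L v.
have Jlb v : - M ^+ 2 <= J v.
  have := le_trans (ler_norm _) (Lbd v); rewrite /J -sqr_ipnorm => h.
  have := sqr_ge0 (ipnorm b v - M).
  by rewrite sqrrB mulr2n; lra.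
have hinf : has_inf (range J).
  by split; [exists (J 0), 0|exists (- M ^+ 2) => _ [v _ <-]].
have [_ [v _ <-] hv] := inf_adherent (exprn_gt0 2 e0) hinf.
exists v => w.
rewrite -(@ler_pXn2r _ 2)// ?nnegrE ?mulr_ge0 ?ipnorm_ge0 ?(ltW e0)//.
rewrite exprMn sqr_ipnorm real_normK ?num_real// mulrC.
apply: quadratic_ge0_discr => [|t]; first exact: (sip_ge0 hb).
have h : J v <= J (t *: w + v) + e ^+ 2.
  apply: ltW; apply: lt_le_trans hv _; rewrite lerD2r.
  by apply: ge_inf; [exact: hinf.2|exists (t *: w + v)].
move: h; rewrite /J Llin !(sipDl, sipDr, sipZl, sipZr) (sip_sym hb w v).
rewrite -subr_ge0; congr (_ <= _); ring.
Qed.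

End semi_inner_theory.

Section riesz.
Context {R : realType} {V : lmodType R} (a b : V -> V -> R).
Hypothesis (hb : semi_inner b) (ca : ip_complete a).

Lemma ipnorm_dom (c : R) : 0 <= c -> (forall u, b u u <= c * a u u) ->
  forall u, ipnorm b u <= Num.sqrt c * ipnorm a u.
Proof. by move=> c0 h u; rewrite /ipnorm -sqrtrM// ler_wsqrtr. Qed.

(** The functional is bounded for [b] while completeness is known for [a], which is
equivalent to [b].  The almost representatives of precision [2^-k] form a Cauchy
sequence for [a], hence for [b]. *)
Lemma riesz (c : R) (L : V -> R) (M : R) :
  0 <= c -> (forall u, a u u <= b u u) -> (forall u, b u u <= c * a u u) ->
  (forall x u v, L (x *: u + v) = x * L u + L v) ->
  (forall u, `|L u| <= M * ipnorm b u) ->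
  exists v, forall w, b v w = L w.
Proof.
move=> c0 hab hba Llin Lbd.
have pos k : 0 < 2^-1 ^+ k / 2 :> R by rewrite divr_gt0// exprn_gt0// invr_gt0.
have /choice[v hv] k := almost_riesz hb Llin Lbd (pos k).
have anti (k i : nat) : (k <= i)%N -> (2^-1 : R) ^+ i <= 2^-1 ^+ k.
  by move=> ki; apply: ler_wiXn2l => //; lra.
have cau k i : (k <= i)%N -> ipnorm a (v i - v k) <= 2^-1 ^+ k.
  move=> ki; set w := v i - v k.
  apply: (@le_trans _ _ (ipnorm b w)); first by rewrite /ipnorm ler_wsqrtr.
  have bw : b w w <= 2^-1 ^+ k * ipnorm b w.
    have := le_trans (ler_norm _) (hv i w); have := hv k w.
    rewrite ler_norml => /andP[+ _].
    rewrite {5}/w (sipBl hb).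
    have := ler_wpM2r (ipnorm_ge0 (b := b) w) (anti _ _ ki).
    lra.
  have := ipnorm_ge0 (b := b) w; rewrite le_eqVlt => /predU1P[<-|w0].
    by rewrite exprn_ge0// invr_ge0.
  by move: bw; rewrite -(sqr_ipnorm hb) expr2 ler_pM2r.
have [l hl] := ca cau.
exists l => w; apply/eqP; rewrite -subr_eq0; apply/eqP.
apply: (@le_geometric_eq0 _ _ ((Num.sqrt c + 1) * ipnorm b w)) => k.
have -> : b l w - L w = (b (v k) w - L w) - b (v k - l) w.
  by rewrite (sipBl hb); ring.
apply: le_trans (ler_normB _ _) _.
have h1 := hv k w.
have h2 := normr_sip_le hb (v k - l) w.
have h3 := ipnorm_dom c0 hba (v k - l).
have h4 := ler_wpM2l (sqrtr_ge0 c) (hl k).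
have h5 := ler_wpM2r (ipnorm_ge0 (b := b) w) (le_trans h3 h4).
have h6 := mulr_ge0 (ltW (pos k)) (ipnorm_ge0 (b := b) w).
apply: le_trans (lerD h1 (le_trans h2 h5)) _.
have -> : (Num.sqrt c + 1) * ipnorm b w * 2^-1 ^+ k =
   2^-1 ^+ k * ipnorm b w + Num.sqrt c * 2^-1 ^+ k * ipnorm b w by ring.
rewrite lerD2r; move: h6; set p := _ ^+ k; lra.
Qed.

End riesz.

(** * Polynomial approximation *)
Section weierstrass.
Context {R : realType}.

(** The Bernstein polynomial of degree [n] of the values [g 0, ..., g n], by the
recursion of de Casteljau: at [x] it is the expectation of [g] at a binomial
variable of parameters [n] and [x]. *)
Fixpoint bernstein (n : nat) (g : nat -> R) : {poly R} :=
  if n is m.+1 then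
    'X * bernstein m (fun k => g k.+1) + (1 - 'X) * bernstein m g
  else (g 0%N)%:P.

Lemma bernsteinS n g (x : R) : (bernstein n.+1 g).[x] =
  x * (bernstein n (fun k => g k.+1)).[x] + (1 - x) * (bernstein n g).[x].
Proof. by rewrite /= !hornerE. Qed.

Lemma bernstein0 g (x : R) : (bernstein 0 g).[x] = g 0%N.
Proof. by rewrite /= hornerC. Qed.

Lemma bernstein_lin n a g h (x : R) :
  (bernstein n (fun k => a * g k + h k)).[x] =
  a * (bernstein n g).[x] + (bernstein n h).[x].
Proof.
elim: n g h => [|n ih] g h; first by rewrite !bernstein0.
by rewrite !bernsteinS !ih; ring.
Qed.

Lemma bernstein_cst n c (x : R) : (bernstein n (fun=> c)).[x] = c.
Proof.
elim: n => [|n ih]; first by rewrite bernstein0.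
by rewrite bernsteinS ih; ring.
Qed.

Lemma bernstein_le n g h (x : R) : 0 <= x <= 1 ->
  (forall k, (k <= n)%N -> g k <= h k) -> (bernstein n g).[x] <= (bernstein n h).[x].
Proof.
move=> /andP[x0 x1]; elim: n g h => [|n ih] g h gh.
  by rewrite !bernstein0 gh.
rewrite !bernsteinS lerD// ler_wpM2l ?subr_ge0//; apply: ih => k kn; apply: gh => //.
exact: leqW.
Qed.

(** The second moment about [a] of the binomial law. *)
Lemma bernstein_moment2 n a (x : R) :
  (bernstein n (fun k => (k%:R - a) ^+ 2)).[x] =
  n%:R * x * (1 - x) + (n%:R * x - a) ^+ 2.
Proof.
elim: n a => [|n ih] a; first by rewrite bernstein0; ring.
rewrite bernsteinS ih.
have -> : (fun k => (k.+1%:R - a) ^+ 2) = (fun k => (k%:R - (a - 1)) ^+ 2) :> (nat -> R).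
  by apply/funext => k; rewrite -natr1; ring.
by rewrite ih -natr1; ring.
Qed.

Lemma continuous_unif01 (f : R -> R) (e : R) : continuous f -> 0 < e ->
  exists2 d : R, 0 < d & forall x y : R, 0 <= x <= 1 -> `|x - y| < d -> `|f x - f y| < e.
Proof.
move=> cf e0.
have /compact_near_coveringP cK : compact (`[0, 1]%classic : set R).
  exact: segment_compact.
have := cK R (0^'+) (fun d x => forall y, `|x - y| < d -> `|f x - f y| < e).
case.
- move=> x _.
  have /cvgrPdist_lt/(_ (e / 2)) := cf x.
  rewrite divr_gt0// => /(_ isT)/nbhs_ballP[d/= d0 hd].
  exists (ball x (d / 2), [set r | r < d / 2]) => /=.
    split; first by apply: nbhsx_ballx; rewrite divr_gt0.
    by apply: nbhs_right_lt; rewrite divr_gt0.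
  move=> [z r]/= [xz rd] y zy.
  have h1 : `|f x - f z| < e / 2.
    by apply: hd; apply: lt_le_trans xz _; rewrite ler_pdivrMr//; lra.
  have h2 : `|f x - f y| < e / 2.
    apply: hd; rewrite /ball/=.
    have -> : x - y = (x - z) + (z - y) by ring.
    apply: le_lt_trans (ler_normD _ _) _.
    move: xz; rewrite /ball/= => xz.
    by apply: (@lt_trans _ _ (d / 2 + r)); [rewrite ltrD|lra].
  have -> : f z - f y = (f x - f y) - (f x - f z) by ring.
  apply: le_lt_trans (ler_normB _ _) _; lra.
- move=> d /= d0 hd.
  exists (d / 2) => [|x y x01 xy]; first by rewrite divr_gt0.
  apply: (hd (d / 2)) => //=.
  - by rewrite sub0r normrN gtr0_norm ?divr_gt0//; lra.
  - by rewrite divr_gt0.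
Qed.

(** Bernstein's proof: [f] oscillates by at most [e + c (x - y)^2], and the second
moment of the binomial law about its mean, divided by [n^2], is at most [1 / n]. *)
Theorem weierstrass01 (f : R -> R) (e : R) : continuous f -> 0 < e ->
  exists p : {poly R}, forall x : R, 0 <= x <= 1 -> `|f x - p.[x]| <= e.
Proof.
move=> cf e0.
have e20 : 0 < e / 2 by rewrite divr_gt0.
have [d d0 hd] := continuous_unif01 cf e20.
have [M hM] : exists M : R, forall x : R, 0 <= x <= 1 -> `|f x| <= M.
  have cg : {within `[(0 : R), 1], continuous (fun x => `|f x|)}.
    apply: continuous_subspaceT => x.
    by apply: continuous_comp; [exact: cf|exact: norm_continuous].
  have [c _ hc] := EVT_max (ler01 : (0 : R) <= 1) cg.
  by exists `|f c| => x x01; apply: hc; rewrite in_itv/=.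
have M0 : 0 <= M by apply: le_trans (normr_ge0 _) (hM 0 _); rewrite lexx ler01.
(* as soon as |x - y| >= d, the trivial bound 2 M on the oscillation is at most c (x - y)^2 *)
pose c : R := 2 * M / d ^+ 2.
have c0 : 0 <= c by rewrite divr_ge0 ?sqr_ge0 ?mulr_ge0.
have osc (x y : R) : 0 <= x <= 1 -> 0 <= y <= 1 ->
    `|f x - f y| <= e / 2 + c * (x - y) ^+ 2.
  move=> x01 y01; have [xyd|dxy] := ltP `|x - y| d.
    apply: le_trans (ltW (hd _ _ x01 xyd)) _.
    by rewrite lerDl mulr_ge0 ?sqr_ge0.
  apply: (@le_trans _ _ (2 * M)).
    apply: le_trans (ler_normB _ _) _.
    by have := hM _ x01; have := hM _ y01; lra.
  apply: (@le_trans _ _ (c * (x - y) ^+ 2)); last by rewrite lerDr ltW.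
  rewrite /c mulrAC ler_pdivlMr ?exprn_gt0// ler_wpM2l ?mulr_ge0//.
  by rewrite -(real_normK (num_real (x - y))) ler_pXn2r// ?nnegrE ?ltW.
clearbody c.
have [n hn] : exists n : nat, c / n.+1%:R <= e / 2.
  exists (Num.truncn (c / (e / 2))).
  rewrite ler_pdivrMr// mulrC -ler_pdivrMr//.
  exact: ltW (truncnS_gt _).
pose N := n.+1.
exists (bernstein N (fun k => f (k%:R / N%:R))) => x x01.
have key (sg : R) : sg * sg = 1 ->
    sg * (f x - (bernstein N (fun k => f (k%:R / N%:R))).[x]) <= e.
  move=> sg1.
  have -> : sg * (f x - (bernstein N (fun k => f (k%:R / N%:R))).[x]) =
     (bernstein N (fun k => - sg * f (k%:R / N%:R) + sg * f x)).[x].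
    by rewrite bernstein_lin bernstein_cst; ring.
  apply: (@le_trans _ _ (bernstein N (fun k =>
      c / N%:R ^+ 2 * (k%:R - N%:R * x) ^+ 2 + e / 2)).[x]).
    apply: bernstein_le => // k kN.
    have k01 : 0 <= (k%:R / N%:R : R) <= 1.
      by rewrite divr_ge0//= ler_pdivrMr ?ltr0n// mul1r ler_nat.
    apply: le_trans (_ : `|f x - f (k%:R / N%:R)| <= _).
      have -> : - sg * f (k%:R / N%:R) + sg * f x = sg * (f x - f (k%:R / N%:R)).
        by ring.
      apply: le_trans (ler_norm _) _; rewrite normrM.
      suff -> : `|sg| = 1 by rewrite mul1r.
      have : `|sg| ^+ 2 = 1 by rewrite real_normK ?num_real// expr2.
      by move/eqP; rewrite sqrp_eq1// => /eqP.
    apply: le_trans (osc _ _ x01 k01) _; rewrite addrC lerD2r.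
    rewrite le_eqVlt; apply/orP; left; apply/eqP; field.
    by rewrite pnatr_eq0.
  rewrite bernstein_lin bernstein_cst bernstein_moment2 subrr expr0n/= addr0.
  suff : c / N%:R ^+ 2 * (N%:R * x * (1 - x)) <= e / 2 by lra.
  apply: le_trans hn.
  have -> : c / N%:R ^+ 2 * (N%:R * x * (1 - x)) = c / N%:R * (x * (1 - x)).
    by field; rewrite pnatr_eq0.
  rewrite ler_piMr ?divr_ge0//.
  case/andP: x01 => x0 x1; nra.
rewrite ler_norml; have := key 1; have := key (- 1).
rewrite mulrNN !mul1r mulN1r => /(_ erefl) h1 /(_ erefl) h2; lra.
Qed.

Corollary weierstrass (f : R -> R) (b e : R) : continuous f -> 0 < b -> 0 < e ->
  exists p : {poly R}, forall x : R, 0 <= x <= b -> `|f x - p.[x]| <= e.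
Proof.
move=> cf b0 e0.
have cg : continuous (fun x => f (b * x)).
  move=> x; apply: (@continuous_comp _ _ _ (fun x => b * x) f); last exact: cf.
  exact: mulrl_continuous.
have [p hp] := weierstrass01 cg e0.
exists (p \Po (b^-1 *: 'X)) => x /andP[x0 xb].
rewrite horner_comp !hornerE.
have := hp (b^-1 * x); rewrite mulrA divff ?gt_eqF// mul1r; apply.
by rewrite mulr_ge0 ?invr_ge0 ?(ltW b0)//= mulrC ler_pdivrMr// mul1r.
Qed.

End weierstrass.

(** * Measure-theoretic tools *)
Section measure_tools.
Context d (X : measurableType d) (R : realType).
Variables (m : {measure set X -> \bar R}) (D : set X) (mD : measurable D).
Implicit Types f g : X -> R.

Lemma fatou_le (f_ : nat -> X -> R) (f : X -> R) (c : \bar R) :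
  (forall k, measurable_fun D (f_ k)) -> (forall k x, D x -> 0 <= f_ k x) ->
  (forall x, D x -> f_ k x @[k --> \oo] --> f x) ->
  (forall k, (\int[m]_(x in D) (f_ k x)%:E <= c)%E) ->
  (\int[m]_(x in D) (f x)%:E <= c)%E.
Proof.
move=> mf f0 cf hc.
have h := @fatou _ _ _ m _ mD (fun k x => (f_ k x)%:E).
have -> : (\int[m]_(x in D) (f x)%:E =
           \int[m]_(x in D) limn_einf (fun k => (f_ k x)%:E))%E.
  apply: eq_integral => x /[!inE] Dx.
  have cx : (f_ k x)%:E @[k --> \oo] --> (f x)%:E by apply: cvg_EFin; [near=> k|exact: cf].
  by rewrite is_cvg_limn_einfE ?(cvg_lim _ cx)//; apply/cvg_ex; exists (f x)%:E.
apply: (le_trans (h _ _)).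
- by move=> k; exact/measurable_EFinP.
- by move=> k x Dx; rewrite lee_fin f0.
rewrite limn_einf_lim; apply: lime_le; first exact: is_cvg_einfs.
near=> k; apply: le_trans (hc k).
apply: ereal_inf_lbound; exists k => //=.
Unshelve. all: by end_near. Qed.

(** The integrals of [4^k * h k ^+ 2] have a finite sum, so that [\sum_k 4^k * h k ^+ 2] is
finite almost everywhere; [S] is its square root. *)
Lemma ae_geometric (h : nat -> X -> R) (c : R) : 0 <= c ->
  (forall k, measurable_fun D (h k)) ->
  (forall k, (\int[m]_(x in D) (h k x ^+ 2)%:E <= (c * 16^-1 ^+ k)%:E)%E) ->
  exists N, [/\ measurable N, m N = 0%E & forall x, D x -> ~ N x ->
    exists S : R, forall k, `|h k x| <= S * 2^-1 ^+ k].
Proof.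
move=> c0 mh hh.
(* any ratio between 1 and 16 would leave a summable series and a geometric bound *)
pose g k (x : X) := (4 ^+ k * h k x ^+ 2)%:E.
have mg k : measurable_fun D (g k).
  apply/measurable_EFinP; apply: measurable_funM => //.
  exact: measurable_funX.
have g0 k x : D x -> (0 <= g k x)%E.
  by move=> _; rewrite lee_fin mulr_ge0 ?sqr_ge0 ?exprn_ge0.
have ig : m.-integrable D (fun x => \sum_(k <oo) g k x)%E.
  apply/integrableP; split.
    by apply: ge0_emeasurable_sum => // k x Dx _; exact: g0.
  under eq_integral => x /[!inE] Dx.
    rewrite gee0_abs; last by apply: nneseries_ge0 => k _ _; exact: g0.
    over.
  rewrite integral_nneseries//.
  apply: (@le_lt_trans _ _ (\sum_(k <oo) ((2 * c) / (2 ^ k.+1)%:R)%:E)%E).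
    apply: lee_nneseries => [k _ _|k _]; first by apply: integral_ge0 => x; exact: g0.
    rewrite /g; under eq_integral do rewrite EFinM.
    rewrite ge0_integralZl_EFin//; last 2 first.
    - by move=> x _; rewrite lee_fin sqr_ge0.
    - by apply/measurable_EFinP; exact: measurable_funX.
    apply: (@le_trans _ _ ((4 ^+ k)%:E * (c * 16^-1 ^+ k)%:E)%E).
      by rewrite lee_pmul2l// ?lte_fin ?exprn_gt0.
    have h1 : 4 ^+ k * 16^-1 ^+ k <= (2 ^+ k)^-1 :> R.
      by rewrite -exprMn -exprVn lerXn2r ?nnegrE//; lra.
    have -> : 2 * c / (2 ^ k.+1)%:R = c * (2 ^+ k)^-1 :> R.
      by rewrite natrX exprS; field; exact: expf_neq0.
    by rewrite -EFinM lee_fin mulrCA ler_wpM2l.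
  by apply: le_lt_trans (epsilon_trick0 _ _) (ltry _); rewrite mulr_ge0.
have [N [mN N0 hN]] := integrable_ae mD ig.
exists N; split => // x Dx Nx.
have fx : (\sum_(k <oo) g k x)%E \is a fin_num.
  by apply: contrapT => nfx; apply: Nx; apply: hN => /= /(_ Dx).
exists (Num.sqrt (fine (\sum_(k <oo) g k x)%E)) => k.
have hk : (g k x <= \sum_(k <oo) g k x)%E.
  apply: le_trans (nneseries_lim_ge k.+1 _); last by move=> j _ _; exact: g0.
  rewrite big_nat_recr//= leeDr// sume_ge0// => j _; exact: g0.
have : 4 ^+ k * h k x ^+ 2 <= fine (\sum_(k <oo) g k x)%E by rewrite -lee_fin fineK.
move=> {}hk.
rewrite -(@ler_pXn2r _ 2)// ?nnegrE ?mulr_ge0 ?sqrtr_ge0 ?exprn_ge0 ?invr_ge0//.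
rewrite exprMn sqr_sqrtr; last first.
  by apply: le_trans hk; rewrite mulr_ge0 ?sqr_ge0 ?exprn_ge0.
rewrite real_normK ?num_real//.
have -> : (2^-1 ^+ k) ^+ 2 = (4 ^+ k)^-1 :> R.
  by rewrite -exprM mulnC exprM expr2 -exprVn; congr (_ ^+ _); field.
by rewrite ler_pdivlMr ?exprn_gt0// mulrC.
Qed.

End measure_tools.

Section ae_tools.
Context d (X : measurableType d) (R : realType) (m : {measure set X -> \bar R}).

Lemma ae_mono (P Q : X -> Prop) : {ae m, forall x, P x} -> (forall x, P x -> Q x) ->
  {ae m, forall x, Q x}.
Proof. by move=> hP PQ; apply: filterS hP. Qed.

Lemma ae_and (P Q : X -> Prop) : {ae m, forall x, P x} -> {ae m, forall x, Q x} ->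
  {ae m, forall x, P x /\ Q x}.
Proof. by move=> hP hQ; apply: filterS2 hP hQ. Qed.

End ae_tools.

Section ae_integral.
Context d (X : measurableType d) (R : realType) (m : {measure set X -> \bar R}).
Import HBNNSimple.

Let nnint (f : X -> \bar R) := ereal_sup
  [set sintegral m h | h in [set h : {nnsfun X >-> R} | forall x, ((h x)%:E <= f x)%E]].

Let nnint_ae_le (f g : X -> \bar R) : (forall x, 0 <= g x)%E ->
  {ae m, forall x, f x = g x} -> (nnint f <= nnint g)%E.
Proof.
move=> g0 [N [mN N0 hN]].
apply: ge_ereal_sup => _ [h /= hf <-].
have mNC : measurable (~` N) by exact: measurableC.
(* h is set to zero on the null set, after which it lies below g *)
have -> : sintegral m h = sintegral m (proj_nnsfun h mNC).
  rewrite -!integralT_nnsfun.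
  apply: ge0_ae_eq_integral => //.
  - exact/measurable_EFinP.
  - exact/measurable_EFinP.
  - by move=> x _; rewrite lee_fin.
  - by move=> x _; rewrite lee_fin.
  exists N; split => // x /= hx; apply: contrapT => Nx; apply: hx => _.
  by rewrite /= mindicE mem_set// mulr1.
apply: ereal_sup_ubound; exists (proj_nnsfun h mNC) => //= x.
rewrite mindicE; have [Nx|Nx] := pselect (N x).
  by rewrite memNset/= ?mulr0//; exact.
rewrite mem_set//= mulr1; apply: le_trans (hf x) _.
by have -> : f x = g x by apply: contrapT => fg; apply: Nx; exact: hN.
Qed.

(** The integral of a function, measurable or not, is a difference of suprema over the simple
functions below it, and a simple function may be set to zero on a null set without
changing its integral. *)
Lemma eq_integral_ae (D : set X) (f g : X -> \bar R) :
  {ae m, forall x, D x -> f x = g x} ->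
  (\int[m]_(x in D) f x = \int[m]_(x in D) g x)%E.
Proof.
move=> fg; rewrite /integral.
have rfg : {ae m, forall x, (f \_ D) x = (g \_ D) x}.
  by apply: filterS fg => x fgx; rewrite /patch; case: ifPn => // /set_mem.
congr (_ - _)%E; apply/eqP; rewrite eq_le; apply/andP; split;
  apply: nnint_ae_le => //; apply: filterS rfg => x;
  by move=> e; rewrite ?funeposE ?funenegE e.
Qed.

Lemma eq_Rintegral_ae (D : set X) (f g : X -> R) :
  {ae m, forall x, D x -> f x = g x} ->
  \int[m]_(x in D) f x = \int[m]_(x in D) g x.
Proof.
move=> fg; congr fine; apply: eq_integral_ae.
by apply: filterS fg => x /[apply] ->.
Qed.

End ae_integral.

(** * Strongly measurable functions of time *)
Section simple.
Context {R : realType}.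

Definition simple {A : Type} (g : R -> A) : Prop :=
  finite_set (range g) /\ forall v, measurable (g @^-1` [set v]).

Lemma simple_cst A (a : A) : simple (fun=> a).
Proof.
split; first by apply: (@sub_finite_set _ _ [set a]) => [_ [t _ <-]//|]; exact: finite_set1.
move=> v; have [<-|av] := pselect (a = v).
  by rewrite (_ : _ @^-1` _ = setT)//; apply/seteqP; split.
by rewrite (_ : _ @^-1` _ = set0)//; apply/seteqP; split.
Qed.

Lemma simple_map2 A B C (phi : A -> B -> C) (g : R -> A) (h : R -> B) :
  simple g -> simple h -> simple (fun t => phi (g t) (h t)).
Proof.
move=> [fg mg] [fh mh]; split.
  apply: (@sub_finite_set _ _ ((fun p => phi p.1 p.2) @` (range g `*` range h))).
    by move=> _ [t _ <-]; exists (g t, h t) => //; split; exists t.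
  by apply: finite_image; exact: finite_setX.
move=> c.
rewrite (_ : _ @^-1` _ = \bigcup_(p in (range g `*` range h) `&` [set p | phi p.1 p.2 = c])
    (g @^-1` [set p.1] `&` h @^-1` [set p.2])).
  apply: fin_bigcup_measurable; last by move=> p _; exact: measurableI.
  by apply: (sub_finite_set (@subIsetl _ _ _)); exact: finite_setX.
apply/seteqP; split=> [t/= ht|t [p [_ /= <-]] [/= -> ->]//].
by exists (g t, h t) => //=; split => //=; split; exists t.
Qed.

Lemma simple_comp A B (phi : A -> B) (g : R -> A) : simple g -> simple (phi \o g).
Proof. by move=> sg; exact: (simple_map2 (fun a _ => phi a) sg (simple_cst tt)). Qed.

Lemma simple_measurable (g : R -> R) : simple g -> measurable_fun setT g.
Proof.
move=> [fg mg] _ Y mY; rewrite setTI.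
rewrite (_ : g @^-1` Y = \bigcup_(a in range g `&` Y) (g @^-1` [set a])).
  by apply: fin_bigcup_measurable => //; exact: (sub_finite_set (@subIsetl _ _ _)).
apply/seteqP; split=> [t/= ht|t [a [_ Ya] /= ->]//].
by exists (g t) => //=; split => //; exists t.
Qed.

Lemma simple_mem (B : set R) : measurable B -> simple (fun t => t \in B).
Proof.
move=> mB; split; first exact: finite_finset.
move=> [].
  rewrite (_ : _ @^-1` _ = B)//; apply/seteqP; split=> t /=; first exact: set_mem.
  exact: mem_set.
rewrite (_ : _ @^-1` _ = ~` B); last first.
  apply/seteqP; split=> t /=; first by move=> /negP tB Bt; apply: tB; exact: mem_set.
  by move=> Bt; apply/negP => /set_mem.
exact: measurableC.
Qed.

Lemma simple_restrict A (z : A) (B : set R) (g : R -> A) : measurable B -> simple g ->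
  simple (fun t => if t \in B then g t else z).
Proof.
move=> mB sg; exact: (simple_map2 (fun (c : bool) a => if c then a else z) (simple_mem mB) sg).
Qed.

End simple.

Section simple_cvg.
Context {R : realType}.
Import HBSimple.

Lemma measurable_simple_cvg (f : R -> R) : measurable_fun setT f ->
  exists2 g : nat -> R -> R, (forall k, simple (g k)) &
    forall t, g k t @[k --> \oo] --> f t.
Proof.
move=> mf; have /measurable_EFinP mf' := mf.
have [g hg] := approximation_sfun measurableT mf'.
exists (fun k t => g k t) => [k|t]; last first.
  by have /fine_cvgP[] := hg t I.
split; first exact: (fimfunP (g k)).
by move=> x; rewrite -[X in measurable X]setTI; exact: measurable_funP.
Qed.

End simple_cvg.

Lemma cvg_dist_le {R : realType} (u e : nat -> R) (l : R) :
  (forall k, `|u k - l| <= e k) -> e k @[k --> \oo] --> (0 : R) ->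
  u k @[k --> \oo] --> l.
Proof.
move=> ue e0.
have h1 : l - e k @[k --> \oo] --> l.
  by rewrite -[X in _ --> X]subr0; apply: cvgB => //; exact: cvg_cst.
have h2 : l + e k @[k --> \oo] --> l.
  by rewrite -[X in _ --> X]addr0; apply: cvgD => //; exact: cvg_cst.
apply: (squeeze_cvgr _ h1 h2); apply: nearW => k.
by have := ue k; rewrite ler_distl.
Qed.

Section strongly_measurable.
Context {R : realType} {V : lmodType R} (b : V -> V -> R).

(** The limit is required at every time and not only at almost every time; a class of
functions always has such a representative. *)
Definition smeas (F : R -> V) : Prop :=
  exists2 g : nat -> R -> V, (forall k, simple (g k)) &
    forall t, ipnorm b (g k t - F t) @[k --> \oo] --> (0 : R).

Hypothesis hb : semi_inner b.

Lemma simple_smeas g : simple g -> smeas g.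
Proof.
move=> sg; exists (fun=> g) => // t; rewrite subrr ipnorm0//; exact: cvg_cst.
Qed.

Lemma smeasD F G : smeas F -> smeas G -> smeas (fun t => F t + G t).
Proof.
move=> [f sf cf] [g sg cg]; exists (fun k t => f k t + g k t).
  by move=> k; exact: simple_map2.
move=> t; have h0 : ipnorm b (f k t - F t) + ipnorm b (g k t - G t) @[k --> \oo] --> (0 : R).
  by rewrite -[X in _ --> X](addr0 0); exact: cvgD.
apply: (squeeze_cvgr _ (cvg_cst 0) h0); apply: nearW => k.
by rewrite ipnorm_ge0 opprD addrACA ipnormD.
Qed.

Lemma smeasN F : smeas F -> smeas (fun t => - F t).
Proof.
move=> [f sf cf]; exists (fun k t => - f k t); first by move=> k; exact: simple_comp.
by move=> t; under eq_fun do rewrite -opprD (ipnormN hb); exact: cf.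
Qed.

Lemma smeasB F G : smeas F -> smeas G -> smeas (fun t => F t - G t).
Proof. by move=> sF /smeasN; exact: smeasD. Qed.

Lemma smeas_sum I (r : seq I) (F : I -> R -> V) :
  (forall i, smeas (F i)) -> smeas (fun t => \sum_(i <- r) F i t).
Proof.
move=> sF; elim: r => [|i r ih].
  by under eq_fun do rewrite big_nil; exact/simple_smeas/simple_cst.
by under eq_fun do rewrite big_cons; exact: smeasD.
Qed.

(** Pointwise limits of simple functions may be paired by any continuous bilinear form, as
the pairing of simple functions is simple. *)
Lemma smeas_measurable (b' : V -> V -> R) (c : R) F G :
  (forall u v w, b' (u - v) w = b' u w - b' v w) ->
  (forall u v w, b' u (v - w) = b' u v - b' u w) ->
  (forall u v, `|b' u v| <= c * ipnorm b u * ipnorm b v) ->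
  smeas F -> smeas G -> measurable_fun setT (fun t => b' (F t) (G t)).
Proof.
move=> bl br bc [f sf cf] [g sg cg].
apply: (@measurable_fun_cvg _ _ _ _ (fun k t => b' (f k t) (g k t))).
  by move=> k; apply: simple_measurable; exact: simple_map2.
move=> t _.
have c0 (u v : V) : 0 <= `|c| * ipnorm b u * ipnorm b v.
  by rewrite !mulr_ge0 ?ipnorm_ge0.
pose e k := `|c| * (ipnorm b (f k t - F t) * (ipnorm b (g k t - G t) + ipnorm b (G t)) +
  ipnorm b (F t) * ipnorm b (g k t - G t)).
have e0 : e k @[k --> \oo] --> (0 : R).
  have -> : (0 : R) = `|c| * (0 * (0 + ipnorm b (G t)) + ipnorm b (F t) * 0) by ring.
  apply: cvgMr; apply: cvgD; last by apply: cvgMr; exact: cg.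
  apply: cvgM; first exact: cf.
  by apply: cvgD; [exact: cg|exact: cvg_cst].
apply: cvg_dist_le e0 => k.
have -> : b' (f k t) (g k t) - b' (F t) (G t) =
  b' (f k t - F t) (g k t) + b' (F t) (g k t - G t) by rewrite bl br; ring.
have bc' u v : `|b' u v| <= `|c| * ipnorm b u * ipnorm b v.
  apply: le_trans (bc u v) _; rewrite -!mulrA ler_wpM2r ?ler_norm//.
  by rewrite mulr_ge0 ?ipnorm_ge0.
apply: le_trans (ler_normD _ _) _.
apply: le_trans (lerD (bc' _ _) (bc' _ _)) _.
rewrite /e mulrDr !mulrA lerD2r -!mulrA ler_wpM2l// ler_wpM2l ?ipnorm_ge0//.
by rewrite -{1}(subrK (G t) (g k t)) ipnormD.
Qed.

Lemma smeas_ip_measurable F G : smeas F -> smeas G ->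
  measurable_fun setT (fun t => b (F t) (G t)).
Proof.
apply: (smeas_measurable (c := 1)) => [u v w|u v w|u v].
- by rewrite sipBl.
- by rewrite sipBr.
- by rewrite mul1r normr_sip_le.
Qed.

Lemma smeas_ipnorm_measurable F : smeas F ->
  measurable_fun setT (fun t => ipnorm b (F t)).
Proof.
move=> sF; apply: (@measurableT_comp _ _ _ _ _ _ (@Num.sqrt R)).
  exact: (continuous_measurable_fun (@sqrt_continuous R)).
exact: smeas_ip_measurable.
Qed.

Lemma smeasZfun (f : R -> R) F : measurable_fun setT f -> smeas F ->
  smeas (fun t => f t *: F t).
Proof.
move=> /measurable_simple_cvg[h sh ch] [g sg cg].
exists (fun k t => h k t *: g k t).
  by move=> k; apply: (simple_map2 (fun x y => x *: y)).
move=> t.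
have e0 : `|h k t| * ipnorm b (g k t - F t) + `|h k t - f t| * ipnorm b (F t)
    @[k --> \oo] --> (0 : R).
  have -> : (0 : R) = `|f t| * 0 + `|f t - f t| * ipnorm b (F t).
    by rewrite subrr normr0; ring.
  apply: cvgD.
    by apply: cvgM; [apply: cvg_norm; exact: ch|exact: cg].
  apply: cvgMl; apply: cvg_norm; apply: cvgB; [exact: ch|exact: cvg_cst].
apply: (squeeze_cvgr _ (cvg_cst 0) e0); apply: nearW => k.
rewrite ipnorm_ge0/= -!(ipnormZ hb).
have -> : h k t *: g k t - f t *: F t =
  h k t *: (g k t - F t) + (h k t - f t) *: F t.
  by rewrite scalerBr scalerBl addrA subrK.
exact: ipnormD.
Qed.

End strongly_measurable.

(** * Square integrable functions of time *)
Lemma cvg_sqr {R : realType} (u : nat -> R) (l : R) :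
  u k @[k --> \oo] --> l -> u k ^+ 2 @[k --> \oo] --> l ^+ 2.
Proof. by move=> ul; under eq_fun do rewrite expr2; rewrite expr2; exact: cvgM. Qed.

Section L2time.
Context {R : realType} {V : lmodType R} (b : V -> V -> R).
Hypothesis hb : semi_inner b.
Variables (D : set R) (mD : measurable D).
Local Notation lambda := (@lebesgue_measure R).

Definition sqint (F : R -> V) : \bar R := (\int[lambda]_(t in D) (b (F t) (F t))%:E)%E.

Lemma sqint_ge0 F : (0 <= sqint F)%E.
Proof. by apply: integral_ge0 => t _; rewrite lee_fin (sip_ge0 hb). Qed.

Lemma smeas_sq_measurable F : smeas b F ->
  measurable_fun D (fun t => (b (F t) (F t))%:E).
Proof. by move=> sF; apply/measurable_EFinP/measurable_funTS; exact: smeas_ip_measurable. Qed.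

Lemma sqint_le (F G H : R -> V) : smeas b F -> smeas b G -> smeas b H ->
  (forall t, D t -> b (F t) (F t) <= 2 * b (G t) (G t) + 2 * b (H t) (H t)) ->
  (sqint F <= 2%:E * sqint G + 2%:E * sqint H)%E.
Proof.
move=> sF sG sH h; rewrite /sqint.
rewrite -!ge0_integralZl_EFin//; try by [exact: smeas_sq_measurable|move=> t _; rewrite lee_fin (sip_ge0 hb)].
have p0 F' t : (0 <= 2%:E * (b (F' t) (F' t))%:E)%E.
  by rewrite mule_ge0// lee_fin (sip_ge0 hb).
have pm F' : smeas b F' -> measurable_fun D (fun t => (2%:E * (b (F' t) (F' t))%:E)%E).
  by move=> sF'; apply: measurable_funeM; exact: smeas_sq_measurable.
rewrite -ge0_integralD//; try exact: pm.
apply: ge0_le_integral.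
- exact: mD.
- by move=> t _; rewrite lee_fin (sip_ge0 hb).
- exact: smeas_sq_measurable.
- by apply: emeasurable_funD; exact: pm.
- by move=> t Dt; rewrite -!EFinM -EFinD lee_fin; exact: h.
Qed.

Lemma sqint_trans (F G H : R -> V) (x y : R) : smeas b F -> smeas b G -> smeas b H ->
  (sqint (fun t => (F t - G t)%R) <= x%:E)%E -> (sqint (fun t => (G t - H t)%R) <= y%:E)%E ->
  (sqint (fun t => (F t - H t)%R) <= (2 * x + 2 * y)%:E)%E.
Proof.
move=> sF sG sH h1 h2.
apply: le_trans (sqint_le (G := fun t => F t - G t) (H := fun t => G t - H t) _ _ _ _) _;
  try exact: smeasB.
- by move=> t _; rewrite -{1 2}(subrKA (G t)) sipD_le.
- have -> : (2 * x + 2 * y)%:E = (2%:E * x%:E + 2%:E * y%:E)%E by rewrite -!EFinM -EFinD.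
  by apply: leeD; rewrite lee_pmul2l.
Qed.

Lemma sqintC F G : sqint (fun t => (F t - G t)%R) = sqint (fun t => (G t - F t)%R).
Proof.
by apply: eq_integral => t _; rewrite -!(sqr_ipnorm hb) (ipnormB hb).
Qed.

(** Where an approximant exceeds twice the function it is replaced by [0]; this does
not spoil pointwise convergence, and makes dominated convergence applicable. *)
Lemma sqint_simple_dense F (e : R) : smeas b F -> (sqint F < +oo)%E -> 0 < e ->
  exists2 g, simple g & (sqint (fun t => (g t - F t)%R) <= e%:E)%E.
Proof.
move=> sF Foo e0; have [g sg cg] := sF.
pose B k := [set t | ipnorm b (g k t) <= 2 * ipnorm b (F t)].
have mB k : measurable (B k).
  rewrite -[X in measurable X]setTI; apply: measurable_fun_le => //.
    by apply: smeas_ipnorm_measurable => //; exact: simple_smeas.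
  by apply: measurable_funM => //; exact: smeas_ipnorm_measurable.
pose h k t := if t \in B k then g k t else 0.
have sh k : simple (h k) by exact: simple_restrict.
have hF k t : ipnorm b (h k t) <= 2 * ipnorm b (F t).
  rewrite /h; case: ifPn => [/set_mem//|_].
  by rewrite ipnorm0// mulr_ge0// ipnorm_ge0.
have ch t : ipnorm b (h k t - F t) @[k --> \oo] --> (0 : R).
  have := ipnorm_ge0 (b := b) (F t); rewrite le_eqVlt => /predU1P[Ft0|Ft0].
    have z k : ipnorm b (h k t - F t) = 0.
      apply/eqP; rewrite eq_le ipnorm_ge0 andbT.
      apply: le_trans (ipnormD hb _ _) _; rewrite ipnormN//.
      by have := hF k t; rewrite -Ft0; lra.
    by under eq_fun do rewrite z; exact: cvg_cst.
  apply: cvg_trans (cg t); apply: near_eq_cvg.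
  have /cvgrPdist_lt/(_ _ Ft0) := cg t; apply: filterS => k.
  rewrite sub0r normrN ger0_norm ?ipnorm_ge0// => hk.
  rewrite /h mem_set//=; rewrite /B/=.
  by rewrite -[g k t](subrK (F t)); apply: le_trans (ipnormD hb _ _) _; lra.
have iF : lambda.-integrable D (fun t => (9 * b (F t) (F t))%:E).
  apply/integrableP; split.
    apply/measurable_EFinP; apply: measurable_funM => //.
    by apply: measurable_funTS; exact: smeas_ip_measurable.
  under eq_integral => t _.
    rewrite gee0_abs; last by rewrite lee_fin mulr_ge0// (sip_ge0 hb).
    rewrite EFinM; over.
  rewrite ge0_integralZl_EFin//.
  - by rewrite lte_mul_pinfty.
  - by move=> t _; rewrite lee_fin (sip_ge0 hb).
  - exact: smeas_sq_measurable.
have := @dominated_cvg _ _ _ lambda _ mD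
  (fun k t => (b (h k t - F t) (h k t - F t))%:E) (cst 0%E) _ _ _ _ iF.
rewrite integral0 => cvh.
have : (sqint (fun t => (h k t - F t)%R)) @[k --> \oo] --> 0%E.
  apply: cvh => //.
  - by move=> k; apply: smeas_sq_measurable; apply: smeasB => //; exact: simple_smeas.
  - move=> t _ /=; apply: cvg_EFin; first exact: nearW.
    under eq_fun do rewrite /= -(sqr_ipnorm hb).
    by have := cvg_sqr (ch t); rewrite expr0n.
  - move=> k t _ /=; rewrite ger0_norm ?(sip_ge0 hb)// lee_fin.
    rewrite -(sqr_ipnorm hb) -(sqr_ipnorm hb (F t)).
    have -> : 9 * ipnorm b (F t) ^+ 2 = (3 * ipnorm b (F t)) ^+ 2 by ring.
    rewrite ler_pXn2r ?nnegrE ?mulr_ge0 ?ipnorm_ge0//.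
    apply: le_trans (ipnormD hb _ _) _; rewrite (ipnormN hb).
    by have := hF k t; lra.
move=> /fine_cvgP[finh] /cvgrPdist_lt/(_ _ e0) h0.
have [k [fk hk]] : exists k, sqint (fun t => (h k t - F t)%R) \is a fin_num /\
    `|0 - fine (sqint (fun t => (h k t - F t)%R))| < e.
  have [N _ hN] : \forall k \near \oo, sqint (fun t => (h k t - F t)%R) \is a fin_num /\
    `|0 - fine (sqint (fun t => (h k t - F t)%R))| < e.
    by apply: filterS2 finh h0.
  by exists N; apply: hN => /=.
exists (h k) => //; rewrite -(fineK fk) lee_fin; apply: ltW.
by apply: le_lt_trans hk; rewrite sub0r normrN ler_norm.
Qed.

Hypothesis cb : ip_complete b.

Lemma ip_complete_scaled (c : R) (u : nat -> V) :
  (forall k i, (k <= i)%N -> ipnorm b (u i - u k) <= c * 2^-1 ^+ k) ->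
  exists l, forall k, ipnorm b (u k - l) <= c * 2^-1 ^+ k.
Proof.
move=> hu.
have [n hn] : exists n : nat, c <= 2 ^+ n.
  exists (Num.truncn c).+1; apply: ltW; apply: lt_le_trans (truncnS_gt c) _.
  by rewrite -natrX ler_nat ltnW// ltn_expl.
have [l hl] : exists l, forall k, ipnorm b (u (k + n)%N - l) <= 2^-1 ^+ k; last first.
  exists l => k; apply/ler_addgt0Pr => e e0.
  have [i [ki hi]] : exists i, (k <= i + n)%N /\ 2^-1 ^+ i <= e.
    exists (k + Num.truncn e^-1)%N; split; first by rewrite -addnA leq_addr.
    rewrite exprVn invf_ple ?posrE ?exprn_gt0//.
    apply: le_trans (ltW (truncnS_gt _)) _; rewrite -natrX ler_nat.
    by apply: leq_trans (ltn_expl _ (leqnn 2)) _; rewrite leq_exp2l// leq_addl.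
  rewrite -(subrKA (u (i + n)%N)).
  apply: le_trans (ipnormD hb _ _) _; rewrite (ipnormB hb).
  by apply: lerD; [exact: hu|exact: le_trans (hl i) hi].
apply: cb => k i ki; apply: le_trans (hu _ _ _) _; first by rewrite leq_add2r.
rewrite exprD mulrCA ler_piMr ?exprn_ge0 ?invr_ge0//.
by rewrite exprVn ler_pdivrMr ?exprn_gt0// mul1r.
Qed.

Lemma telescope_geometric (S : R) (u : nat -> V) :
  (forall k, ipnorm b (u k.+1 - u k) <= S * 2^-1 ^+ k) ->
  forall k i, (k <= i)%N -> ipnorm b (u i - u k) <= 2 * S * 2^-1 ^+ k.
Proof.
move=> hu k i ki.
suff : ipnorm b (u i - u k) <= 2 * S * (2^-1 ^+ k - 2^-1 ^+ i).
  move=> h; apply: le_trans h _; rewrite mulrBr gerBl !mulr_ge0 ?exprn_ge0 ?invr_ge0//.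
  by have := le_trans (ipnorm_ge0 _) (hu 0%N); rewrite expr0 mulr1.
elim: i ki => [|i ih].
  by rewrite leqn0 => /eqP ->; rewrite !subrr ipnorm0// mulr0.
rewrite leq_eqVlt => /predU1P[->|]; first by rewrite !subrr ipnorm0// mulr0.
rewrite ltnS => /ih {}ih.
rewrite -(subrKA (u i)); apply: le_trans (ipnormD hb _ _) _.
have := hu i; rewrite (exprS _ i).
have -> : 2 * S * (2^-1 ^+ k - 2^-1 * 2^-1 ^+ i) =
  2 * S * (2^-1 ^+ k - 2^-1 ^+ i) + S * 2^-1 ^+ i by field.
by move=> h; rewrite addrC; apply: lerD.
Qed.

(** Simple functions [g k] near [u k] converge almost everywhere because their
increments are summable in square mean; set to [0] on the exceptional null set, they
witness that the limit is strongly measurable. *)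
Theorem sqint_complete (u : nat -> R -> V) : (forall k, smeas b (u k)) ->
  (forall k, (sqint (u k) < +oo)%E) ->
  (forall k i, (k <= i)%N -> (sqint (fun t => (u i t - u k t)%R) <= (16^-1 ^+ k)%:E)%E) ->
  exists2 rho, smeas b rho &
    forall k, (sqint (fun t => (u k t - rho t)%R) <= (4 * 16^-1 ^+ k)%:E)%E.
Proof.
move=> su uoo hu.
have e0 k : 0 < 16^-1 ^+ k :> R by rewrite exprn_gt0// invr_gt0.
have /choice[g hg] k : exists g, simple g /\ (sqint (fun t => (g t - u k t)%R) <= (16^-1 ^+ k)%:E)%E.
  by have [g sg hg] := sqint_simple_dense (su k) (uoo k) (e0 k); exists g.
have sg k : smeas b (g k) by apply: simple_smeas => //; exact: (hg k).1.
have ug k i : (k <= i)%N -> (sqint (fun t => (u k t - g i t)%R) <= (4 * 16^-1 ^+ k)%:E)%E.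
  move=> ki; have h1 : (sqint (fun t => (u k t - u i t)%R) <= (16^-1 ^+ k)%:E)%E.
    by rewrite sqintC hu.
  have h2 : (sqint (fun t => (u i t - g i t)%R) <= (16^-1 ^+ k)%:E)%E.
    rewrite sqintC; apply: le_trans (hg i).2 _; rewrite lee_fin.
    by apply: ler_wiXn2l => //; lra.
  apply: le_trans (sqint_trans (su k) (su i) (sg i) h1 h2) _.
  by rewrite lee_fin; lra.
have inc k : (sqint (fun t => (g k.+1 t - g k t)%R) <= (16 * 16^-1 ^+ k)%:E)%E.
  have h1 : (sqint (fun t => (g k.+1 t - u k t)%R) <= (4 * 16^-1 ^+ k)%:E)%E.
    by rewrite sqintC ug.
  by apply: le_trans (sqint_trans (sg _) (su k) (sg k) h1 (ug k k (leqnn k))) _;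
    rewrite lee_fin; have := e0 k; lra.
have mh k : measurable_fun D (fun t => ipnorm b (g k.+1 t - g k t)).
  by apply: measurable_funTS; apply: smeas_ipnorm_measurable => //; exact: smeasB.
have inc' k : (\int[lambda]_(t in D) (ipnorm b (g k.+1 t - g k t) ^+ 2)%:E <=
    (16 * 16^-1 ^+ k)%:E)%E.
  by under eq_integral do rewrite sqr_ipnorm//; exact: inc.
have [N [mN N0 hN]] := @ae_geometric _ _ R lambda D mD _ _ (ler0n _ 16) mh inc'.
have mDN : measurable (D `\` N) by exact: measurableD.
have /choice[rho hrho] t : exists l, if t \in D `\` N then
    ipnorm b (g k t - l) @[k --> \oo] --> (0 : R) else l = 0.
  case: (boolP (t \in D `\` N)) => [/set_mem[Dt Nt]|_]; last by exists 0.
  have [S hS] := hN t Dt Nt.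
  have [|l hl] := @ip_complete_scaled (2 * S) (fun k => g k t).
    apply: telescope_geometric => k.
    by apply: le_trans (hS k); exact: ler_norm.
  exists l.
  have h0 : 2 * S * 2^-1 ^+ k @[k --> \oo] --> (0 : R).
    rewrite -[X in _ --> X](mulr0 (2 * S)); apply: cvgMr; apply: cvg_expr.
    by rewrite ger0_norm; lra.
  apply: (squeeze_cvgr _ (cvg_cst 0) h0); apply: nearW => k.
  by rewrite ipnorm_ge0 hl.
pose g' k t := if t \in D `\` N then g k t else 0.
have sg' k : simple (g' k) by apply: simple_restrict => //; exact: (hg k).1.
have cg' t : ipnorm b (g' k t - rho t) @[k --> \oo] --> (0 : R).
  have := hrho t; rewrite /g'; case: ifP => // _ ->.
  by rewrite subrr ipnorm0//; exact: cvg_cst.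
have srho : smeas b rho by exists g'.
exists rho => // k.
have ug' i : (k <= i)%N -> (sqint (fun t => (u k t - g' i t)%R) <= (4 * 16^-1 ^+ k)%:E)%E.
  move=> ki; apply: le_trans (ug k i ki); rewrite le_eqVlt; apply/orP; left; apply/eqP.
  apply: eq_integral_ae; exists N; split => // t /= ht; apply: contrapT => Nt; apply: ht => Dt.
  by rewrite /g' mem_set.
apply: (@fatou_le _ _ R lambda D mD (fun i t => b (u k t - g' (i + k)%N t) (u k t - g' (i + k)%N t))) => //.
- move=> i; apply: measurable_funTS; apply: smeas_ip_measurable => //;
  by apply: smeasB => //; exact: simple_smeas.
- by move=> i t _; rewrite (sip_ge0 hb).
- move=> t _; under eq_fun do rewrite -(sqr_ipnorm hb).
  rewrite -(sqr_ipnorm hb); apply: cvg_sqr.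
  have h0 : ipnorm b (g' (i + k)%N t - rho t) @[i --> \oo] --> (0 : R).
    by rewrite (cvg_shiftn k (fun i => ipnorm b (g' i t - rho t))); exact: cg'.
  apply: cvg_dist_le h0 => i.
  apply: le_trans (ipnorm_dist hb _ _) _.
  by rewrite opprB addrC addrA subrK (ipnormB hb).
- by move=> i; apply: ug'; rewrite leq_addl.
Qed.

End L2time.

(** * Exponential solutions of the evolution equation *)
Section exponential.
Context {R : realType}.

Lemma is_derive_bigsum (m : nat) (f : 'I_m -> R -> R) (df : 'I_m -> R) (t : R) :
  (forall i, is_derive t 1 (f i) (df i)) ->
  is_derive t 1 (fun x => \sum_(i < m) f i x) (\sum_(i < m) df i).
Proof.
move=> h; rewrite (_ : (fun x => _) = \sum_(i < m) f i); first exact: is_derive_sum.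
by apply/funext => x; rewrite fct_sumE.
Qed.

Lemma is_derive_expRM (c t : R) : is_derive t 1 (fun x => expR (c * x)) (c * expR (c * t)).
Proof.
have h : is_derive t 1 (fun x : R => c * x) c.
  by apply: is_derive_eq; rewrite /GRing.scale/= mulr1.
by apply: is_derive_eq; rewrite mulrC.
Qed.

Lemma is_derive_continuous (f : R -> R) (df t : R) : is_derive t 1 f df -> {for t, continuous f}.
Proof.
by move=> [dft _]; apply: differentiable_continuous; exact/derivable1_diffP.
Qed.

Context {V : lmodType R}.

(** The exponents start at one, so that the sum vanishes at [-oo]. *)
Definition expsum (m : nat) (c : nat -> V) (t : R) : V :=
  \sum_(k < m) expR (k.+1%:R * t) *: c k.

Definition expsum_dcoef (c : nat -> V) (k : nat) : V := k.+1%:R *: c k.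

(** Padding with zero coefficients brings two sums to the same number of terms. *)
Lemma expsum_pad (m n : nat) (c : nat -> V) t : (m <= n)%N ->
  expsum n (fun k => if (k < m)%N then c k else 0) t = expsum m c t.
Proof.
move=> mn; rewrite /expsum (big_ord_widen _ (fun k => expR (k.+1%:R * t) *: c k) mn).
rewrite [RHS]big_mkcond/=; apply: eq_bigr => i _.
by case: ifP => // _; rewrite scaler0.
Qed.

Lemma expsumD m c d t : expsum m (fun k => c k + d k) t = expsum m c t + expsum m d t.
Proof. by rewrite /expsum -big_split/=; apply: eq_bigr => i _; rewrite scalerDr. Qed.

Lemma expsumN m c t : expsum m (fun k => - c k) t = - expsum m c t.
Proof. by rewrite /expsum -sumrN; apply: eq_bigr => i _; rewrite scalerN. Qed.

Lemma ip_expsum (b : V -> V -> R) m c d t : semi_inner b ->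
  b (expsum m c t) (expsum m d t) =
  \sum_(i < m) \sum_(j < m) b (c i) (d j) * (expR (i.+1%:R * t) * expR (j.+1%:R * t)).
Proof.
move=> hb; rewrite /expsum (sip_suml hb); apply: eq_bigr => i _.
rewrite (sip_sumr hb); apply: eq_bigr => j _.
by rewrite (sipZl hb) (sipZr hb); ring.
Qed.

Lemma is_derive_ip_expsum (b : V -> V -> R) m c d (t : R) : semi_inner b ->
  is_derive t 1 (fun t => b (expsum m c t) (expsum m d t))
    (b (expsum m (expsum_dcoef c) t) (expsum m d t) +
     b (expsum m c t) (expsum m (expsum_dcoef d) t)).
Proof.
move=> hb; under eq_fun do rewrite ip_expsum//.
rewrite !ip_expsum// -big_split/=; apply: is_derive_bigsum => i.
rewrite -big_split/=; apply: is_derive_bigsum => j.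
have hi := is_derive_expRM i.+1%:R t; have hj := is_derive_expRM j.+1%:R t.
apply: is_derive_eq; rewrite /expsum_dcoef (sipZl hb) (sipZr hb) /GRing.scale/=; ring.
Qed.

Lemma continuous_ip_expsum (b : V -> V -> R) m c d : semi_inner b ->
  continuous (fun t => b (expsum m c t) (expsum m d t)).
Proof. by move=> hb t; exact: (is_derive_continuous (is_derive_ip_expsum m c d t hb)). Qed.

Lemma smeas_expsum (b : V -> V -> R) m c : semi_inner b -> smeas b (expsum m c).
Proof.
move=> hb; apply: (smeas_sum hb) => i; apply: smeasZfun => //; last first.
  exact/simple_smeas/simple_cst.
apply: continuous_measurable_fun => t.
exact: (is_derive_continuous (is_derive_expRM _ _)).
Qed.

Lemma expsum_at0 m c : expsum m c 0 = \sum_(k < m) c k.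
Proof. by apply: eq_bigr => i _; rewrite mulr0 expR0 scale1r. Qed.

End exponential.

Section resolvent.
Context {R : realType} {V : lmodType R} (a h : V -> V -> R) (Cp : R).
Hypotheses (ha : semi_inner a) (hh : semi_inner h) (ca : ip_complete a).
Hypotheses (Cp0 : 0 <= Cp) (hCp : forall u, h u u <= Cp * a u u).

(** Both forms are read on one space: through the Riesz representation of the form [a],
the equation [(k + A) v = g] in the dual space becomes this relation, where [r]
represents [g]. *)
Definition resolves (k : R) (v r : V) : Prop := forall w, a r w = k * h v w + a v w.

Lemma ipnorm_hle u : ipnorm h u <= Num.sqrt Cp * ipnorm a u.
Proof. exact: ipnorm_dom. Qed.

Lemma normr_hle u v : `|h u v| <= Cp * ipnorm a u * ipnorm a v.
Proof.
apply: le_trans (normr_sip_le hh u v) _.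
apply: le_trans (ler_pM (ipnorm_ge0 _) (ipnorm_ge0 _) (ipnorm_hle u) (ipnorm_hle v)) _.
rewrite le_eqVlt; apply/orP; left; apply/eqP.
have := sqr_sqrtr Cp0; set q := Num.sqrt Cp => <-; ring.
Qed.

(** Riesz representation for the form [k * h + a], which is equivalent to [a]. *)
Lemma resolvent_exists (k : R) r : 0 <= k -> exists v, resolves k v r.
Proof.
move=> k0; pose b u v := k * h u v + a u v.
have hb : semi_inner b.
  split=> [x u v w|u v|u]; rewrite /b.
  - by rewrite (sip_linear hh) (sip_linear ha); ring.
  - by rewrite (sip_sym hh) (sip_sym ha).
  - by rewrite addr_ge0 ?mulr_ge0 ?(sip_ge0 hh) ?(sip_ge0 ha).
have hab u : a u u <= b u u by rewrite /b lerDr mulr_ge0 ?(sip_ge0 hh).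
have [|||||v hv] := @riesz _ _ a b hb ca (k * Cp + 1) (a r) (ipnorm a r).
- by rewrite addr_ge0// mulr_ge0.
- exact: hab.
- by move=> u; rewrite /b mulrDl mul1r lerD2r -mulrA ler_wpM2l.
- by move=> x u v; rewrite (sipDr ha) (sipZr ha).
- move=> u; apply: le_trans (normr_sip_le ha _ _) _.
  by rewrite ler_wpM2l ?ipnorm_ge0// /ipnorm ler_wsqrtr.
by exists v => w; rewrite -hv.
Qed.

Lemma resolvent_inv_exists (k : R) v : exists r, resolves k v r.
Proof.
have [|||||r hr] := @riesz _ _ a a ha ca 1 (fun w => k * h v w + a v w)
  (`|k| * Cp * ipnorm a v + ipnorm a v).
- by [].
- by [].
- by move=> u; rewrite mul1r.
- by move=> x u w; rewrite !(sipDr ha, sipZr ha, sipDr hh, sipZr hh); ring.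
- move=> u; apply: le_trans (ler_normD _ _) _; rewrite mulrDl.
  apply: lerD; last exact: normr_sip_le.
  by rewrite normrM -!mulrA ler_wpM2l// mulrA normr_hle.
by exists r.
Qed.

Section energy.
Variables (m : nat) (v r : nat -> V).
Hypothesis hvr : forall k, resolves k.+1%:R (v k) (r k).
Let U := expsum m v.
Let G := expsum m r.

(** Multiply the relation for each [k] by [expR (k.+1%:R * t)] and sum. *)
Lemma expsum_equation t w : h (expsum m (expsum_dcoef v) t) w = a (G t) w - a (U t) w.
Proof.
rewrite /G /U /expsum (sip_suml hh) !(sip_suml ha) -sumrB.
apply: eq_bigr => i _; rewrite !(sipZl hh, sipZl ha) hvr; ring.
Qed.

Lemma is_derive_pairing (t : R) w :
  is_derive t 1 (fun t => h (U t) w) (a (G t) w - a (U t) w).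
Proof.
rewrite -expsum_equation /U /expsum (sip_suml hh).
under eq_fun do rewrite (sip_suml hh).
apply: is_derive_bigsum => i; have hi := is_derive_expRM i.+1%:R t.
under eq_fun do rewrite (sipZl hh).
by apply: is_derive_eq; rewrite !(sipZl hh) /GRing.scale/=; ring.
Qed.

Lemma is_derive_energy (t : R) :
  is_derive t 1 (fun t => h (U t) (U t)) (2 * (a (G t) (U t) - a (U t) (U t))).
Proof.
have := is_derive_ip_expsum m v v t hh.
rewrite (sip_sym hh (expsum m v t)) expsum_equation => d.
by apply: is_derive_eq; rewrite -/U; ring.
Qed.

(** The difference of the two sides is [a (G - U) (G - U)]. *)
Lemma energy_derive_le t :
  2 * (a (G t) (U t) - a (U t) (U t)) <= a (G t) (G t) - a (U t) (U t).
Proof. by have := sip_young ha (G t) (U t); lra. Qed.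

End energy.
End resolvent.

(** * Energy estimates *)
Section energy_integrals.
Context {R : realType}.
Local Notation lambda := (@lebesgue_measure R).

Lemma continuous_integrable_itv (f : R -> R) (x y : R) : continuous f ->
  lambda.-integrable `[x, y] (EFin \o f).
Proof.
by move=> cf; apply: continuous_compact_integrable;
  [exact: segment_compact|exact: continuous_subspaceT].
Qed.

Lemma FTC2_continuous (F f : R -> R) (x y : R) : x <= y -> continuous f ->
  (forall t : R, is_derive t 1 F (f t)) ->
  \int[lambda]_(t in `[x, y]) f t = F y - F x.
Proof.
rewrite le_eqVlt => /predU1P[->|xy] cf dF.
  by rewrite set_itv1 Rintegral_set1 subrr.
have cF : continuous F by move=> t; exact: is_derive_continuous (dF t).
rewrite /Rintegral (continuous_FTC2 xy (F := F))//.
- exact: continuous_subspaceT.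
- split; first by move=> t _; have [] := dF t.
  + by apply: cvg_at_right_filter; exact: cF.
  + by apply: cvg_at_left_filter; exact: cF.
- by move=> t _; rewrite derive1E derive_val.
Qed.

Lemma le_integral_of_derive_le (F f p q : R -> R) (x y : R) : x <= y ->
  continuous f -> continuous p -> continuous q ->
  (forall t : R, is_derive t 1 F (f t)) -> (forall t, f t <= q t - p t) ->
  F y + \int[lambda]_(t in `[x, y]) p t <= F x + \int[lambda]_(t in `[x, y]) q t.
Proof.
move=> xy cf cp cq dF hf.
have h : \int[lambda]_(t in `[x, y]) f t <= \int[lambda]_(t in `[x, y]) (q t - p t).
  apply: le_Rintegral => //; try exact: continuous_integrable_itv.
  by apply: continuous_integrable_itv => t; apply: continuousB; [exact: cq|exact: cp].
move: h; rewrite (FTC2_continuous xy cf dF) RintegralB//; try exact: continuous_integrable_itv.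
lra.
Qed.

Lemma RintegralE_itv (f : R -> R) (x y : R) : continuous f ->
  (\int[lambda]_(t in `[x, y]) (f t)%:E)%E = (\int[lambda]_(t in `[x, y]) f t)%:E.
Proof.
move=> cf; rewrite /Rintegral fineK//; apply: integrable_fin_num => //.
exact: continuous_integrable_itv.
Qed.

End energy_integrals.

Section energy_estimates.
Context {R : realType} {V : lmodType R} (a h : V -> V -> R).
Hypotheses (ha : semi_inner a) (hh : semi_inner h).
Local Notation lambda := (@lebesgue_measure R).
Variables (m : nat) (v r : nat -> V).
Hypothesis hvr : forall k, resolves a h k.+1%:R (v k) (r k).
Let U := expsum m v.
Let G := expsum m r.

Lemma energy_le (x y : R) : x <= y ->
  ((h (U y) (U y))%:E + sqint a `[x, y] U <= (h (U x) (U x))%:E + sqint a `[x, y] G)%E.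
Proof.
move=> xy.
rewrite /sqint !RintegralE_itv; try exact: continuous_ip_expsum.
rewrite -!EFinD lee_fin.
apply: (@le_integral_of_derive_le R (fun t => h (U t) (U t))
  (fun t => 2 * (a (G t) (U t) - a (U t) (U t)))
  (fun t => a (U t) (U t)) (fun t => a (G t) (G t)) x y xy).
- have c1 := @continuous_ip_expsum R V a m r v ha; have c2 := @continuous_ip_expsum R V a m v v ha.
  by move=> t; apply: cvgMr; apply: cvgB; [exact: c1|exact: c2].
- exact: (@continuous_ip_expsum R V a m v v ha).
- exact: (@continuous_ip_expsum R V a m r r ha).
- by move=> t; exact: (is_derive_energy ha hh m hvr).
- by move=> t; exact: (energy_derive_le ha m v r t).
- exact: (@continuous_ip_expsum R V a m r r ha).
- exact: (@continuous_ip_expsum R V a m v v ha).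
Qed.

(** All the exponents are positive, so that [U] vanishes at [-oo]: the energy at time
[0] is at most the integral of the right-hand side over the past. *)
Lemma energy_from_past (c : R) :
  (forall t : R, t <= 0 -> a (G t) (G t) <= c * expR (2 * t)) -> h (U 0) (U 0) <= c.
Proof.
move=> hG.
(* the bound on the energy is the primitive of the bound on its derivative *)
pose f t := c / 2 * expR (2 * t) - h (U t) (U t).
have df (t : R) : is_derive t 1 f (c * expR (2 * t) -
    2 * (a (G t) (U t) - a (U t) (U t))).
  have h1 := is_derive_expRM 2 t; have h2 := is_derive_energy ha hh m hvr t.
  by apply: is_derive_eq; rewrite /GRing.scale/=; field.
have c0 : 0 <= c.
  by have := le_trans (sip_ge0 ha _) (hG 0 (lexx _)); rewrite mulr0 expR0 mulr1.
have mono (t : R) : t <= 0 -> f t <= f 0.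
  move=> t0.
  have df1 x : x \in `]t, 0[ -> derivable f x 1 by move=> _; have [] := df x.
  have df2 x : x \in `]t, 0[ -> 0 <= f^`()%classic x.
    rewrite in_itv/= => /andP[_ x0].
    rewrite derive1E; have [_ ->] := df x.
    have := energy_derive_le ha m v r x; have := hG x (ltW x0).
    by have := sip_ge0 ha (expsum m v x); rewrite -/U -/G; lra.
  have cf : {within `[t, 0], continuous f}.
    by apply: continuous_subspaceT => x; exact: is_derive_continuous (df x).
  by apply: (ger0_derive1_le df1 df2 cf); rewrite ?in_itv/= ?lexx ?t0.
pose M : R := \sum_(i < m) \sum_(j < m) `|h (v i) (v j)|.
have M0 : 0 <= M by rewrite sumr_ge0// => i _; rewrite sumr_ge0.
have decay (t : R) : t <= 0 -> h (U t) (U t) <= M * expR t.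
  move=> t0; rewrite /U ip_expsum// mulr_suml; apply: ler_sum => i _.
  rewrite mulr_suml; apply: ler_sum => j _.
  have e1 : expR (i.+1%:R * t) <= expR t.
    rewrite ler_expR -[leRHS]mul1r; apply: ler_wnM2r => //.
    by rewrite ler1n.
  have e2 : expR (j.+1%:R * t) <= 1.
    by rewrite -expR0 ler_expR mulr_ge0_le0.
  have e3 := ler_pM (expR_ge0 _) (expR_ge0 _) e1 e2.
  apply: le_trans (ler_wpM2r _ (ler_norm _)) _; first by rewrite mulr_ge0 ?expR_ge0.
  by rewrite ler_wpM2l//; rewrite mulr1 in e3.
have key (t : R) : t <= 0 -> h (U 0) (U 0) <= c + M * expR t.
  move=> t0; have := mono t t0; rewrite /f mulr0 expR0 mulr1.
  have := decay t t0.
  have : 0 <= c / 2 * expR (2 * t) by rewrite mulr_ge0 ?expR_ge0// divr_ge0.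
  lra.
apply/ler_addgt0Pr => e e0.
apply: le_trans (key (- (M / e)) _) _; first by rewrite oppr_le0 divr_ge0// ltW.
rewrite lerD2l expRN ler_pdivrMr ?expR_gt0//.
apply: (@le_trans _ _ (e * (1 + M / e))).
  by rewrite mulrDr mulr1 mulrCA divff ?gt_eqF// mulr1 lerDr ltW.
by rewrite ler_wpM2l ?(ltW e0)// expR_ge1Dx.
Qed.

End energy_estimates.

(** * Density of the data of exponential solutions *)
Section density.
Context {R : realType} {V : lmodType R} (a h : V -> V -> R) (Cp T : R).
Hypotheses (ha : semi_inner a) (hh : semi_inner h) (ca : ip_complete a).
Hypotheses (Cp0 : 0 <= Cp) (hCp : forall u, h u u <= Cp * a u u) (T0 : 0 < T).
Local Notation lambda := (@lebesgue_measure R).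
Local Notation I := (`]0, T[%classic : set R).

(** The initial value and the source are approximated by the data of one and the same exact
solution, whence the error on both in a single statement. *)
Definition approximable (p : V) (F : R -> V) : Prop := forall e : R, 0 < e ->
  exists m (v r : nat -> V), [/\ forall k, resolves a h k.+1%:R (v k) (r k),
    h (expsum m v 0 - p) (expsum m v 0 - p) <= e &
    (sqint a I (fun t => (expsum m r t - F t)%R) <= e%:E)%E].

Lemma resolvesD k v1 r1 v2 r2 : resolves a h k v1 r1 -> resolves a h k v2 r2 ->
  resolves a h k (v1 + v2) (r1 + r2).
Proof. by move=> h1 h2 w; rewrite !(sipDl ha) (sipDl hh) h1 h2; ring. Qed.

Lemma resolves0 k : resolves a h k 0 0.
Proof. by move=> w; rewrite !(sip0l ha) (sip0l hh) mulr0 addr0. Qed.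

Let mI : measurable I. Proof. exact: measurable_itv. Qed.

Let integral_cstI (c : R) : (\int[lambda]_(t in I) (cst c%:E t) = (c * T)%:E)%E.
Proof.
rewrite integral_cst// EFinM; congr (_ * _)%E.
by have := @lebesgue_measure_itv R `]0, T[; rewrite /= lte_fin T0 oppr0 adde0.
Qed.

Lemma approximableD p q F G : smeas a F -> smeas a G ->
  approximable p F -> approximable q G -> approximable (p + q) (fun t => F t + G t).
Proof.
move=> sF sG hF hG e e0.
have e4 : 0 < e / 4 by rewrite divr_gt0.
have [m1 [v1 [r1 [res1 i1 g1]]]] := hF _ e4.
have [m2 [v2 [r2 [res2 i2 g2]]]] := hG _ e4.
pose pad m (c : nat -> V) k := if (k < m)%N then c k else 0.
exists (maxn m1 m2), (fun k => pad m1 v1 k + pad m2 v2 k),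
  (fun k => pad m1 r1 k + pad m2 r2 k).
have E t c1 c2 : expsum (maxn m1 m2) (fun k => pad m1 c1 k + pad m2 c2 k) t =
    expsum m1 c1 t + expsum m2 c2 t.
  by rewrite expsumD !expsum_pad ?leq_maxl ?leq_maxr.
split.
- move=> k; apply: resolvesD; rewrite /pad; case: ifP => // _; exact: resolves0.
- rewrite E opprD addrACA; apply: le_trans (sipD_le hh _ _) _; lra.
- have sE m c : smeas a (expsum m c) by exact: smeas_expsum.
  apply: le_trans (sqint_le ha mI (G := fun t => expsum m1 r1 t - F t)
    (H := fun t => expsum m2 r2 t - G t) _ _ _ _) _.
  + by apply: smeasB => //; exact: smeasD.
  + exact: smeasB.
  + exact: smeasB.
  + by move=> t _; rewrite E opprD addrACA; exact: sipD_le.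
  have -> : e%:E = (2%:E * (e / 4)%:E + 2%:E * (e / 4)%:E)%E.
    by rewrite -!EFinM -EFinD; congr EFin; field.
  by apply: leeD; rewrite lee_pmul2l.
Qed.

Lemma approximable_closed p F : smeas a F ->
  (forall e : R, 0 < e -> exists G, [/\ smeas a G, approximable p G &
    (sqint a I (fun t => (G t - F t)%R) <= e%:E)%E]) -> approximable p F.
Proof.
move=> sF hF e e0; have e4 : 0 < e / 4 by rewrite divr_gt0.
have [G [sG hG FG]] := hF _ e4.
have [m [v [r [res i g]]]] := hG _ e4.
exists m, v, r; split => //; first by apply: le_trans i _; rewrite ler_pdivrMr//; lra.
have -> : e = 2 * (e / 4) + 2 * (e / 4) by field.
by apply: (sqint_trans ha mI _ sG sF g FG); exact: smeas_expsum.
Qed.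

(** In the variable [x = exp t], approximating [theta t] by [\sum_k c_k exp ((k+1) t)]
is approximating the continuous function [theta (ln x) / x] by a polynomial.  The error
is at most [eta exp t] at every time [t < T], hence is small in the past also, and this
is what makes the initial value small. *)
Lemma approximable_continuous (theta : R -> R) (g : V) : continuous theta ->
  (forall t : R, t <= 0 -> theta t = 0) -> approximable 0 (fun t => theta t *: g).
Proof.
move=> cth th0 e e0.
(* the quotient by x accounts for the exponents starting at one *)
pose psi (x : R) := if 0 < x then theta (ln x) / x else 0.
have cpsi : continuous psi.
  move=> x; have [x1|x1] := ltP x 1.
    have psi0 y : y < 1 -> psi y = 0.
      by move=> y1; rewrite /psi; case: ifP => // y0; rewrite th0 ?mul0r// ln_le0// ltW.
    have nz : {near nbhs x, cst (psi x) =1 psi}.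
      by near=> y; rewrite /= !psi0//; near: y; exact: lt_nbhsl.
    exact: cvg_trans (near_eq_cvg nz) (cvg_cst _).
  have x0 : 0 < x by apply: lt_le_trans x1.
  have c1 : {for x, continuous (fun y => theta (ln y) / y)}.
    apply: continuousM.
      by apply: (@continuous_comp _ _ _ (@ln R) theta); [exact: continuous_ln|exact: cth].
    by apply: continuousV; rewrite ?gt_eqF//; exact: cvg_id.
  have nz : {near nbhs x, (fun y => theta (ln y) / y) =1 psi}.
    by near=> y; rewrite /psi ifT//; near: y; exact: lt_nbhsr.
  rewrite /continuous_at {2}/psi x0; exact: cvg_trans (near_eq_cvg nz) c1.
pose X := expR T.
have X0 : 0 < X by exact: expR_gt0.
pose c := a g g * (1 + X ^+ 2 * T).
have c0 : 0 <= c.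
  by rewrite mulr_ge0 ?(sip_ge0 ha)// addr_ge0// mulr_ge0 ?sqr_ge0// ltW.
have [eta eta0 heta] : exists2 eta : R, 0 < eta & eta ^+ 2 * c <= e.
  have c1 : 0 < c + 1 by rewrite ltr_wpDl.
  exists (Num.sqrt (e / (c + 1))); first by rewrite sqrtr_gt0 divr_gt0.
  rewrite sqr_sqrtr; last by rewrite divr_ge0// ltW.
  by rewrite mulrAC ler_pdivrMr// ler_wpM2l ?(ltW e0)//; lra.
have [p hp] := weierstrass cpsi X0 eta0.
have /choice[v hv] k : exists v, resolves a h k.+1%:R v (p`_k *: g).
  by apply: (resolvent_exists ha hh ca Cp0 hCp); rewrite ler0n.
pose r k := p`_k *: g.
have GE t : expsum (size p) r t = (expR t * p.[expR t]) *: g.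
  rewrite /expsum horner_coef mulr_sumr scaler_suml; apply: eq_bigr => i _.
  by rewrite scalerA -expRM_natl -addn1 natrD mulrDl mul1r expRD expRM_natl; congr (_ *: _); ring.
have err t : t <= T -> `|expR t * p.[expR t] - theta t| <= eta * expR t.
  move=> tT; have := hp (expR t); rewrite expR_ge0 ler_expR tT => /(_ isT).
  rewrite /psi expR_gt0 expRK => h1.
  have -> : expR t * p.[expR t] - theta t = - (expR t * (theta t / expR t - p.[expR t])).
    by field; rewrite gt_eqF ?expR_gt0.
  by rewrite normrN normrM ger0_norm ?expR_ge0// mulrC ler_wpM2r ?expR_ge0.
have sqe (x y : R) : `|x| <= y -> x ^+ 2 <= y ^+ 2.
  move=> xy; rewrite -(real_normK (num_real x)) ler_pXn2r ?nnegrE//.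
  exact: le_trans xy.
exists (size p), v, r; split => //.
- rewrite subr0; apply: (@le_trans _ _ (eta ^+ 2 * a g g)).
    apply: (energy_from_past ha hh (r := r) hv) => t t0.
    rewrite GE (sipZl ha) (sipZr ha).
    have := sqe _ _ (err t (le_trans t0 (ltW T0))); rewrite th0// subr0 => h1.
    have := ler_wpM2r (sip_ge0 ha g) h1.
    have -> : 2 * t = t + t by ring.
    rewrite expRD; congr (_ <= _); ring.
  apply: le_trans heta; rewrite ler_wpM2l ?sqr_ge0// /c mulrDr mulr1 lerDl.
  by rewrite mulr_ge0 ?(sip_ge0 ha)// mulr_ge0 ?sqr_ge0// ltW.
apply: (@le_trans _ _ (\int[lambda]_(t in I) (cst (eta ^+ 2 * X ^+ 2 * a g g)%:E t))%E).
  apply: ge0_le_integral => //.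
  - by move=> t _; rewrite lee_fin (sip_ge0 ha).
  - apply: smeas_sq_measurable => //; apply: smeasB => //; first exact: smeas_expsum.
    apply: smeasZfun => //; first exact: continuous_measurable_fun.
    exact/simple_smeas/simple_cst.
  - move=> t; rewrite /= in_itv/= => /andP[t0 tT]; rewrite lee_fin.
    rewrite GE -scalerBl (sipZl ha) (sipZr ha) mulrA -expr2.
    rewrite ler_wpM2r ?(sip_ge0 ha)// -exprMn.
    apply: sqe; apply: le_trans (err _ (ltW tT)) _.
    by rewrite ler_wpM2l ?(ltW eta0)// ler_expR ltW.
rewrite integral_cstI lee_fin.
apply: le_trans heta; rewrite -subr_ge0 /c.
have -> : eta ^+ 2 * (a g g * (1 + X ^+ 2 * T)) - eta ^+ 2 * X ^+ 2 * a g g * T =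
  eta ^+ 2 * a g g by ring.
by rewrite mulr_ge0 ?sqr_ge0// (sip_ge0 ha).
Unshelve. all: by end_near. Qed.

(** Lusin's argument: by regularity [B] lies between a compact set and an open set inside
[I] whose difference has small measure, and Urysohn's lemma separates the compact set from
the complement of the open one. *)
Lemma urysohn_indicator (B : set R) (e : R) : measurable B -> B `<=` I -> 0 < e ->
  exists theta : R -> R, [/\ continuous theta, forall t, t <= 0 -> theta t = 0 &
    (\int[lambda]_(t in I) ((\1_B t - theta t) ^+ 2)%:E <= e%:E)%E].
Proof.
move=> mB BI e0; have e20 : 0 < e / 2 by rewrite divr_gt0.
have lB : (lambda B < +oo)%E.
  apply: (@le_lt_trans _ _ (lambda I)).
    by apply: le_measure; rewrite ?inE.
  by rewrite lebesgue_measure_itv/= lte_fin T0 oppr0 adde0 ltry.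
have [K [cK KB lK]] := lebesgue_regularity_inner mB lB e20.
(* W is intersected with I so that theta vanishes before time 0 *)
have [W [oW BW lW]] := lebesgue_regularity_outer mB lB e20.
pose W' := W `&` I.
have oW' : open W' by apply: openI => //; exact: interval_open.
have clK : closed K by apply: compact_closed => //; exact: Rhausdorff.
have sep : uniform_separator (~` W') K.
  have /(@normal_separatorP R) := @pseudometric_normal R R.
  apply => //; first by rewrite closedC.
  apply/seteqP; split => // t [nW Kt]; apply: nW; split; first exact/BW/KB.
  exact/BI/KB.
have /(@uniform_separatorP _ R)[theta [cth th01 thW thK]] := sep.
have th_itv t : 0 <= theta t <= 1.
  by have := th01 (theta t) (imageT theta t); rewrite /= in_itv.
exists theta; split => //.
  move=> t t0; apply: thW; exists t => //; move=> [_]; rewrite /= in_itv/=.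
  by move=> /andP[]; rewrite ltNge t0.
have mK : measurable K by exact: closed_measurable.
have mW : measurable W by exact: open_measurable.
apply: (@le_trans _ _ (\int[lambda]_(t in I) (\1_(W `\` K) t)%:E)%E).
  apply: ge0_le_integral => //.
  - by move=> t _; rewrite lee_fin sqr_ge0.
  - apply/measurable_EFinP/measurable_funTS; apply: measurable_funX.
    apply: measurable_funB; first exact: measurable_indic.
    exact: continuous_measurable_fun.
  - by apply/measurable_EFinP/measurable_funTS/measurable_indic; exact: measurableD.
  - move=> t It; rewrite lee_fin !indicE.
    have /andP[t0 t1] := th_itv t.
    have [Kt|nKt] := pselect (K t).
      rewrite (thK (theta t)); last by exists t.
      by rewrite mem_set; [rewrite subrr expr0n/= ler0n|exact: KB].
    have [Wt|nWt] := pselect (W t).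
      rewrite (mem_set (_ : (W `\` K) t))//=.
      by case: (t \in B); rewrite ?mulr1n ?mulr0n; nra.
    rewrite (thW (theta t)); last by exists t => // -[].
    rewrite memNset; last by move=> Bt; apply: nWt; exact: BW.
    by rewrite subrr expr0n/= ler0n.
rewrite integral_indic//; last exact: measurableD.
apply: (@le_trans _ _ (lambda ((W `\` B) `|` (B `\` K)))).
  apply: le_measure; rewrite ?inE.
  - by apply: measurableI => //; exact: measurableD.
  - by apply: measurableU; exact: measurableD.
  - move=> t [[Wt nKt] _]; have [Bt|nBt] := pselect (B t); [by right|by left].
apply: le_trans (measureU2 _ _ _) _; [exact: measurableD|exact: measurableD|].
have -> : e%:E = ((e / 2)%:E + (e / 2)%:E)%E by rewrite -EFinD; congr EFin; field.
by apply: leeD; exact: ltW.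
Qed.

Lemma approximable_indicator (B : set R) (g : V) : measurable B -> B `<=` I ->
  approximable 0 (fun t => \1_B t *: g).
Proof.
move=> mB BI; have sc : smeas a (fun=> g) by exact/simple_smeas/simple_cst.
apply: approximable_closed; first exact: smeasZfun.
move=> e e0; have g1 : 0 < a g g + 1 by rewrite ltr_wpDl ?(sip_ge0 ha).
have [theta [cth th0 hth]] := urysohn_indicator mB BI (divr_gt0 e0 g1).
have mth : measurable_fun setT theta by exact: continuous_measurable_fun.
exists (fun t => theta t *: g); split.
- exact: smeasZfun.
- exact: approximable_continuous.
rewrite /sqint.
have -> : (fun t : R => (a (theta t *: g - \1_B t *: g) (theta t *: g - \1_B t *: g))%:E) =
    (fun t => (a g g)%:E * ((\1_B t - theta t) ^+ 2)%:E)%E.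
  apply/funext => t; rewrite -scalerBl (sipZl ha) (sipZr ha) -EFinM; congr EFin; ring.
rewrite ge0_integralZl_EFin//.
- apply: le_trans (lee_wpmul2l _ hth) _; first by rewrite lee_fin (sip_ge0 ha).
  rewrite -EFinM lee_fin mulrCA ler_piMr ?(ltW e0)//.
  by rewrite ler_pdivrMr// mul1r lerDl.
- by move=> t _; rewrite lee_fin sqr_ge0.
- apply/measurable_EFinP/measurable_funTS; apply: measurable_funX.
  by apply: measurable_funB => //; exact: measurable_indic.
- exact: (sip_ge0 ha).
Qed.

Lemma approximable_cst0 : approximable 0 (fun=> 0).
Proof.
move=> e e0; exists 0%N, (fun=> 0), (fun=> 0); split => //.
- by move=> k; exact: resolves0.
- by rewrite expsum_at0 big_ord0 subrr (sip0l hh) ltW.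
- rewrite /sqint; under eq_integral do rewrite /expsum big_ord0 subrr (sip0l ha).
  by rewrite integral0 lee_fin ltW.
Qed.

Lemma approximable_eq p F G : (forall t, I t -> F t = G t) ->
  approximable p F -> approximable p G.
Proof.
move=> FG hF e e0; have [m [v [r [res i g]]]] := hF e e0; exists m, v, r; split => //.
rewrite /sqint in g *; under eq_integral => t /set_mem It do rewrite -(FG t It).
exact: g.
Qed.

Lemma approximable_simple (F : R -> V) : simple F -> approximable 0 F.
Proof.
move=> [fF mF]; have /finite_seqP[s hs] := fF.
pose B v := F @^-1` [set v] `&` I.
have mB v : measurable (B v) by exact: measurableI.
have hsum (s' : seq V) : approximable 0 (fun t => \sum_(v <- s') \1_(B v) t *: v) /\
    smeas a (fun t => \sum_(v <- s') \1_(B v) t *: v).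
  split; last first.
    apply: smeas_sum => // v; apply: smeasZfun => //.
    exact/simple_smeas/simple_cst.
  elim: s' => [|v s' ih].
    by under eq_fun do rewrite big_nil; exact: approximable_cst0.
  under eq_fun do rewrite big_cons.
  have sc w : smeas a (fun t : R => \1_(B w) t *: w).
    by apply: smeasZfun => //; exact/simple_smeas/simple_cst.
  have := approximableD (sc v) (smeas_sum ha s' sc)
    (approximable_indicator v (mB v) (@subIsetr _ _ _)) ih.
  by rewrite addr0.
apply: approximable_eq (hsum (undup s)).1 => t It.
have Fts : F t \in undup s.
  have : [set` s] (F t) by rewrite -hs; exists t.
  by rewrite mem_undup.
rewrite (bigD1_seq (F t))//= ?undup_uniq// big1_seq.
  by rewrite indicE mem_set ?scale1r ?addr0.
move=> v /andP[vF _]; rewrite indicE memNset ?scale0r// => -[/= Fv _].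
by move: vF; rewrite Fv eqxx.
Qed.

(** Sources with zero initial value are reached from simple functions.  A nonzero initial
value [p] comes from the exact solution [exp (t) p], whose source is then removed. *)
Theorem exponential_density p (F : R -> V) : smeas a F -> (sqint a I F < +oo)%E ->
  approximable p F.
Proof.
have hL2 G : smeas a G -> (sqint a I G < +oo)%E -> approximable 0 G.
  move=> sG Goo; apply: approximable_closed => // e e0.
  have [g sg hg] := sqint_simple_dense ha mI sG Goo e0.
  by exists g; split => //; [exact: simple_smeas|exact: approximable_simple].
move=> sF Foo.
have [r0 hr0] := resolvent_inv_exists ha hh ca Cp0 hCp 1 p.
pose G t := expR t *: - r0.
have mexp : measurable_fun setT (@expR R) by exact: measurable_expR.
have sc (w : V) : smeas a (fun=> w) by exact/simple_smeas/simple_cst.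
have sG : smeas a G by exact: smeasZfun.
have approx1 : approximable p (fun t => expR t *: r0).
  move=> e e0; exists 1%N, (fun k => if k == 0%N then p else 0),
    (fun k => if k == 0%N then r0 else 0); split.
  - by move=> [|k] //=; exact: resolves0.
  - by rewrite expsum_at0 big_ord1/= subrr (sip0l hh) ltW.
  - rewrite /sqint; under eq_integral do rewrite /expsum big_ord1/= mul1r subrr (sip0l ha).
    by rewrite integral0 lee_fin ltW.
have approx2 : approximable 0 G.
  apply: hL2 => //; apply: (@le_lt_trans _ _ (\int[lambda]_(t in I) (cst (expR T ^+ 2 * a r0 r0)%:E t))%E).
    apply: ge0_le_integral => //.
    - by move=> t _; rewrite lee_fin (sip_ge0 ha).
    - exact: smeas_sq_measurable.
    - move=> t; rewrite /= in_itv/= => /andP[t0 tT].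
      rewrite lee_fin /G (sipZl ha) (sipZr ha) (sipNl ha) (sipNr ha) opprK mulrA -expr2.
      rewrite ler_wpM2r ?(sip_ge0 ha)// ler_pXn2r ?nnegrE ?expR_ge0// ler_expR.
      exact: ltW.
  by rewrite integral_cstI ltry.
have := approximableD (smeasD ha (smeasZfun ha mexp (sc r0)) sG) sF
  (approximableD (smeasZfun ha mexp (sc r0)) sG approx1 approx2) (hL2 F sF Foo).
rewrite !addr0; apply: approximable_eq => t _.
by rewrite /G scalerN subrr add0r.
Qed.

End density.

(** * Smooth cutoff functions *)
Section smooth.
Context {R : realType}.

(** Up to the polynomial factors that differentiation brings in, this is the classical
function [exp (- 1 / x)]. *)
Definition flat (m : nat) (x : R) : R := if 0 < x then x^-1 ^+ m * expR (- x^-1) else 0.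

Lemma flat_ge0 m x : 0 <= flat m x.
Proof.
rewrite /flat; case: ifP => // x0.
by rewrite mulr_ge0 ?expR_ge0// exprn_ge0// invr_ge0 ltW.
Qed.

Lemma flat_gt0 x : 0 < x -> 0 < flat 0 x.
Proof. by move=> x0; rewrite /flat x0 expr0 mul1r expR_gt0. Qed.

Lemma flat_le0 m x : x <= 0 -> flat m x = 0.
Proof. by move=> x0; rewrite /flat ltNge x0. Qed.

(** A power of [1 / x] is at most a factorial times the exponential of [1 / x]. *)
Lemma flat_le m x : 0 <= x -> flat m x <= m.+1`!%:R * x.
Proof.
move=> x0; rewrite /flat; case: ifP => [xp|_]; last by rewrite mulr_ge0.
have f0 : 0 < m.+1`!%:R :> R by rewrite ltr0n fact_gt0.
rewrite expRN ler_pdivrMr ?expR_gt0//.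
have := @expR_ge1Dxn R x^-1 m; rewrite invr_ge0 => /(_ x0) h1.
apply: (@le_trans _ _ (m.+1`!%:R * x * (x^-1 ^+ m.+1 / m.+1`!%:R))).
  rewrite exprS le_eqVlt; apply/orP; left; apply/eqP; field.
  by rewrite !gt_eqF.
by rewrite ler_wpM2l ?mulr_ge0//; lra.
Qed.

(** At [0] the difference quotient of [flat m] is [flat m.+1], which tends to [0]. *)
Lemma is_derive_flat m (x : R) :
  is_derive x 1 (flat m) (- m%:R * flat m.+1 x + flat m.+2 x).
Proof.
have [x0|x0|->] := ltgtP x 0.
- rewrite !(flat_le0 _ (ltW x0)) mulr0 addr0.
  have hc : is_derive x 1 (cst 0 : R -> R) 0 by exact: is_derive_cst.
  apply: near_eq_is_derive hc.
  by near=> y; rewrite flat_le0// ltW//; near: y; exact: lt_nbhsl.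
- have xn0 : x != 0 by rewrite gt_eqF.
  have h1 : is_derive x 1 (fun y : R => y^-1) (- x ^- 2).
    by have := is_deriveV xn0 (is_derive_id x 1); rewrite /GRing.scale/= mulr1.
  have h2 : is_derive x 1 (fun y : R => y^-1 ^+ m) (m%:R * x^-1 ^+ m.-1 * - x ^- 2).
    have -> : (fun y : R => y^-1 ^+ m) = (fun y : R => y^-1) ^+ m.
      by rewrite exprfctE.
    exact: is_deriveX.
  have h3 : is_derive x 1 (fun y : R => expR (- y^-1)) (expR (- x^-1) * x ^- 2).
    have h4 : is_derive x 1 (fun y : R => - y^-1) (x ^- 2).
      by have := is_deriveN h1; rewrite opprK.
    exact: is_derive1_comp.
  have h5 : is_derive x 1 (fun y : R => y^-1 ^+ m * expR (- y^-1))
      (- m%:R * flat m.+1 x + flat m.+2 x).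
    apply: is_derive_eq; rewrite /flat x0 /GRing.scale/=.
    case: m {h2} => [|m]; rewrite -?exprVn /= ?exprS; ring.
  apply: near_eq_is_derive h5.
  by near=> y; rewrite /flat ifT//; near: y; exact: lt_nbhsr.
- rewrite !(flat_le0 _ (lexx 0)) mulr0 addr0.
  have n1 : m.+2`!%:R * `|h| @[h --> (0 : R)^'] --> (0 : R).
    rewrite -[X in _ --> X](mulr0 m.+2`!%:R); apply: cvgMr.
    rewrite -[X in _ --> X](normr0 R); apply: cvg_norm.
    by apply: cvg_within_filter; exact: cvg_id.
  have q : h^-1 *: ((flat m \o shift 0) (h *: 1) - flat m 0) @[h --> (0 : R)^'] --> (0 : R).
    apply: (@squeeze_cvgr _ _ _ _ (fun h => - (m.+2`!%:R * `|h|))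
       (fun h => m.+2`!%:R * `|h|)).
    + near=> h; rewrite /= addr0 (flat_le0 _ (lexx 0)) subr0 /GRing.scale/= mulr1 -ler_norml.
      have h0 : h != 0 by near: h; exact: nbhs_dnbhs_neq.
      have [hp|hn] := ltP 0 h; last by rewrite flat_le0// mulr0 normr0 mulr_ge0.
      have -> : h^-1 * flat m h = flat m.+1 h by rewrite /flat hp exprS mulrA.
      by rewrite !ger0_norm ?flat_ge0 ?(ltW hp)// flat_le// ltW.
    + by rewrite -[X in _ --> X]oppr0; exact: cvgN.
    + exact: n1.
  by apply: DeriveDef; [exact: cvgP q|exact: cvg_lim q].
Unshelve. all: by end_near. Qed.

(** A class of functions that contains the cutoffs and is visibly stable under derivation:
having derivatives of all orders is then a matter of iteration
([smooth_derive1n]). *)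
Inductive smooth : (R -> R) -> Prop :=
| smooth_flat m : smooth (flat m)
| smooth_cst c : smooth (fun=> c)
| smooth_exp c : smooth (fun t => expR (c * t))
| smooth_add f g : smooth f -> smooth g -> smooth (fun t => f t + g t)
| smooth_mul f g : smooth f -> smooth g -> smooth (fun t => f t * g t)
| smooth_affine c d f : smooth f -> smooth (fun t => f (c * t + d))
| smooth_inv f : smooth f -> (forall t, f t != 0) -> smooth (fun t => (f t)^-1).

Lemma smooth_is_derive f : smooth f ->
  exists2 df, smooth df & forall t : R, is_derive t 1 f (df t).
Proof.
elim=> {f}.
- move=> m; exists (fun x => - m%:R * flat m.+1 x + flat m.+2 x).
    apply: smooth_add; last exact: smooth_flat.
    by apply: smooth_mul; [exact: smooth_cst|exact: smooth_flat].
  exact: is_derive_flat.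
- by move=> c; exists (fun=> 0); [exact: smooth_cst|move=> t; exact: is_derive_cst].
- move=> c; exists (fun t => c * expR (c * t)).
    by apply: smooth_mul; [exact: smooth_cst|exact: smooth_exp].
  by move=> t; exact: is_derive_expRM.
- move=> f g sf [df sdf hf] sg [dg sdg hg]; exists (fun t => df t + dg t).
    exact: smooth_add.
  by move=> t; have := hf t; have := hg t => ? ?; exact: is_deriveD.
- move=> f g sf [df sdf hf] sg [dg sdg hg]; exists (fun t => f t * dg t + g t * df t).
    by apply: smooth_add; exact: smooth_mul.
  by move=> t; have := hf t; have := hg t => ? ?; exact: is_deriveM.
- move=> c d f sf [df sdf hf]; exists (fun t => c * df (c * t + d)).
    by apply: smooth_mul; [exact: smooth_cst|exact: smooth_affine].
  move=> t; have h1 := hf (c * t + d).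
  have h2 : is_derive t 1 (fun t : R => c * t + d) c.
    by apply: is_derive_eq; rewrite /GRing.scale/= mulr1 addr0.
  by have := @is_derive1_comp R f (fun t => c * t + d) t _ _ h1 h2; rewrite mulrC.
- move=> f sf [df sdf hf] f0; exists (fun t => -1 * ((f t)^-1 * (f t)^-1 * df t)).
    apply: smooth_mul; first exact: smooth_cst.
    by apply: smooth_mul => //; apply: smooth_mul; exact: smooth_inv.
  move=> t; have -> : -1 * ((f t)^-1 / f t * df t) = - f t ^- 2 *: df t.
    by rewrite /GRing.scale/= -exprVn expr2; ring.
  exact: is_deriveV.
Qed.

Lemma smooth_derive1n f k : smooth f -> smooth (derive1n k f).
Proof.
elim: k f => [//|k ih] f sf; rewrite derive1Sn; apply: ih.
have [df sdf hdf] := smooth_is_derive sf.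
by rewrite (_ : derive1 f = df)//; apply/funext => t; rewrite derive1E derive_val.
Qed.

Lemma smooth_derivable f k (t : R) : smooth f -> derivable (derive1n k f) t 1.
Proof.
by move=> /(smooth_derive1n k)/smooth_is_derive[df _ /(_ t)[]].
Qed.

(** The two terms of the denominator are positive after [1] and before [2] respectively, so
that it vanishes nowhere; the function goes from [0] at [1] to [1] at [2]. *)
Definition step (x : R) : R :=
  flat 0 (1 * x + -1) * (flat 0 (1 * x + -1) + flat 0 (-1 * x + 2))^-1.

Lemma step_denom_gt0 x : 0 < flat 0 (1 * x + -1) + flat 0 (-1 * x + 2).
Proof.
have [x1|x1] := ltP 1 x.
  by rewrite ltr_wpDr ?flat_ge0// flat_gt0//; lra.
by rewrite ltr_wpDl ?flat_ge0// flat_gt0//; lra.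
Qed.

Lemma smooth_step : smooth step.
Proof.
apply: smooth_mul; first exact/smooth_affine/smooth_flat.
apply: smooth_inv; last by move=> t; rewrite gt_eqF// step_denom_gt0.
by apply: smooth_add; exact/smooth_affine/smooth_flat.
Qed.

Lemma step0 x : x <= 1 -> step x = 0.
Proof. by move=> x1; rewrite /step flat_le0 ?mul0r//; lra. Qed.

Lemma step1 x : 2 <= x -> step x = 1.
Proof.
move=> x2; rewrite /step [flat 0 (-1 * x + 2)]flat_le0; last by lra.
by rewrite addr0 divff// gt_eqF// flat_gt0//; lra.
Qed.

Lemma step_itv x : 0 <= step x <= 1.
Proof.
have p := step_denom_gt0 x; rewrite /step divr_ge0 ?flat_ge0 ?(ltW p)//=.
by rewrite ler_pdivrMr// [leRHS]mul1r lerDl flat_ge0.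
Qed.

Lemma step_derive : exists2 ds, continuous ds &
  [/\ forall t : R, is_derive t 1 step (ds t), forall t, ~ (1 <= t <= 2) -> ds t = 0 &
    exists2 C, 0 <= C & forall t, `|ds t| <= C].
Proof.
have [ds sds hds] := smooth_is_derive smooth_step.
have cds : continuous ds.
  by have [dds _ hdds] := smooth_is_derive sds; move=> t; exact: is_derive_continuous (hdds t).
exists ds => //.
have ds0 t : ~ (1 <= t <= 2) -> ds t = 0.
  move=> nt; have {nt}[t1|t2] : t < 1 \/ 2 < t.
  - have [t1|t1] := ltP t 1; first by left.
    by right; rewrite ltNge; apply/negP => t2; apply: nt; rewrite t1.
  - have h : is_derive t 1 step 0.
      have hc : is_derive t 1 (cst 0 : R -> R) 0 by exact: is_derive_cst.
      apply: near_eq_is_derive hc.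
      by near=> y; rewrite step0// ltW//; near: y; exact: lt_nbhsl.
    by have [_ <-] := hds t; have [_ ->] := h.
  - have h : is_derive t 1 step 0.
      have hc : is_derive t 1 (cst 1 : R -> R) 0 by exact: is_derive_cst.
      apply: near_eq_is_derive hc.
      by near=> y; rewrite step1// ltW//; near: y; exact: lt_nbhsr.
    by have [_ <-] := hds t; have [_ ->] := h.
split => //.
have cn : {within `[(1 : R), 2], continuous (fun x => `|ds x|)}.
  by apply: continuous_subspaceT => x; apply: continuous_comp; [exact: cds|exact: norm_continuous].
have [c _ hc] := EVT_max (ler1n R 2 : (1 : R) <= 2) cn.
exists `|ds c| => // t; have [t12|nt] := pselect (1 <= t <= 2); last by rewrite ds0 ?normr0.
by apply: hc; rewrite in_itv.
Unshelve. all: by end_near. Qed.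

End smooth.

(** * Integration by parts against weak derivatives *)
Section Rintegral_tools.
Context {R : realType}.
Local Notation lambda := (@lebesgue_measure R).

Lemma Rintegral_dominated_cvg (D : set R) (f_ : nat -> R -> R) (f g : R -> R) :
  measurable D -> (forall n, measurable_fun D (f_ n)) ->
  (forall t, D t -> f_ n t @[n --> \oo] --> f t) ->
  lambda.-integrable D (EFin \o f) ->
  lambda.-integrable D (EFin \o g) -> (forall n t, D t -> `|f_ n t| <= g t) ->
  (\int[lambda]_(t in D) f_ n t) @[n --> \oo] --> \int[lambda]_(t in D) f t.
Proof.
move=> mD mf cf If ig fg; apply: fine_cvg.
have -> : (fine (\int[lambda]_(t in D) (f t)%:E)%E)%:E = (\int[lambda]_(t in D) (f t)%:E)%E.
  by rewrite fineK//; exact: integrable_fin_num.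
apply: (@dominated_cvg _ _ _ lambda D mD (fun n t => (f_ n t)%:E) (EFin \o f) (EFin \o g)) => //.
- by move=> n; apply/measurable_EFinP; exact: mf.
- by move=> t Dt; apply: cvg_EFin; [exact: nearW|exact: cf].
Qed.

(** The image measure agrees with the Lebesgue measure on bounded half-open intervals, which
reflection exchanges up to their endpoints. *)
Lemma lebesgue_measure_reflect (T : R) (A : set R) : measurable A ->
  lambda ((fun t => T - t) @^-1` A) = lambda A.
Proof.
move=> mA.
have mphi : measurable_fun setT (fun t : measurableTypeR R => T - t : measurableTypeR R).
  by apply: measurable_funB => //; exact: measurable_cst.
have := @lebesgue_measure_unique R
  (measure_function_pushforward__canonical__measure_function_Measure lambda mphi).
move=> h; apply/esym; apply: h => //= _ [[a b]] _ <-.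
rewrite /pushforward.
have -> : (fun t : R => T - t) @^-1` `]a, b]%classic = `[T - b, T - a[%classic.
  by apply/seteqP; split => t /=; rewrite !in_itv/= => /andP[? ?]; apply/andP; split; lra.
rewrite !lebesgue_measure_itv/= !lte_fin.
have -> : (T - b < T - a) = (a < b) by apply/idP/idP; lra.
by case: ifP => // _; rewrite -!EFinD; congr EFin; ring.
Qed.

Lemma ge0_integral_reflect (T : R) (f : R -> R) : measurable_fun setT f ->
  (forall t, 0 <= f t) ->
  (\int[lambda]_(t in `]0%R, T[) (f (T - t))%:E = \int[lambda]_(t in `]0%R, T[) (f t)%:E)%E.
Proof.
move=> mf f0.
have mphi : measurable_fun setT (fun t : measurableTypeR R => T - t : measurableTypeR R).
  by apply: measurable_funB => //; exact: measurable_cst.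
have := @ge0_integral_pushforward _ _ _ _ _ _ mphi lambda `]0, T[%classic (EFin \o f).
have -> : (fun t : R => T - t) @^-1` `]0, T[%classic = `]0, T[%classic.
  by apply/seteqP; split => t /=; rewrite !in_itv/= => /andP[? ?]; apply/andP; split; lra.
have mf' : measurable_fun `]0, T[ (EFin \o f) by apply/measurable_EFinP; exact: measurable_funTS mf.
move=> <- //; last by move=> t _; rewrite lee_fin.
apply: eq_measure_integral => A mA _; exact: lebesgue_measure_reflect.
Qed.

End Rintegral_tools.

Section weak_derivative.
Context {R : realType} (T : R) (T0 : 0 < T).
Local Notation lambda := (@lebesgue_measure R).
Local Notation I := (`]0, T[%classic : set R).

Lemma continuous_integrable_oo (f : R -> R) : continuous f -> lambda.-integrable I (EFin \o f).
Proof.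
move=> cf; apply: (@integrableS _ _ _ lambda `[0, T]%classic) => //.
- by apply: subset_itvW; rewrite bnd_simp.
- exact: continuous_integrable_itv.
Qed.

Lemma continuous_measurable_oo (f : R -> R) : continuous f -> measurable_fun I f.
Proof. by move=> cf; apply: measurable_funTS; exact: continuous_measurable_fun. Qed.

(** An approximate Dirac mass: [delta] has integral one, is carried by an interval on which
[k] is almost constant, and is at most [C] times the mean density of that interval. *)
Lemma mean_value_delta (delta k : R -> R) (c d C e p : R) : 0 < c -> c < d -> d < T ->
  continuous delta -> continuous k -> (forall t, ~ (c <= t <= d) -> delta t = 0) ->
  (forall t, `|delta t| <= C / (d - c)) -> \int[lambda]_(t in `[c, d]) delta t = 1 ->
  (forall t, c <= t <= d -> `|k t - k p| <= e) ->
  `|\int[lambda]_(t in I) (delta t * k t) - k p| <= C * e.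
Proof.
move=> c0 cd dT cdel ck del0 delC del1 ke.
have -> : \int[lambda]_(t in I) (delta t * k t) = \int[lambda]_(t in `[c, d]) (delta t * k t).
  rewrite Rintegral_mkcond [RHS]Rintegral_mkcond; apply: eq_Rintegral => t _.
  rewrite /patch; case: ifPn => tI; case: ifPn => tcd //.
  - rewrite del0 ?mul0r// => tcd'; move/negP: tcd; apply; apply/mem_set.
    by rewrite /= in_itv.
  - exfalso; move/negP: tI; apply; apply/mem_set; move/set_mem: tcd.
    by rewrite /= !in_itv/= => /andP[? ?]; apply/andP; split; lra.
have i1 : lambda.-integrable `[c, d] (EFin \o (fun t => delta t * k t)).
  by apply: continuous_integrable_itv => t; apply: cvgM; [exact: cdel|exact: ck].
have i2 : lambda.-integrable `[c, d] (EFin \o (fun t => delta t * k p)).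
  by apply: continuous_integrable_itv => t; apply: cvgMl; exact: cdel.
have i3 : lambda.-integrable `[c, d] (EFin \o delta) by exact: continuous_integrable_itv.
have -> : k p = \int[lambda]_(t in `[c, d]) (delta t * k p).
  by rewrite RintegralZr// del1 mul1r.
rewrite -RintegralB//.
apply: le_trans (le_normr_Rintegral _ _) _ => //.
  by apply: continuous_integrable_itv => t; apply: cvgB;
    [apply: cvgM; [exact: cdel|exact: ck]|apply: cvgMl; exact: cdel].
apply: (@le_trans _ _ (\int[lambda]_(t in `[c, d]) (cst (C / (d - c) * e) t))).
  apply: le_Rintegral => //.
  - apply: continuous_integrable_itv => t; apply: cvg_norm; apply: cvgB;
      [apply: cvgM; [exact: cdel|exact: ck]|apply: cvgMl; exact: cdel].
  - by apply: continuous_integrable_itv => t; exact: cvg_cst.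
  - move=> t; rewrite /= in_itv/= => tcd; rewrite -mulrBr normrM.
    by apply: ler_pM => //; exact: ke.
have lcd : lambda `[c, d]%classic = (d - c)%:E by rewrite lebesgue_measure_itv/= lte_fin cd EFinB.
have -> : \int[lambda]_(t in `[c, d]) (cst (C / (d - c) * e) t) =
    C / (d - c) * e * fine (lambda `[c, d]%classic) by exact: Rintegral_cst.
rewrite lcd /=.
by rewrite mulrAC divfK// gt_eqF// subr_gt0.
Qed.

Section cutoff.
Let eps (n : nat) : R := T / (n%:R + 4).
Let eps_gt0 n : 0 < eps n. Proof. by rewrite divr_gt0// ltr_wpDl. Qed.
Let eps_le n : eps n * 4 <= T.
Proof.
rewrite /eps mulrAC ler_pdivrMr ?ltr_wpDl// ler_wpM2l ?(ltW T0)//.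
by rewrite lerDr.
Qed.
Let eps_cvg (x : R) : 0 < x -> \forall n \near \oo, eps n <= x.
Proof.
move=> x0; exists (Num.truncn (T / x)).+1 => // n /= hn.
rewrite /eps ler_pdivrMr ?ltr_wpDl//.
have : T / x < n%:R by apply: lt_le_trans (truncnS_gt _) _; rewrite ler_nat.
rewrite ltr_pdivrMr// mulrC => h; apply: ltW; apply: lt_le_trans h _.
by rewrite ler_wpM2l ?(ltW x0)// lerDl.
Qed.

(** The cutoff [chi n] equals [1] between [2 eps] and [T - 2 eps] and vanishes before
[eps] and after [T - eps]; its derivative tends to a Dirac mass at [0] minus a Dirac
mass at [T], which produces the boundary terms. *)
Let chi n (t : R) : R := step ((eps n)^-1 * t + 0) +
  -1 * step ((eps n)^-1 * t + (3 - T / eps n)).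

Let epsV n (t b : R) : (eps n)^-1 * t + b = (t + b * eps n) / eps n.
Proof. by field; rewrite gt_eqF. Qed.

Let chi_smooth n : smooth (chi n).
Proof.
apply: smooth_add; first exact/smooth_affine/smooth_step.
by apply: smooth_mul; [exact: smooth_cst|exact/smooth_affine/smooth_step].
Qed.

Let shiftE n t : (eps n)^-1 * t + (3 - T / eps n) = (t - T + 3 * eps n) / eps n.
Proof. by field; rewrite gt_eqF. Qed.

Let chi0 n t : ~ (eps n <= t <= T - eps n) -> chi n t = 0.
Proof.
move=> nt; have e0 := eps_gt0 n; have e4 := eps_le n.
have {nt}[t1|t1] : t <= eps n \/ T - eps n <= t.
- have [|h] := leP t (eps n); first by left.
  right; rewrite leNgt; apply/negP => h2; apply: nt; apply/andP; split; lra.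
- rewrite /chi !step0 ?mulr0 ?addr0// ?shiftE ?addr0.
  + by rewrite ler_pdivrMr// mul1r; lra.
  + by rewrite mulrC ler_pdivrMr// mul1r.
- rewrite /chi !step1 ?mulr1 ?subrr// ?shiftE ?addr0.
  + by rewrite ler_pdivlMr//; lra.
  + by rewrite mulrC ler_pdivlMr//; lra.
Qed.

Let chi_le1 n t : `|chi n t| <= 1.
Proof.
rewrite /chi; have := step_itv ((eps n)^-1 * t + 0).
have := step_itv ((eps n)^-1 * t + (3 - T / eps n)).
by rewrite ler_norml; lra.
Qed.

Let chi_cvg t : I t -> chi n t @[n --> \oo] --> (1 : R).
Proof.
rewrite /= in_itv/= => /andP[t0 tT].
have h1 : \forall n \near \oo, eps n <= t / 2 by apply: eps_cvg; rewrite divr_gt0.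
have h2 : \forall n \near \oo, eps n <= (T - t) / 2.
  by apply: eps_cvg; rewrite divr_gt0// subr_gt0.
apply: cvg_near_cst; apply: filterS2 h1 h2 => n h1 h2.
have e0 := eps_gt0 n.
rewrite /chi [X in X + _]step1 ?[step (_ + (3 - _))]step0 ?mulr0 ?addr0// ?shiftE ?addr0.
- by rewrite ler_pdivrMr// mul1r; lra.
- by rewrite mulrC ler_pdivlMr//; lra.
Qed.

Let delta_limit (k : R -> R) : continuous k ->
  exists2 dchi : nat -> R -> R, (forall n (t : R), is_derive t 1 (chi n) (dchi n t)) /\
      (forall n, continuous (dchi n)) &
    (\int[lambda]_(t in I) (dchi n t * k t)) @[n --> \oo] --> k 0 - k T.
Proof.
move=> ck; have [ds cds [hds ds0 [C C0 hC]]] := @step_derive R.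
pose del n (b t : R) := (eps n)^-1 * ds ((eps n)^-1 * t + b).
have ddel n (b : R) (t : R) : is_derive t 1 (fun t => step ((eps n)^-1 * t + b)) (del n b t).
  have h1 := hds ((eps n)^-1 * t + b).
  have h2 : is_derive t 1 (fun t : R => (eps n)^-1 * t + b) (eps n)^-1.
    by apply: is_derive_eq; rewrite /GRing.scale/= mulr1 addr0.
  by have := @is_derive1_comp R step (fun t => (eps n)^-1 * t + b) t _ _ h1 h2; rewrite mulrC.
have cdel n b : continuous (del n b).
  move=> t; apply: cvgMr; apply: (@continuous_comp _ _ _ (fun t => (eps n)^-1 * t + b) ds).
    by apply: cvgD; [exact: mulrl_continuous|exact: cvg_cst].
  exact: cds.
exists (fun n t => del n 0 t - del n (3 - T / eps n) t).
  split => [n t|n t].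
    have h1 := ddel n 0 t; have h2 := ddel n (3 - T / eps n) t.
    by apply: is_derive_eq; rewrite /GRing.scale/=; ring.
  by apply: cvgB; exact: cdel.
have one n b (x : R) :
    0 < eps n * (1 - b) -> eps n * (2 - b) < T -> forall e,
    (forall t, eps n * (1 - b) <= t <= eps n * (2 - b) -> `|k t - k x| <= e) ->
    `|\int[lambda]_(t in I) (del n b t * k t) - k x| <= C * e.
  move=> h1 h2 e he; have e0 := eps_gt0 n.
  have E : eps n * (2 - b) - eps n * (1 - b) = eps n by ring.
  apply: (@mean_value_delta _ _ (eps n * (1 - b)) (eps n * (2 - b))) => //.
  - by rewrite ltr_pM2l// ltrD2r ltr1n.
  - move=> t nt; rewrite /del ds0 ?mulr0// => ht; apply: nt; move: ht.
    rewrite epsV ler_pdivlMr// ler_pdivrMr// => /andP[? ?]; apply/andP; split; lra.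
  - move=> t; rewrite E /del normrM gtr0_norm ?invr_gt0// mulrC ler_wpM2r ?invr_ge0//.
    exact: ltW.
  - rewrite (FTC2_continuous _ (cdel n b) (ddel n b)); last by rewrite ler_pM2l// lerD2r ler1n.
    rewrite step1 ?step0 ?subr0//.
      by rewrite mulKf ?gt_eqF// subrK.
    by rewrite mulKf ?gt_eqF// subrK.
have i n b : lambda.-integrable I (EFin \o (fun t => del n b t * k t)).
  by apply: continuous_integrable_oo => t; apply: cvgM; [exact: cdel|exact: ck].
apply/cvgrPdist_le => e e0.
have e'0 : 0 < e / (2 * (C + 1)) by rewrite divr_gt0// mulr_gt0// ltr_wpDl.
have /cvgrPdist_le/(_ _ e'0)/nbhs_ballP[r0 /= r00 hr0] := ck 0.
have /cvgrPdist_le/(_ _ e'0)/nbhs_ballP[rT /= rT0 hrT] := ck T.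
have h1 : \forall n \near \oo, eps n <= r0 / 4 by apply: eps_cvg; rewrite divr_gt0.
have h2 : \forall n \near \oo, eps n <= rT / 4 by apply: eps_cvg; rewrite divr_gt0.
apply: filterS2 h1 h2 => n h1 h2.
have en := eps_gt0 n; have en4 := eps_le n.
have -> : \int[lambda]_(t in I) ((del n 0 t - del n (3 - T / eps n) t) * k t) =
    \int[lambda]_(t in I) (del n 0 t * k t) -
    \int[lambda]_(t in I) (del n (3 - T / eps n) t * k t).
  by rewrite -RintegralB//; apply: eq_Rintegral => t _; rewrite mulrBl.
have b1 : `|\int[lambda]_(t in I) (del n 0 t * k t) - k 0| <= C * (e / (2 * (C + 1))).
  apply: (one n 0 0) => //; rewrite ?subr0 ?mulr1//; first lra.
  move=> t /andP[t1 t2]; rewrite distrC; apply: hr0; rewrite /ball/= sub0r normrN gtr0_norm; lra.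
have ET x : eps n * (x - (3 - T / eps n)) = T - eps n * (3 - x).
  by field; rewrite gt_eqF.
have b2 : `|\int[lambda]_(t in I) (del n (3 - T / eps n) t * k t) - k T| <= C * (e / (2 * (C + 1))).
  apply: (one n (3 - T / eps n) T) => //; rewrite ?ET; [lra|lra|].
  move=> t /andP[t1 t2]; rewrite distrC; apply: hrT; rewrite /ball/= ger0_norm; lra.
have Ce : C * (e / (2 * (C + 1))) <= e / 2.
  rewrite mulrA ler_pdivrMr ?mulr_gt0 ?ltr_wpDl//.
  have -> : e / 2 * (2 * (C + 1)) = e * (C + 1) by field.
  by rewrite mulrC ler_wpM2l ?(ltW e0)// lerDl.
set x1 := \int[lambda]_(t in I) _ in b1 *; set x2 := \int[lambda]_(t in I) _ in b2 *.
have -> : k 0 - k T - (x1 - x2) = (x2 - k T) - (x1 - k 0) by ring.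
by apply: le_trans (ler_normB _ _) _; lra.
Qed.

(** The weak derivative is tested with [eta] times the cutoff, which has support inside
]0, T[; the derivative of the cutoff concentrates at the two ends, where [h] is read
through its continuous representative. *)
Theorem weak_integration_by_parts (h hc w eta deta : R -> R) :
  continuous hc -> lambda.-integrable I (EFin \o w) ->
  {ae lambda, forall t, I t -> h t = hc t} ->
  (forall theta, test_fun T theta -> \int[lambda]_(t in I) (derive1 theta t * h t) =
     - \int[lambda]_(t in I) (theta t * w t)) ->
  smooth eta -> (forall t : R, is_derive t 1 eta (deta t)) -> continuous deta ->
  \int[lambda]_(t in I) (eta t * w t) =
  eta T * hc T - eta 0 * hc 0 - \int[lambda]_(t in I) (deta t * hc t).
Proof.
move=> chc iw hhc hw seta heta cdeta.
have ceta : continuous eta by move=> t; exact: is_derive_continuous (heta t).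
have mI : measurable I by exact: measurable_itv.
have [dchi [hdchi cdchi] lim1] := delta_limit (k := fun t => eta t * hc t)
  (fun t => cvgM (ceta t) (chc t)).
have cchi n : continuous (chi n) by move=> t; exact: is_derive_continuous (hdchi n t).
have [M hM] : exists M : R, forall t, I t -> `|eta t| <= M.
  have cn : {within `[0, T], continuous (fun x => `|eta x|)}.
    by apply: continuous_subspaceT => x; apply: continuous_comp; [exact: ceta|exact: norm_continuous].
  have [c _ hc'] := EVT_max (ltW T0) cn.
  exists `|eta c| => t It; apply: hc'; move: It; rewrite /= !in_itv/= => /andP[? ?].
  by apply/andP; split; exact: ltW.
have mw : measurable_fun I w by apply/measurable_EFinP; exact: measurable_int iw.
have iM : lambda.-integrable I (EFin \o (fun t => M * `|w t|)).
  have h1 : lambda.-integrable I (fun t => M%:E * `|(EFin \o w) t|)%E.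
    by apply: integrableZl => //; exact: integrable_abse.
  by apply: eq_integrable h1.
have ietaw : lambda.-integrable I (EFin \o (fun t => eta t * w t)).
  apply: le_integrable iM => //.
    apply/measurable_EFinP; apply: measurable_funM => //.
    exact: continuous_measurable_oo.
  move=> t It /=; rewrite lee_fin normrM.
  by apply: le_trans (ler_norm _); rewrite ler_wpM2r// hM.
have lim2 : (\int[lambda]_(t in I) (eta t * chi n t * w t)) @[n --> \oo] -->
    \int[lambda]_(t in I) (eta t * w t).
  apply: (Rintegral_dominated_cvg (g := fun t => M * `|w t|)) => //.
  - move=> n; apply: measurable_funM => //; apply: continuous_measurable_oo.
    by move=> t; apply: cvgM; [exact: ceta|exact: cchi].
  - move=> t It; apply: cvgMl; rewrite -[X in _ --> X]mulr1; apply: cvgMr; exact: chi_cvg.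
  - move=> n t It; rewrite normrM ler_wpM2r// normrM.
    by apply: le_trans (ler_piMr _ (chi_le1 n t)) _ => //; exact: hM.
have lim3 : (\int[lambda]_(t in I) (deta t * chi n t * hc t)) @[n --> \oo] -->
    \int[lambda]_(t in I) (deta t * hc t).
  apply: (Rintegral_dominated_cvg (g := fun t => `|deta t * hc t|)) => //.
  - move=> n; apply: continuous_measurable_oo.
    by move=> t; apply: cvgM; [apply: cvgM; [exact: cdeta|exact: cchi]|exact: chc].
  - move=> t It; apply: cvgMl; rewrite -[X in _ --> X]mulr1; apply: cvgMr; exact: chi_cvg.
  - by apply: continuous_integrable_oo => t; apply: cvgM; [exact: cdeta|exact: chc].
  - apply: continuous_integrable_oo => t; apply: cvg_norm.
    by apply: cvgM; [exact: cdeta|exact: chc].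
  - move=> n t It; rewrite mulrAC normrM.
    by apply: le_trans (ler_piMr _ (chi_le1 n t)) _.
have eqn n : \int[lambda]_(t in I) (eta t * chi n t * w t) =
    - (\int[lambda]_(t in I) (deta t * chi n t * hc t)) -
    \int[lambda]_(t in I) (dchi n t * (eta t * hc t)).
  have dth (t : R) : is_derive t 1 (fun t => eta t * chi n t)
      (eta t * dchi n t + chi n t * deta t).
    by have h1 := heta t; have h2 := hdchi n t; exact: is_deriveM.
  have := hw (fun t => eta t * chi n t); set A := _ = _ => hA.
  have : A.
    apply: hA; split; first by move=> k t; apply: smooth_derivable; exact: smooth_mul.
    exists (eps n), (T - eps n); split => //.
      by rewrite ltrBlDr ltrDl.
    by move=> t nt; rewrite chi0 ?mulr0.
  rewrite /A => {A hA} E; rewrite -[LHS]opprK -E.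
  have -> : \int[lambda]_(t in I) (derive1 (fun t0 => eta t0 * chi n t0) t * h t) =
    \int[lambda]_(t in I) (deta t * chi n t * hc t + dchi n t * (eta t * hc t)).
    apply: eq_Rintegral_ae; apply: (ae_mono hhc) => t ht It.
    by rewrite derive1E derive_val (ht It); ring.
  rewrite RintegralD//; first by rewrite opprD.
  - apply: continuous_integrable_oo => t.
    by apply: cvgM; [apply: cvgM; [exact: cdeta|exact: cchi]|exact: chc].
  - apply: continuous_integrable_oo => t.
    by apply: cvgM; [exact: cdchi|apply: cvgM; [exact: ceta|exact: chc]].
have lim4 : (\int[lambda]_(t in I) (eta t * chi n t * w t)) @[n --> \oo] -->
    - (\int[lambda]_(t in I) (deta t * hc t)) - (eta 0 * hc 0 - eta T * hc T).
  by under eq_fun do rewrite eqn; apply: cvgB => //; exact: cvgN.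
rewrite (cvg_unique _ lim2 lim4)//; ring.
Qed.

End cutoff.
End weak_derivative.

(** * Square integrable functions *)
Section sqi.
Context d (X : measurableType d) (R : realType) (m : {measure set X -> \bar R}).
Implicit Types f g : X -> R.

Definition sqi f : Prop :=
  measurable_fun setT f /\ (\int[m]_x (f x ^+ 2)%:E < +oo)%E.

Lemma sqr_fine_Lnorm2 f :
  fine (Lnorm m 2%:E (EFin \o f)) ^+ 2 = fine (\int[m]_x (f x ^+ 2)%:E)%E.
Proof.
have := @poweR_Lnorm _ _ _ m (EFin \o f) 2 _.
have := Lnorm_ge0 m 2%:E (EFin \o f).
have -> : (\int[m]_x `|(EFin \o f) x| `^ 2 = \int[m]_x (f x ^+ 2)%:E)%E.
  apply: eq_integral => x _ /=; rewrite -(real_normK (num_real (f x))) -powR_mulrn//.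
case: (Lnorm m 2%:E (EFin \o f)) => [r| |] //=.
  by rewrite lee_fin => r0 <- //=; rewrite powR_mulrn.
move=> _; have n2 : (2 == 0 :> R) = false by rewrite pnatr_eq0.
by rewrite n2 => <-//; rewrite expr0n.
Qed.

Lemma LfunP2 f : (f \in Lfun m 2%:E) <-> sqi f.
Proof.
have E : (Lnorm m 2%:E (EFin \o f) `^ 2 = \int[m]_x (f x ^+ 2)%:E)%E.
  rewrite poweR_Lnorm//; apply: eq_integral => x _ /=.
  by rewrite -(real_normK (num_real (f x))) -powR_mulrn.
split.
  move=> fP; have mf := set_mem (sub_Lfun_mfun fP); have ff := set_mem (sub_Lfun_finLfun fP).
  by split; [exact: mf|rewrite -E; apply: poweR_lty; exact: ff].
move=> [mf ff]; apply/andP; rewrite !inE/=; split => //.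
by rewrite /finite_norm; apply: (@lty_poweRy _ _ 2) => //; rewrite E.
Qed.

Lemma sqi_integrable f g : sqi f -> sqi g -> m.-integrable setT (EFin \o (fun x => f x * g x)).
Proof.
move=> [mf ff] [mg gg].
have i2 (h : X -> R) : sqi h -> m.-integrable setT (EFin \o (fun x => h x ^+ 2)).
  move=> [mh hh]; apply/integrableP; split; first by apply/measurable_EFinP; exact: measurable_funX.
  by under eq_integral do rewrite /= ger0_norm ?sqr_ge0//.
have iD : m.-integrable setT (EFin \o (fun x => f x ^+ 2 + g x ^+ 2)).
  by have := integrableD measurableT (i2 _ (conj mf ff)) (i2 _ (conj mg gg)); apply: eq_integrable.
apply: le_integrable iD => //.
  by apply/measurable_EFinP; exact: measurable_funM.
move=> x _ /=; rewrite lee_fin normrM [leRHS]ger0_norm ?addr_ge0 ?sqr_ge0//.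
rewrite -(real_normK (num_real (f x))) -(real_normK (num_real (g x))).
by have := sqr_ge0 (`|f x| - `|g x|); have := sqr_ge0 (`|f x| + `|g x|); nra.
Qed.

Lemma sqi_linear a f g : sqi f -> sqi g -> sqi (fun x => a * f x + g x).
Proof.
move=> [mf ff] [mg gg]; split.
  by apply: measurable_funD => //; apply: measurable_funM.
apply: (@le_lt_trans _ _ (\int[m]_x ((2 * a ^+ 2)%:E * (f x ^+ 2)%:E + 2%:E * (g x ^+ 2)%:E))%E).
  apply: ge0_le_integral => //.
  - by move=> x _; rewrite lee_fin sqr_ge0.
  - apply/measurable_EFinP; apply: measurable_funX.
    by apply: measurable_funD => //; apply: measurable_funM.
  - apply: emeasurable_funD; apply: measurable_funeM; apply/measurable_EFinP;
      exact: measurable_funX.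
  - move=> x _; rewrite -!EFinM -EFinD lee_fin.
    by have := sqr_ge0 (a * f x - g x); nra.
have p0 (h : X -> R) c : 0 <= c -> (forall x, setT x -> 0 <= c%:E * (h x ^+ 2)%:E)%E.
  by move=> c0 x _; rewrite -EFinM lee_fin mulr_ge0 ?sqr_ge0.
have pm (h : X -> R) c : measurable_fun setT h -> measurable_fun setT (fun x => c%:E * (h x ^+ 2)%:E)%E.
  by move=> mh; apply: measurable_funeM; apply/measurable_EFinP; exact: measurable_funX.
have a0 : 0 <= 2 * a ^+ 2 by rewrite mulr_ge0 ?sqr_ge0.
rewrite ge0_integralD//; [|exact: p0|exact: pm|exact: p0|exact: pm].
have zl (h : X -> R) c : 0 <= c -> measurable_fun setT h ->
    (\int[m]_x (c%:E * (h x ^+ 2)%:E) = c%:E * \int[m]_x (h x ^+ 2)%:E)%E.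
  move=> c0 mh; rewrite ge0_integralZl_EFin//.
  - by move=> x _; rewrite lee_fin sqr_ge0.
  - by apply/measurable_EFinP; exact: measurable_funX.
rewrite !zl//; apply: lte_add_pinfty; exact: lte_mul_pinfty.
Qed.

Lemma sqi0 : sqi (fun=> 0).
Proof.
split; first exact: measurable_cst.
by under eq_integral do rewrite expr0n/=; rewrite integral0.
Qed.

Lemma sqiB f g : sqi f -> sqi g -> sqi (fun x => f x - g x).
Proof.
move=> hf hg; rewrite (_ : (fun x => f x - g x) = (fun x => -1 * g x + f x)).
  exact: sqi_linear.
by apply/funext => x; rewrite mulN1r addrC.
Qed.

Definition l2ip f g : R := \int[m]_x (f x * g x).

Lemma l2ip_linear a f g h : sqi f -> sqi g -> sqi h ->
  l2ip (fun x => a * f x + g x) h = a * l2ip f h + l2ip g h.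
Proof.
move=> sf sg sh; rewrite /l2ip.
have i1 := sqi_integrable sf sh; have i2 := sqi_integrable sg sh.
rewrite -RintegralZl// -RintegralD//; last first.
  by have := integrableZl measurableT a i1; apply: eq_integrable.
by apply: eq_Rintegral => x _; ring.
Qed.

Lemma l2ipC f g : l2ip f g = l2ip g f.
Proof. by apply: eq_Rintegral => x _; rewrite mulrC. Qed.

Lemma l2ip_ge0 f : 0 <= l2ip f f.
Proof. by apply: Rintegral_ge0 => x _; rewrite -expr2 sqr_ge0. Qed.

Lemma l2ipE f : sqi f -> (l2ip f f)%:E = (\int[m]_x (f x ^+ 2)%:E)%E.
Proof.
move=> [mf ff]; rewrite /l2ip /Rintegral fineK.
  by apply: eq_integral => x _; rewrite expr2.
under eq_integral do rewrite -expr2.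
by rewrite ge0_fin_numE// integral_ge0// => x _; rewrite lee_fin sqr_ge0.
Qed.

(** A sequence with summable increments converges almost everywhere; redefined to be
[0] on the exceptional set, it converges everywhere, to a measurable function. *)
Lemma sqi_cauchy_ae (u : nat -> X -> R) : (forall k, sqi (u k)) ->
  (forall k i, (k <= i)%N -> l2ip (fun x => u i x - u k x) (fun x => u i x - u k x) <= 16^-1 ^+ k) ->
  exists f N, [/\ measurable_fun setT f, measurable N, m N = 0%E &
    forall x, ~ N x -> u k x @[k --> \oo] --> f x].
Proof.
move=> su hu.
have inc k : (\int[m]_x ((u k.+1 x - u k x) ^+ 2)%:E <= (1 * 16^-1 ^+ k)%:E)%E.
  rewrite -l2ipE; last exact: sqiB.
  by rewrite mul1r lee_fin hu.
have mu_ k : measurable_fun setT (fun x => u k.+1 x - u k x).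
  by apply: measurable_funB; [exact: (su _).1|exact: (su _).1].
have [N [mN N0 hN]] := @ae_geometric _ _ R m setT measurableT _ 1 ler01 mu_ inc.
have cauchy x : ~ N x -> cvgn (fun k => u k x).
  move=> Nx; have [S hS] := hN x I Nx.
  have S0 : 0 <= S by have := le_trans (normr_ge0 _) (hS 0%N); rewrite expr0 mulr1.
  have tel k i : (k <= i)%N -> `|u i x - u k x| <= 2 * S * (2^-1 ^+ k - 2^-1 ^+ i).
    elim: i => [|i ih].
      by rewrite leqn0 => /eqP ->; rewrite !subrr normr0 mulr0.
    rewrite leq_eqVlt => /predU1P[->|]; first by rewrite !subrr normr0 mulr0.
    rewrite ltnS => /ih {}ih; rewrite -(subrKA (u i x)).
    apply: le_trans (ler_normD _ _) _; have := hS i; rewrite (exprS _ i).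
    have -> : 2 * S * (2^-1 ^+ k - 2^-1 * 2^-1 ^+ i) =
      2 * S * (2^-1 ^+ k - 2^-1 ^+ i) + S * 2^-1 ^+ i by field.
    by move=> h; rewrite addrC; apply: lerD.
  have z : 2 * S * 2^-1 ^+ k @[k --> \oo] --> (0 : R).
    rewrite -[X in _ --> X](mulr0 (2 * S)); apply: cvgMr; apply: cvg_expr.
    by rewrite ger0_norm; lra.
  apply/cauchy_cvgP/cauchy_exP => e e0.
  have /cvgrPdist_lt/(_ _ e0)[k _ hk] := z.
  exists (u k x); exists k => // i /= ki.
  rewrite /ball/= distrC; apply: le_lt_trans (tel k i ki) _.
  have := hk k (leqnn k); rewrite sub0r normrN; apply: le_lt_trans.
  apply: le_trans (ler_norm _); rewrite ler_wpM2l ?mulr_ge0// gerBl.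
  by rewrite exprn_ge0 ?invr_ge0.
have mNC : measurable (~` N) by exact: measurableC.
pose g k x := if x \in ~` N then u k x else 0.
have mg k : measurable_fun setT (g k).
  apply: measurable_fun_if => //.
  - apply: (measurable_fun_bool true); rewrite setTI.
    rewrite (_ : _ @^-1` _ = ~` N)//; apply/seteqP; split=> x /=; first exact: set_mem.
    exact: mem_set.
  - exact: measurable_funTS (su k).1.
pose f x := limn (fun k => g k x).
have cg x : g k x @[k --> \oo] --> f x.
  have : cvgn (fun k => g k x); last by [].
  rewrite /g; have [Nx|Nx] := pselect (N x).
    have -> : (x \in ~` N) = false by apply: memNset => /(_ Nx).
    exact: is_cvg_cst.
  by rewrite mem_set//; exact: cauchy.
exists f, N; split => //; first by apply: measurable_fun_cvg mg _ => x _; exact: cg.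
move=> x Nx; have := cg x; rewrite /g mem_set//.
Qed.

(** Fatou's lemma along such a sequence. *)
Lemma sqi_complete (u : nat -> X -> R) : (forall k, sqi (u k)) ->
  (forall k i, (k <= i)%N -> l2ip (fun x => u i x - u k x) (fun x => u i x - u k x) <= 16^-1 ^+ k) ->
  exists f, [/\ sqi f, {ae m, forall x, u k x @[k --> \oo] --> f x} &
    forall k, l2ip (fun x => u k x - f x) (fun x => u k x - f x) <= 16^-1 ^+ k].
Proof.
move=> su hu; have [f [N [mf mN N0 hf]]] := sqi_cauchy_ae su hu.
have mNC : measurable (~` N) by exact: measurableC.
have bound k : (\int[m]_x ((u k x - f x) ^+ 2)%:E <= (16^-1 ^+ k)%:E)%E.
  have rN (h : X -> R) : (\int[m]_x (h x)%:E = \int[m]_(x in ~` N) (h x)%:E)%E.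
    rewrite [RHS]integral_mkcond; apply: eq_integral_ae.
    exists N; split => // x /= hx; apply: contrapT => Nx; apply: hx => _.
    by rewrite /patch mem_set.
  rewrite rN.
  apply: (@fatou_le _ _ R m (~` N) mNC (fun i x => (u k x - u (i + k)%N x) ^+ 2)).
  - move=> i; apply: measurable_funTS; apply: measurable_funX.
    by apply: measurable_funB; [exact: (su _).1|exact: (su _).1].
  - by move=> i x _; exact: sqr_ge0.
  - move=> x Nx; under eq_fun do rewrite expr2; rewrite expr2.
    have h1 : u (i + k)%N x @[i --> \oo] --> f x.
      by rewrite (cvg_shiftn k (fun i => u i x)); exact: hf.
    by apply: cvgM; apply: cvgB => //; exact: cvg_cst.
  - move=> i; rewrite -rN -l2ipE; last exact: sqiB.
    rewrite lee_fin; apply: le_trans (hu k (i + k)%N (leq_addl _ _)).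
    rewrite le_eqVlt; apply/orP; left; apply/eqP.
    by apply: eq_Rintegral => x _; ring.
have sd k : sqi (fun x => u k x - f x).
  split; first by apply: measurable_funB => //; exact: (su k).1.
  by apply: le_lt_trans (bound k) (ltry _).
exists f; split.
- have := sqiB (su 0%N) (sd 0%N); congr sqi; apply/funext => x; ring.
- exists N; split => // x /= hx; apply: contrapT => Nx; apply: hx; exact: hf.
- by move=> k; rewrite -lee_fin l2ipE.
Qed.

Lemma eq_l2ip f f' g g' : {ae m, forall x, f x = f' x} -> {ae m, forall x, g x = g' x} ->
  l2ip f g = l2ip f' g'.
Proof.
move=> ff gg; apply: eq_Rintegral_ae.
by apply: (ae_mono (ae_and ff gg)) => x [-> ->].
Qed.

Lemma l2ip_eq0 f : sqi f -> l2ip f f = 0 -> {ae m, forall x, f x = 0}.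
Proof.
move=> sf f0; have := l2ipE sf; rewrite f0 => /esym h.
have : (\int[m]_x `|(f x ^+ 2)%:E| = 0)%E.
  by rewrite -[RHS]/(0%:E) -h; apply: eq_integral => x _; rewrite gee0_abs// lee_fin sqr_ge0.
move/ae_eq_integral_abs => /(_ measurableT) {}h.
have {}h := h _; apply: (ae_mono (h _)).
  by apply/measurable_EFinP; exact: measurable_funX sf.1.
by move=> x /(_ I)[] /eqP; rewrite sqrf_eq0 => /eqP.
Qed.

Lemma sqi_patch (D : set X) f : measurable D -> sqi f -> sqi (f \_ D).
Proof.
move=> mD [mf ff]; split.
  by apply/(measurable_restrictT _ mD); exact: measurable_funTS.
apply: le_lt_trans ff; apply: ge0_le_integral => //.
- by move=> x _; rewrite lee_fin sqr_ge0.
- apply/measurable_EFinP/measurable_funX/(measurable_restrictT _ mD).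
  exact: measurable_funTS.
- by apply/measurable_EFinP; exact: measurable_funX.
- move=> x _; rewrite lee_fin /patch; case: ifP => // _.
  by rewrite expr0n/= sqr_ge0.
Qed.

End sqi.

(** * The normalizing constant *)
Section gamma.
Context {R : realType}.
Local Notation lambda := (@lebesgue_measure R).

Lemma powR_le_expR_half (z : R) : 0 < z ->
  exists2 C : R, 0 < C & forall t : R, 0 < t -> t `^ z <= C * expR (2^-1 * t).
Proof.
move=> z0.
pose m := (Num.truncn z).+1.
have zm : z <= m%:R by exact: ltW (truncnS_gt z).
pose C : R := 1 + 2 ^+ m.+1 * m.+1`!%:R.
have f0 : 0 < m.+1`!%:R :> R by rewrite ltr0n fact_gt0.
have K0 : 0 < 2 ^+ m.+1 * m.+1`!%:R :> R by rewrite mulr_gt0// exprn_gt0.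
exists C => [|t t0]; first by rewrite /C addr_gt0.
have e1 : 1 <= expR (2^-1 * t) by rewrite -expR0 ler_expR mulr_ge0 ?invr_ge0// ltW.
have [t1|t1] := leP t 1.
  have tz : t `^ z <= 1.
    have -> : (1 : R) = 1 `^ z by rewrite powR1.
    by apply: ge0_ler_powR; rewrite ?nnegrE ?ler01 ?(ltW z0) ?(ltW t0).
  apply: le_trans tz _; rewrite -[leLHS]mul1r; apply: ler_pM => //.
  by rewrite /C lerDl ltW.
have tz : t `^ z <= t ^+ m.+1.
  rewrite -powR_mulrn ?(ltW t0)//; apply: ler_powR; first exact: ltW.
  by apply: le_trans zm _; rewrite ler_nat.
apply: le_trans tz _.
have := @expR_ge1Dxn R (2^-1 * t) m; rewrite mulr_ge0 ?invr_ge0 ?(ltW t0)// => /(_ isT) h1.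
apply: (@le_trans _ _ (2 ^+ m.+1 * m.+1`!%:R * ((2^-1 * t) ^+ m.+1 / m.+1`!%:R))).
  rewrite exprMn exprVn le_eqVlt; apply/orP; left; apply/eqP; field.
  by rewrite expf_neq0//= gt_eqF.
rewrite /C mulrDl mul1r -[leLHS]add0r; apply: lerD; first exact: expR_ge0.
by rewrite ler_wpM2l ?(ltW K0)//; lra.
Qed.

Variables (z : R) (z0 : 0 < z).
Let f (t : R) : R := t `^ (z - 1) * expR (- t).

Let mf : measurable_fun setT f.
Proof.
apply: measurable_funM; first exact: measurable_powR.
by apply: measurableT_comp => //; exact: measurable_expR.
Qed.

Let f0 t : 0 <= f t. Proof. by rewrite mulr_ge0 ?powR_ge0 ?expR_ge0. Qed.

(** Up to a boundary term, [z] times the integrand is [t `^ z * expR (- t)], which a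
multiple of [expR (- t / 2)] dominates: this reduces small exponents to large ones, and
gives an antiderivative that is bounded on the half-line. *)
Lemma integral_gamma_bounded : exists M : R, forall a b : R, 0 < a -> a < b ->
  (\int[lambda]_(t in `[a, b]) (f t)%:E <= M%:E)%E.
Proof.
have [C C0 hC] := powR_le_expR_half z0.
pose H t := z^-1 * (t `^ z * expR (-1 * t) - 2 * C * expR (- 2^-1 * t)).
pose h t := z^-1 * (z * t `^ (z - 1) * expR (-1 * t) - t `^ z * expR (-1 * t) +
  C * expR (- 2^-1 * t)).
have expM c (t : R) : is_derive t 1 (fun t : R => expR (c * t)) (c * expR (c * t)).
  exact: is_derive_expRM.
have dH (t : R) : 0 < t -> is_derive t 1 H (h t).
  move=> t0; have h1 := is_derive1_powR z t0; have h2 := expM (-1) t.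
  have h3 := expM (- 2^-1) t.
  by apply: is_derive_eq; rewrite /h /GRing.scale/=; field; rewrite gt_eqF.
have ch (t : R) : 0 < t -> {for t, continuous h}.
  move=> t0; have p1 := is_derive_continuous (is_derive1_powR z t0).
  have p2 := is_derive_continuous (is_derive1_powR (z - 1) t0).
  have p3 c := is_derive_continuous (expM c t).
  apply: cvgMr; apply: cvgD; last by apply: cvgMr; exact: p3.
  apply: cvgB; last by apply: cvgM; [exact: p1|exact: p3].
  by apply: cvgM; [apply: cvgMr; exact: p2|exact: p3].
have key (t : R) : 0 < t -> t `^ z * expR (-1 * t) <= C * expR (- 2^-1 * t).
  move=> t0; have -> : expR (- 2^-1 * t) = expR (2^-1 * t) * expR (-1 * t).
    by rewrite -expRD; congr expR; field.
  by rewrite mulrA ler_wpM2r ?expR_ge0// hC.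
have fh (t : R) : 0 < t -> f t <= h t.
  move=> t0; have := key t t0; rewrite /h mulrDr mulrBr mulN1r /f.
  have -> : z^-1 * (z * t `^ (z - 1) * expR (- t)) = t `^ (z - 1) * expR (- t).
    by field; rewrite gt_eqF.
  move=> k; rewrite -addrA lerDl addrC subr_ge0 ler_wpM2l ?invr_ge0 ?(ltW z0)//.
exists (z^-1 * (3 * C)) => a b a0 ab.
have pos (t : R) : t \in `[a, b] -> 0 < t.
  by rewrite in_itv/= => /andP[+ _]; exact: lt_le_trans.
have posC (t : R) : t \in `]a, b[ -> 0 < t.
  by rewrite in_itv/= => /andP[+ _]; exact: lt_trans.
have wch : {within `[a, b], continuous h}.
  by apply: continuous_in_subspaceT => t /set_mem/= ti; apply: ch; exact: pos.
have mh : measurable_fun `[a, b] h by exact: subspace_continuous_measurable_fun.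
apply: (@le_trans _ _ (\int[lambda]_(t in `[a, b]) (h t)%:E)%E).
  apply: ge0_le_integral => //.
  - by move=> t _; rewrite lee_fin.
  - by apply/measurable_EFinP; exact: measurable_funTS.
  - by apply/measurable_EFinP.
  - by move=> t ti; rewrite lee_fin fh// pos.
rewrite (continuous_FTC2 ab wch (F := H)); last first.
- by move=> t ti; rewrite derive1E; have [_ ->] := dH t (posC t ti).
- split.
  + by move=> t ti; have [] := dH t (posC t ti).
  + by apply: cvg_at_right_filter; exact: is_derive_continuous (dH a a0).
  + by apply: cvg_at_left_filter; exact: is_derive_continuous (dH b (lt_trans a0 ab)).
rewrite -EFinB lee_fin /H -mulrBr ler_wpM2l ?invr_ge0 ?(ltW z0)//.
have e1 (t : R) : 0 < t -> expR (- 2^-1 * t) <= 1.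
  by move=> t0; rewrite -[leRHS]expR0 ler_expR; lra.
have := key b (lt_trans a0 ab); have := e1 a a0; have := e1 b (lt_trans a0 ab).
have p0 : 0 <= a `^ z * expR (-1 * a) by rewrite mulr_ge0 ?powR_ge0 ?expR_ge0.
have := expR_ge0 (- 2^-1 * b).
move: (expR _) (expR (- 2^-1 * a)) => x y; nra.
Qed.

(** By [integral_gamma_bounded] the integral is finite, so that its real value is not the
default one; it is positive because the integrand is bounded below on [`[1, 2]]. *)
Lemma Gamma_gt0 : 0 < Gamma z.
Proof.
have [M hM] := integral_gamma_bounded.
have fin : (\int[lambda]_(t in `]0%R, +oo[) (f t)%:E <= M%:E)%E.
  pose F (n : nat) : set (measurableTypeR R) := `[n.+1%:R^-1, n.+2%:R]%classic.
  have FU : \bigcup_n F n = `]0, +oo[%classic.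
    apply/seteqP; split=> [t [n _]|t]; rewrite /F /= !in_itv/= ?andbT.
      by move=> /andP[+ _]; apply: lt_le_trans; rewrite invr_gt0.
    move=> t0; pose k := maxn (Num.truncn t) (Num.truncn t^-1).
    exists k => //; rewrite /= in_itv/=; apply/andP; split.
      rewrite invf_ple ?posrE//; apply: le_trans (ltW (truncnS_gt _)) _.
      by rewrite ler_nat ltnS leq_maxr.
    apply: le_trans (ltW (truncnS_gt _)) _.
    by rewrite ler_nat ltnS; apply: leq_trans (leq_maxl _ _) _; exact: leqnSn.
  have nd : nondecreasing_seq F.
    apply/nondecreasing_seqP => n; rewrite subsetEset => t.
    rewrite /F /= !in_itv/= => /andP[t1 t2]; apply/andP; split.
      by apply: le_trans t1; rewrite lef_pV2 ?posrE// ler_nat.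
    by apply: le_trans t2 _; rewrite ler_nat.
  have cv := @ge0_nondecreasing_set_cvg_integral _ _ _ F (EFin \o f) lambda nd _ _ _.
  rewrite -FU; apply: (cvge_le (F := \oo)); last apply: cv.
  - apply: nearW => n; apply: hM; first by rewrite invr_gt0.
    by apply: (@le_lt_trans _ _ 1); rewrite ?ltr1n// invf_le1 ?ler1n.
  - by move=> n; exact: measurable_itv.
  - by move=> n; apply/measurable_EFinP; exact: measurable_funTS.
  - by move=> n t _; rewrite lee_fin.
have low1 : ((expR (-2) / 2)%:E <= \int[lambda]_(t in `[1%R, 2%R]) (f t)%:E)%E.
  have l12 : lambda `[1%R, 2%R]%classic = 1%E.
    by rewrite lebesgue_measure_itv/= lte_fin ltr1n -EFinB; congr EFin; ring.
  have <- : (\int[lambda]_(t in `[1%R, 2%R]) (cst (expR (-2) / 2)%:E t) =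
      (expR (-2) / 2)%:E)%E.
    apply: (@etrans _ _ ((expR (-2) / 2)%:E * lambda `[1%R, 2%R]%classic)%E).
      exact: integral_cst.
    by rewrite l12 mule1.
  apply: ge0_le_integral => //.
  - by move=> t _; rewrite lee_fin divr_ge0 ?expR_ge0.
  - by apply/measurable_EFinP; exact: measurable_funTS.
  - move=> t; rewrite /= in_itv/= => /andP[t1 t2]; rewrite lee_fin /f mulrC.
    apply: ler_pM; rewrite ?invr_ge0 ?expR_ge0//; last by rewrite ler_expR; lra.
    apply: (@le_trans _ _ (t `^ (-1))).
      by rewrite powR_inv1 ?(le_trans ler01 t1)// lef_pV2 ?posrE//; lra.
    by apply: ler_powR => //; rewrite lerBrDr addNr ltW.
have low2 : (\int[lambda]_(t in `[1%R, 2%R]) (f t)%:E <=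
    \int[lambda]_(t in `]0%R, +oo[) (f t)%:E)%E.
  apply: ge0_subset_integral => //.
  - by apply/measurable_EFinP; exact: measurable_funTS.
  - by move=> t _; rewrite lee_fin.
  - by move=> t; rewrite /= !in_itv/= andbT => /andP[+ _]; apply: lt_le_trans.
have low := le_trans low1 low2.
rewrite /Gamma /Rintegral -lte_fin fineK; last first.
  rewrite ge0_fin_numE; first exact: le_lt_trans fin (ltry _).
  by apply: (le_trans _ low); rewrite lee_fin divr_ge0 ?expR_ge0.
by apply: lt_le_trans low; rewrite lte_fin divr_gt0 ?expR_gt0.
Qed.

End gamma.

Lemma C_Ns_gt0 (R : realType) (n : nat) (s : R) : 0 < s -> s < 1 -> 0 < C_Ns n s.
Proof.
move=> s0 s1; rewrite /C_Ns divr_gt0//.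
  rewrite mulr_gt0//; first by rewrite mulr_gt0// powR_gt0.
  by apply: Gamma_gt0; rewrite divr_gt0// ltr_wpDr// mulr_gt0.
by rewrite mulr_gt0 ?powR_gt0 ?pi_gt0//; apply: Gamma_gt0; rewrite subr_gt0.
Qed.

(** * Measurability and volume in the space of row vectors *)
Section geometry.
Context {R : realType} (d : nat).
Implicit Types x y : 'rV[R]_d.

Lemma measurable_box (a b : R) : measurable [set x : 'rV[R]_d | forall i, a < x ord0 i < b].
Proof.
have -> : [set x : 'rV[R]_d | forall i, a < x ord0 i < b] =
    \bigcap_(i in [set: 'I_d]) [set x | x ord0 i \in `]a, b[%R].
  apply/seteqP; split=> x /= h i; first by move=> _ /=; rewrite in_itv/= h.
  by have := h i I; rewrite /= in_itv/=.
apply: fin_bigcap_measurable => // i _.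
have := @measurable_rV_coord R d i measurableT `]a, b[%classic.
by rewrite setTI; apply; exact: measurable_itv.
Qed.

Lemma measurable_sup_ball x (e : R) : measurable (ball x e).
Proof.
have [e0|e0] := ltP 0 e; last first.
  by rewrite (_ : ball x e = set0)//; apply/seteqP; split=> y //= -[]; rewrite ltNge e0.
have -> : ball x e =
    \bigcap_(i in [set: 'I_d]) [set y | y ord0 i \in `]x ord0 i - e, x ord0 i + e[%R].
  apply/seteqP; split=> y /=.
    move=> [_ h] i _ /=; have := h ord0 i.
    by rewrite -ball_normE /ball_ /= in_itv/= ltr_distlC.
  move=> h; split=> // i j; have := h j I.
  rewrite (_ : i = ord0) /=; last by rewrite (ord1 i); exact: val_inj.
  by rewrite -ball_normE /ball_ /= in_itv/= ltr_distlC.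
apply: fin_bigcap_measurable => // i _.
have := @measurable_rV_coord R d i measurableT `]x ord0 i - e, x ord0 i + e[%classic.
by rewrite setTI; apply; exact: measurable_itv.
Qed.

(** The Borel sets of the sup norm: an open set is the union of the balls with rational
centre and radius that it contains. *)
Lemma open_measurable_rV (A : set 'rV[R]_d) : open A -> measurable A.
Proof.
move=> oA.
pose B (p : 'rV[rat]_d * nat) : set 'rV[R]_d :=
  ball (map_mx ratr p.1 : 'rV[R]_d) p.2.+1%:R^-1.
pose C (p : 'rV[rat]_d * nat) := if pselect (B p `<=` A) then B p else set0.
have -> : A = \bigcup_p C p.
  apply/seteqP; split=> [x Ax|x [p _]]; last first.
    by rewrite /C; case: pselect => // sub; exact: sub.
  have /nbhs_ballP[e e0 he] : nbhs x A by exact: open_nbhs_nbhs.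
  pose k := Num.truncn (2 / e).
  have ke : k.+1%:R^-1 < e / 2.
    rewrite -[e / 2]invrK ltf_pV2 ?posrE ?invr_gt0 ?divr_gt0// invf_div.
    exact: truncnS_gt.
  have k0 : 0 < k.+1%:R^-1 :> R by rewrite invr_gt0.
  have hq i : exists q : rat, ratr q \in `]x ord0 i - k.+1%:R^-1, x ord0 i + k.+1%:R^-1[.
    by apply: rat_in_itvoo; rewrite ltrD2l; rewrite -subr_gt0 opprK addr_gt0.
  have [q hq'] := choice hq.
  exists (\row_i q i, k) => //.
  have xB : B (\row_i q i, k) x.
    split => //= i j; rewrite (_ : i = ord0); last by rewrite (ord1 i); exact: val_inj.
    rewrite !mxE -ball_normE /ball_/= ltr_distl.
    by have := hq' j; rewrite in_itv.
  rewrite /C; case: pselect => // -[] y [_ hy].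
  apply: he; split => // i j.
  rewrite (_ : i = ord0); last by rewrite (ord1 i); exact: val_inj.
  have := hy ord0 j; have := hq' j; rewrite !mxE -!ball_normE /ball_/= in_itv/= !ltr_distl.
  move: (x ord0 j) (y ord0 j) (ratr (q j)) (k.+1%:R^-1) ke => a b c r re.
  by move=> /andP[h1 h2] /andP[h3 h4]; apply/andP; split; lra.
apply: countable_bigcupT_measurable => [|p]; first exact: countableP.
by rewrite /C; case: (pselect (B p `<=` A)) => ? /=; [exact: measurable_sup_ball|exact: measurable0].
Qed.

Lemma measurable_enormB :
  measurable_fun setT (fun p : 'rV[R]_d * 'rV[R]_d => enorm (p.1 - p.2)).
Proof.
have ms : measurable_fun setT (@Num.sqrt R).
  by apply: continuous_measurable_fun; exact: sqrt_continuous.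
apply: (measurableT_comp ms).
apply: measurable_sum => i; apply: measurable_funX.
under eq_fun do rewrite !mxE.
apply: measurable_funB.
- exact: (measurableT_comp (measurable_rV_coord i)) measurable_fst.
- exact: (measurableT_comp (measurable_rV_coord i)) measurable_snd.
Qed.

Lemma enorm_le_coord x (M : R) : (forall i, `|x ord0 i| <= M) -> enorm x <= Num.sqrt (d%:R * M ^+ 2).
Proof.
move=> h; rewrite /enorm ler_wsqrtr//.
apply: (@le_trans _ _ (\sum_(i < d) M ^+ 2)).
  by apply: ler_sum => i _; rewrite -(real_normK (num_real _)) ler_sqr ?nnegrE// (le_trans _ (h i)).
by rewrite sumr_const card_ord mulr_natl.
Qed.

Lemma enorm_gt0 x i : x ord0 i != 0 -> 0 < enorm x.
Proof.
move=> xi; rewrite sqrtr_gt0 (bigD1 i)//=; apply: ltr_wpDr.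
  by apply: sumr_ge0 => j _; exact: sqr_ge0.
by rewrite exprn_even_gt0.
Qed.

End geometry.

Lemma lebesgue_box {R : realType} (d : nat) (a b : R) : a < b ->
  lebesgue_rV d [set x : 'rV[R]_d | forall i, a < x ord0 i < b] = ((b - a) ^+ d)%:E.
Proof.
move=> ab; elim: d => [|d IH].
  rewrite /= diracE mem_set//= ?expr0//.
  by case.
change ((@lebesgue_measure R \x lebesgue_rV d)%E
  (@cons_rV R d @^-1` [set x | forall i, a < x ord0 i < b]) = ((b - a) ^+ d.+1)%:E).
have -> : @cons_rV R d @^-1` [set x | forall i, a < x ord0 i < b] =
    `]a, b[%classic `*` [set x : 'rV[R]_d | forall i, a < x ord0 i < b].
  apply/seteqP; split=> -[t x] /=.
    move=> h; split.
      have := h ord0; have := cons_rVK (t, x); rewrite /uncons_rV => -[-> _].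
      by rewrite in_itv.
    move=> i; have := h (rshift 1 i).
    have [_ /(congr1 (fun z : 'rV_d => z ord0 i))] := cons_rVK (t, x).
    by rewrite mxE => ->.
  move=> [ht hx] i.
  have [j ->|j ->] := split_ordP (i : 'I_(1 + d)).
    have -> : lshift d j = ord0 by apply: val_inj; rewrite /= ord1.
    by have [-> _] := cons_rVK (t, x); move: ht; rewrite in_itv.
  by have [_ /(congr1 (fun z : 'rV_d => z ord0 j))] := cons_rVK (t, x); rewrite mxE => ->.
rewrite product_measure1E//; last exact: measurable_box.
have l : @lebesgue_measure R `]a, b[%classic = (b - a)%:E.
  by rewrite lebesgue_measure_itv/= lte_fin ab -EFinB.
rewrite exprS EFinM; congr (_ * _)%E; [exact: l|exact: IH].
Qed.

(** * The Gagliardo form *)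
Section gagliardo.
Context {R : realType} (d : nat) (s : R).
Local Notation E := 'rV[R]_d.
Local Notation mu := (lebesgue_rV d).
Implicit Types u v : E -> R.

(** With the square root of the kernel put into the difference quotient, the Gagliardo form
is a scalar product of two square integrable functions on the product space
([FsE]). *)
Definition sqrt_kernel (p : E * E) : R := enorm (p.1 - p.2) `^ (- (d%:R + 2 * s) / 2).

Lemma sqr_sqrt_kernel p : sqrt_kernel p ^+ 2 = kernel_Ns s p.
Proof.
rewrite /sqrt_kernel /kernel_Ns -powRN -powR_mulrn ?powR_ge0// -powRrM.
by congr powR; field.
Qed.

Lemma measurable_sqrt_kernel : measurable_fun setT sqrt_kernel.
Proof.
by apply: (measurableT_comp (measurable_powR _)); exact: measurable_enormB.
Qed.

Definition diffq u (p : E * E) : R := (u p.1 - u p.2) * sqrt_kernel p.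

Lemma diffq_linear (a : R) u v :
  diffq (fun x => a * u x + v x) = (fun p => a * diffq u p + diffq v p).
Proof. by apply/funext => p; rewrite /diffq; ring. Qed.

Lemma diffqB u v : diffq (fun x => u x - v x) = (fun p => diffq u p - diffq v p).
Proof. by apply/funext => p; rewrite /diffq; ring. Qed.

Lemma measurable_diffq u : measurable_fun setT u -> measurable_fun setT (diffq u).
Proof.
move=> mf; apply: measurable_funM; last exact: measurable_sqrt_kernel.
apply: measurable_funB.
- exact: measurableT_comp mf measurable_fst.
- exact: measurableT_comp mf measurable_snd.
Qed.

Lemma HsE u : Hs s u <-> sqi mu u /\ sqi (mu \x mu)%E (diffq u).
Proof.
rewrite /Hs /L2 patch_setT; split.
  move=> [/LfunP2 su hu]; split => //; split; first exact: measurable_diffq su.1.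
  by under eq_integral do rewrite exprMn sqr_sqrt_kernel.
move=> [su [_ hu]]; split; first exact/LfunP2.
by under eq_integral do rewrite -sqr_sqrt_kernel -exprMn.
Qed.

Lemma FsE u v : Fs s u v = C_Ns d s / 2 * l2ip (mu \x mu)%E (diffq u) (diffq v).
Proof.
congr (_ * _); apply: eq_Rintegral => p _.
by rewrite /diffq -sqr_sqrt_kernel; ring.
Qed.

(** If [P] holds outside a null set [N], the exceptional pairs lie in the union of
[N `*` setT] and [setT `*` N]. *)
Lemma ae_both (P : E -> Prop) : {ae mu, forall x, P x} ->
  {ae (mu \x mu)%E, forall p, P p.1 /\ P p.2}.
Proof.
move=> [N [mN N0 hN]].
have mNT : measurable (N `*` [set: E]) by exact: measurableX.
have mTN : measurable ([set: E] `*` N) by exact: measurableX.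
have e1 : (mu \x mu)%E (N `*` setT) = 0%E.
  by rewrite product_measure1E//; apply: etrans (mul0e _); congr (_ * _)%E; exact: N0.
have e2 : (mu \x mu)%E (setT `*` N) = 0%E.
  by rewrite product_measure1E//; apply: etrans (mule0 _); congr (_ * _)%E; exact: N0.
exists ((N `*` setT) `|` (setT `*` N)); split.
- exact: measurableU.
- by apply: (etrans (measureU0 mNT mTN e2)); exact: e1.
move=> [x y] /=; apply: contra_notP => /not_orP[h1 h2].
have e z : ~ N z -> P z by move=> Nz; apply: contrapT => uv; exact/Nz/hN.
by split; apply: e => ?; [exact: h1|exact: h2].
Qed.

(** Fractional Poincare inequality: a function vanishing outside the bounded set [Omega]
vanishes on a box [B] at distance one from it, and the kernel is bounded below on
[Omega `*` B], so that the part of the Gagliardo integral carried by this product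
already dominates the square of the [L2] norm. *)
Lemma poincare (Omega : set E) : (0 < d)%N -> measurable Omega -> bounded_set Omega ->
  0 < s -> s < 1 ->
  exists2 C : R, 0 < C & forall u, Hs0 Omega s u ->
    l2ip mu (u \_ Omega) (u \_ Omega) <= C * Fs s u u.
Proof.
move=> d0 mO bO s0 s1.
have [M [M1 hM]] : exists M : R, 1 < M /\ forall x, Omega x -> `|x| <= M.
  have [M [_ hM]] := bO.
  exists (`|M| + 2); split => [|x Ox]; first by have := normr_ge0 M; lra.
  by apply: hM Ox; have := ler_norm M; lra.
have hMi x i : Omega x -> `|x ord0 i| <= M.
  move=> Ox; apply: le_trans (hM x Ox).
  by rewrite [leRHS]/Num.Def.normr/= mx_normrE; exact: (le_bigmax _ (fun ij : 'I_1 * 'I_d => `|x ij.1 ij.2|) (ord0, i)).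
(* a cube of volume one, whose points are at distance at least one from those of Omega *)
pose B : set E := [set y | forall i, M + 1 < y ord0 i < M + 2].
have mB : measurable B by exact: measurable_box.
have muB : mu B = 1%E.
  rewrite /B lebesgue_box; last by lra.
  by rewrite (_ : M + 2 - (M + 1) = 1); [rewrite expr1n|ring].
(* D bounds the distance from a point of Omega to a point of B *)
pose D := Num.sqrt (d%:R * (2 * M + 2) ^+ 2).
pose q : R := d%:R + 2 * s.
have q0 : 0 < q by rewrite /q ltr_pwDr ?mulr_gt0.
have D0 : 0 < D by rewrite sqrtr_gt0 mulr_gt0 ?ltr0n// exprn_gt0//; lra.
have kD x y : Omega x -> B y -> D `^ (- q) <= kernel_Ns s (x, y).
  move=> Ox By; rewrite /kernel_Ns/= powRN.
  have i0 : 'I_d by exact: (Ordinal d0).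
  have e0 : 0 < enorm (x - y).
    apply: (enorm_gt0 (i := i0)); rewrite !mxE lt_eqF// subr_lt0.
    by have := By i0; have := hMi x i0 Ox; rewrite ler_norml => /andP[_ ?] /andP[? _]; lra.
  rewrite lef_pV2 ?posrE ?powR_gt0// ge0_ler_powR ?nnegrE ?(ltW q0) ?(ltW e0) ?(ltW D0)//.
  apply: enorm_le_coord => i; rewrite !mxE.
  have := By i; have := hMi x i Ox; rewrite !ler_norml => /andP[? ?] /andP[? ?].
  by apply/andP; split; lra.
pose K := D `^ (- q).
have K0 : 0 < K by rewrite powR_gt0.
have C0 : 0 < C_Ns d s by exact: C_Ns_gt0.
have key u : Hs0 Omega s u -> K * l2ip mu (u \_ Omega) (u \_ Omega) <=
    l2ip (mu \x mu)%E (diffq u) (diffq u).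
  move=> [/HsE[su sDu] [N [mN N0 hN]]].
  have suO := sqi_patch mO su.
  rewrite -lee_fin EFinM !l2ipE//.
  have mF : measurable_fun setT (fun p => (diffq u p ^+ 2)%:E).
    by apply/measurable_EFinP; apply: measurable_funX; exact: sDu.1.
  have F0 p : (0 <= (diffq u p ^+ 2)%:E)%E by rewrite lee_fin sqr_ge0.
  rewrite (fubini_tonelli1 _ mF F0).
  have mS : measurable_fun setT (fun x => ((u \_ Omega) x ^+ 2)%:E).
    by apply/measurable_EFinP; apply: measurable_funX; exact: suO.1.
  rewrite -ge0_integralZl//; last 2 first.
  - by move=> x _; rewrite lee_fin sqr_ge0.
  - by rewrite lee_fin ltW.
  apply: ge0_le_integral => //.
  - by move=> x _; rewrite mule_ge0// lee_fin ?sqr_ge0 ?(ltW K0).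
  - by apply: emeasurable_funM => //; exact: measurable_cst.
  - exact: measurable_fun_fubini_tonelli_F.
  move=> x _; rewrite /fubini_F /=.
  rewrite {1}/patch; case: ifPn => [/set_mem Ox|_]; last first.
    by rewrite expr0n/= mule0; apply: integral_ge0.
  have mFx : measurable_fun setT (fun y => (diffq u (x, y) ^+ 2)%:E).
    exact: measurable_fun_pair2 mF.
  apply: (@le_trans _ _ (\int[mu]_(y in B) (diffq u (x, y) ^+ 2)%:E)%E); last first.
    by apply: ge0_subset_integral => //; exact: measurable_funTS.
  have <- : (\int[mu]_(y in B) (cst (K%:E * (u x ^+ 2)%:E) y) = K%:E * (u x ^+ 2)%:E)%E.
    apply: (@etrans _ _ (K%:E * (u x ^+ 2)%:E * mu B)%E); first exact: integral_cst.
    by rewrite muB mule1.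
  apply: ae_ge0_le_integral => //.
  - by move=> y _; rewrite mule_ge0// lee_fin ?sqr_ge0 ?(ltW K0).
  - exact: measurable_funTS.
  exists N; split=> // y /=; apply: contra_notP => Ny By.
  have uy : u y = 0.
    apply: contrapT => uy; apply: Ny; apply: hN => h; apply: uy; apply: h => Oy.
    have i0 : 'I_d by exact: (Ordinal d0).
    have := hMi y i0 Oy; rewrite ler_norml => /andP[_ ?].
    by have := By i0 => /andP[? _]; lra.
  rewrite -EFinM lee_fin /diffq/= uy subr0 exprMn mulrC ler_wpM2l ?sqr_ge0//.
  by rewrite sqr_sqrt_kernel kD.
have K1 : 0 < 2 / (C_Ns d s * K) by apply: divr_gt0 => //; exact: mulr_gt0.
exists (2 / (C_Ns d s * K)) => // u /key.
rewrite FsE mulrA (_ : _ * (_ / 2) = K^-1); last by field; rewrite !gt_eqF.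
by move=> h; rewrite mulrC ler_pdivlMr// mulrC.
Qed.

End gagliardo.

(** * The Hilbert space of the problem *)
Section hs0_type.
Context {R : realType} (d : nat) (Omega : set 'rV[R]_d) (s : R).
Local Notation E := 'rV[R]_d.
Local Notation mu := (lebesgue_rV d).

Lemma Hs0_linear (a : R) (u v : E -> R) : Hs0 Omega s u -> Hs0 Omega s v ->
  Hs0 Omega s (fun x => a * u x + v x).
Proof.
move=> [/HsE[su du] u0] [/HsE[sv dv] v0]; split.
  by apply/HsE; rewrite diffq_linear; split; exact: sqi_linear.
by apply: (ae_mono (ae_and u0 v0)) => x [ux vx] Ox; rewrite ux// vx// mulr0 addr0.
Qed.

Lemma Hs0_0 : Hs0 Omega s (fun=> 0).
Proof.
split; last by exists set0; split=> // x /=; apply: contra_notP.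
apply/HsE; split; first exact: sqi0.
rewrite (_ : diffq _ _ = fun=> 0); first exact: sqi0.
by apply/funext => p; rewrite /diffq subrr mul0r.
Qed.

Definition hs0_pred : {pred (E -> R)} := fun u => `[<Hs0 Omega s u>].

Lemma hs0_submod_closed : submod_closed hs0_pred.
Proof.
split; first by apply/asboolP; exact: Hs0_0.
by move=> a u v /asboolP hu /asboolP hv; apply/asboolP; exact: Hs0_linear.
Qed.

HB.instance Definition _ := GRing.isSubmodClosed.Build _ _ hs0_pred hs0_submod_closed.

(** The functions of [Hs0] as a type of its own: a vector space to which the theory of
positive semidefinite forms applies. *)
Record hs0 := Hs0Elt { hs0_val :> E -> R; _ : hs0_val \in hs0_pred }.

HB.instance Definition _ := [isSub for hs0_val].
HB.instance Definition _ := [Choice of hs0 by <:].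
HB.instance Definition _ := [SubChoice_isSubLmodule of hs0 by <:].

Lemma hs0P (u : hs0) : Hs0 Omega s u.
Proof. by case: u => u /= /asboolP. Qed.

Definition Hs0_elt (u : E -> R) (hu : Hs0 Omega s u) : hs0 := Hs0Elt (asboolT hu).

Lemma hs0B (u v : hs0) : (u - v : hs0) = (fun x => u x - v x) :> (E -> R).
Proof. by []. Qed.

Lemma hs0_linearE (a : R) (u v : hs0) : (a *: u + v : hs0) = (fun x => a * u x + v x) :> (E -> R).
Proof. by []. Qed.

Definition gagliardo (u v : hs0) : R := Fs s u v.
Definition pivot (u v : hs0) : R := L2prod Omega u v.

End hs0_type.

Section hs0_hilbert.
Context {R : realType} (d : nat) (Omega : set 'rV[R]_d) (s : R).
Local Notation E := 'rV[R]_d.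
Local Notation mu := (lebesgue_rV d).
Local Notation V := (hs0 Omega s).
Local Notation aV := (@gagliardo R d Omega s).
Local Notation aH := (@pivot R d Omega s).

Lemma L2prodE (u v : E -> R) : L2prod Omega u v = l2ip mu (u \_ Omega) (v \_ Omega).
Proof.
rewrite /L2prod Rintegral_mkcond; apply: eq_Rintegral => x _.
by rewrite /patch; case: ifP => // _; rewrite mul0r.
Qed.

Lemma L2P (u : E -> R) : L2 Omega u <-> sqi mu (u \_ Omega).
Proof. exact: LfunP2. Qed.

Lemma sqr_L2norm (u : E -> R) : L2norm Omega u ^+ 2 = L2prod Omega u u.
Proof.
rewrite L2prodE /L2norm sqr_fine_Lnorm2 /l2ip /Rintegral.
by congr fine; apply: eq_integral => x _; rewrite expr2.
Qed.

Lemma hs0_sqi (u : V) : sqi mu u. Proof. by have [/HsE[]] := hs0P u. Qed.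

Lemma hs0_sqi_diffq (u : V) : sqi (mu \x mu)%E (diffq s u).
Proof. by have [/HsE[]] := hs0P u. Qed.

Lemma hs0_patch (u : V) : {ae mu, forall x, (u \_ Omega) x = u x}.
Proof.
have [_ u0] := hs0P u; apply: (ae_mono u0) => x ux.
by rewrite /patch; case: ifPn => // /negP; rewrite inE => /ux ->.
Qed.

Lemma pivotE (u v : V) : aH u v = l2ip mu u v.
Proof. by rewrite /pivot L2prodE; apply: eq_l2ip; exact: hs0_patch. Qed.

Lemma pivot_semi_inner : semi_inner aH.
Proof.
split=> [a u v w|u v|u].
- by rewrite !pivotE hs0_linearE l2ip_linear//; exact: hs0_sqi.
- by rewrite !pivotE l2ipC.
- by rewrite pivotE l2ip_ge0.
Qed.

Hypothesis C0 : 0 < C_Ns d s.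

Lemma gagliardo_semi_inner : semi_inner aV.
Proof.
split=> [a u v w|u v|u]; rewrite /gagliardo !FsE.
- by rewrite hs0_linearE diffq_linear l2ip_linear; [ring|exact: hs0_sqi_diffq..].
- by rewrite l2ipC.
- by rewrite mulr_ge0 ?l2ip_ge0// divr_ge0// ltW.
Qed.

Variables (Cp : R) (Cp0 : 0 < Cp).
Hypothesis hCp : forall u : V, aH u u <= Cp * aV u u.

(** A Cauchy sequence [u] and its difference quotients converge almost everywhere, along a
subsequence, and in [L2]: the former by the Poincare inequality, the latter by
definition of the form. *)
Lemma gagliardo_complete : ip_complete aV.
Proof.
have ha := gagliardo_semi_inner.
move=> u hu.
pose M := Cp + 2 / C_Ns d s.
have M0 : 0 < M by rewrite addr_gt0// divr_gt0.
have [c hc] : exists c : nat, M * 4^-1 ^+ c <= 1.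
  have : M * 4^-1 ^+ k @[k --> \oo] --> M * 0.
    by apply: cvgMr; apply: cvg_expr; rewrite ger0_norm; lra.
  rewrite mulr0 => /cvgrPdist_le/(_ 1 ltr01)[c _ hc]; exists c.
  have := hc c (leqnn c); rewrite /= sub0r normrN ger0_norm//.
  by rewrite mulr_ge0 ?(ltW M0)// exprn_ge0.
(* the even indices turn the rate 2^-k of the norms into the rate 16^-j of their squares,
and the shift by c absorbs the constant M *)
pose w j : V := u (2 * j + c)%N.
have hw j i : (j <= i)%N -> M * aV (w i - w j) (w i - w j) <= 16^-1 ^+ j.
  move=> ji; have := hu (2 * j + c)%N (2 * i + c)%N.
  rewrite leq_add2r leq_mul2l ji => /(_ isT).
  rewrite ipnorm_le ?exprn_ge0// exprAC.
  rewrite (_ : 2^-1 ^+ 2 = 4^-1); last by field.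
  rewrite exprD exprM (_ : 4^-1 ^+ 2 = 16^-1 :> R); last by field.
  move=> h; apply: (@le_trans _ _ (M * (16^-1 ^+ j * 4^-1 ^+ c))).
    by rewrite ler_wpM2l ?(ltW M0).
  by rewrite mulrCA -[leRHS]mulr1 ler_wpM2l ?exprn_ge0.
have aM u' : aH u' u' <= M * aV u' u'.
  apply: le_trans (hCp u') _; rewrite ler_wpM2r ?(sip_ge0 ha)//.
  by rewrite lerDl divr_ge0// ltW.
have dM (u' : V) : l2ip (mu \x mu)%E (diffq s u') (diffq s u') <= M * aV u' u'.
  rewrite /gagliardo FsE mulrA -[leLHS]mul1r ler_wpM2r ?l2ip_ge0//.
  rewrite /M mulrDl (_ : 2 / C_Ns d s * (C_Ns d s / 2) = 1); last by field; rewrite gt_eqF.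
  by rewrite lerDr mulr_ge0 ?(ltW Cp0)// divr_ge0 ?(ltW C0).
have w1 j i : (j <= i)%N -> l2ip mu (fun x => w i x - w j x) (fun x => w i x - w j x) <= 16^-1 ^+ j.
  move=> ji; rewrite -hs0B -pivotE.
  by apply: le_trans (aM (w i - w j)) _; exact: hw.
have w2 j i : (j <= i)%N -> l2ip (mu \x mu)%E
    (fun p => diffq s (w i) p - diffq s (w j) p) (fun p => diffq s (w i) p - diffq s (w j) p) <=
    16^-1 ^+ j.
  move=> ji; rewrite -diffqB -hs0B.
  by apply: le_trans (dM (w i - w j)) _; exact: hw.
have [f [sf cf _]] := sqi_complete (fun j => hs0_sqi (w j)) w1.
have [g [sg cg gr]] := sqi_complete (fun j => hs0_sqi_diffq (w j)) w2.
(* the limit of the difference quotients is the difference quotient of the limit *)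
have gf : {ae (mu \x mu)%E, forall p, g p = diffq s f p}.
  apply: (ae_mono (ae_and cg (ae_both cf))) => p [c1 [c2 c3]].
  have : diffq s (w k) p @[k --> \oo] --> diffq s f p by apply: cvgMl; exact: cvgB.
  by move: c1; exact: cvg_unique.
have Hf : Hs0 Omega s f.
  split.
    apply/HsE; split => //; split; first exact: measurable_diffq sf.1.
    apply: le_lt_trans sg.2; rewrite le_eqVlt; apply/orP; left; apply/eqP.
    by apply: eq_integral_ae; apply: (ae_mono gf) => p ->.
  have w0 j : {ae mu, forall x, ~ Omega x -> w j x = 0} by have [] := hs0P (w j).
  have := ae_foralln w0; move/(ae_and cf) => h.
  apply: (ae_mono h) => x [cx wx] Ox.
  have : w k x @[k --> \oo] --> (0 : R).
    by under eq_fun do rewrite (wx _ Ox); exact: cvg_cst.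
  by move: cx; exact: cvg_unique.
pose l : V := Hs0_elt Hf.
have wl j : aV (w j - l) (w j - l) <= C_Ns d s / 2 * 16^-1 ^+ j.
  rewrite /gagliardo FsE; apply: ler_wpM2l; first by apply: divr_ge0; rewrite ?(ltW C0).
  apply: le_trans (gr j); rewrite le_eqVlt; apply/orP; left; apply/eqP.
  by apply: eq_l2ip; rewrite hs0B diffqB; apply: (ae_mono gf) => p ->.
exists l => k.
apply/ler_addgt0Pr => e e0.
have : C_Ns d s / 2 * 16^-1 ^+ j @[j --> \oo] --> C_Ns d s / 2 * 0.
  by apply: cvgMr; apply: cvg_expr; rewrite ger0_norm; lra.
rewrite mulr0 => /cvgrPdist_le/(_ (e ^+ 2) (exprn_gt0 _ e0))[j0 _ hj].
pose j := maxn j0 k.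
rewrite (_ : u k - l = (u k - w j) + (w j - l)); last by rewrite addrA subrK.
apply: le_trans (ipnormD ha _ _) _; apply: lerD.
  rewrite ipnormB//; apply: hu; rewrite /j.
  apply: leq_trans (leq_maxr j0 k) _; apply: leq_trans (leq_addr _ _).
  by rewrite mul2n -addnn leq_addr.
rewrite ipnorm_le ?(ltW e0)//; apply: le_trans (wl j) _.
have := hj j (leq_maxl _ _); rewrite /= sub0r normrN; apply: le_trans.
exact: ler_norm.
Qed.

End hs0_hilbert.

(** * Limits for a semi-inner product *)
Section sip_limits.
Context {R : realType} {V : lmodType R} {b : V -> V -> R} (hb : semi_inner b).
Implicit Types (u : nat -> V) (l w : V).

Lemma sip_sub_sq (u v : V) : b (u - v) (u - v) = b u u - 2 * b u v + b v v.
Proof. by rewrite sipBl// !sipBr// (sip_sym hb v u); ring. Qed.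

Lemma ipnorm_cvg0_geometric (c : R) u l :
  (forall k, b (u k - l) (u k - l) <= c * 16^-1 ^+ k) -> ipnorm b (u k - l) @[k --> \oo] --> (0 : R).
Proof.
move=> h; have c0 : 0 <= c by have := h 0%N; rewrite expr0 mulr1; apply: le_trans; exact: sip_ge0.
apply: (@cvg_dist_le _ _ (fun k => Num.sqrt c * 4^-1 ^+ k)).
  move=> k; rewrite subr0 ger0_norm ?ipnorm_ge0// ipnorm_le ?mulr_ge0 ?sqrtr_ge0 ?exprn_ge0//.
  rewrite exprMn sqr_sqrtr// exprAC (_ : 4^-1 ^+ 2 = 16^-1); first exact: h.
  by field.
rewrite -(mulr0 (Num.sqrt c)); apply: cvgMr; apply: cvg_expr; rewrite ger0_norm; lra.
Qed.

Lemma sip_cvgl u l w : ipnorm b (u k - l) @[k --> \oo] --> (0 : R) ->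
  b (u k) w @[k --> \oo] --> b l w.
Proof.
move=> h; apply: (@cvg_dist_le _ _ (fun k => ipnorm b (u k - l) * ipnorm b w)).
  by move=> k; rewrite -sipBl//; exact: normr_sip_le.
by rewrite -(mul0r (ipnorm b w)); exact: cvgMl.
Qed.

Lemma sip_cvgr u l w : ipnorm b (u k - l) @[k --> \oo] --> (0 : R) ->
  b w (u k) @[k --> \oo] --> b w l.
Proof. move=> h; rewrite (sip_sym hb w l) (_ : (fun k => b w (u k)) = fun k => b (u k) w).
  exact: sip_cvgl.
by apply/funext => k; exact: sip_sym. Qed.

Lemma sip_cvg_sq u l : ipnorm b (u k - l) @[k --> \oo] --> (0 : R) ->
  b (u k) (u k) @[k --> \oo] --> b l l.
Proof.
move=> h; under eq_fun do rewrite -sqr_ipnorm//; rewrite -sqr_ipnorm//.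
by apply: cvg_sqr; apply: cvg_dist_le h => k; exact: ipnorm_dist.
Qed.

End sip_limits.

(** * The space of square integrable functions of time *)
Section l2time.
Context {R : realType} {V : lmodType R} (a : V -> V -> R) (I : set R).
Local Notation lambda := (@lebesgue_measure R).

(** The proofs are parameters of the predicate so that the closure properties that depend on
them can be found by inference. *)
Definition l2time_pred (_ : semi_inner a) (_ : measurable I) : {pred (R -> V)} :=
  fun X => `[<smeas a X /\ (sqint a I X < +oo)%E>].

Variables (ha : semi_inner a) (mI : measurable I).

Lemma l2time_submod_closed : submod_closed (l2time_pred ha mI).
Proof.
split.
  apply/asboolP; split; first by apply: simple_smeas => //; exact: simple_cst.
  by rewrite /sqint integral0_eq// => t _ /=; rewrite sip0l.
move=> c X Y /asboolP[sX fX] /asboolP[sY fY]; apply/asboolP.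
have scX : smeas a (fun t => c *: X t).
  by apply: (smeasZfun ha (f := fun=> c)) => //; exact: measurable_cst.
split; first exact: smeasD.
have fcX : (sqint a I (fun t => c *: X t) < +oo)%E.
  rewrite /sqint; under eq_integral do rewrite sipZl// sipZr// mulrA -expr2 EFinM.
  rewrite ge0_integralZl_EFin ?sqr_ge0//; last 2 first.
  - by move=> t _; rewrite lee_fin sip_ge0.
  - exact: smeas_sq_measurable.
  by rewrite lte_mul_pinfty// lee_fin sqr_ge0.
apply: le_lt_trans (sqint_le ha mI (smeasD ha scX sY) scX sY _) _.
  by move=> t _; exact: sipD_le.
by rewrite lte_add_pinfty// lte_mul_pinfty// lee_fin.
Qed.

HB.instance Definition _ := GRing.isSubmodClosed.Build _ _ (l2time_pred ha mI) l2time_submod_closed.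

Record l2time := L2Time { l2time_val :> R -> V; _ : l2time_val \in l2time_pred ha mI }.

HB.instance Definition _ := [isSub for l2time_val].
HB.instance Definition _ := [Choice of l2time by <:].
HB.instance Definition _ := [SubChoice_isSubLmodule of l2time by <:].

Definition l2time_elt (X : R -> V) (sX : smeas a X) (fX : (sqint a I X < +oo)%E) : l2time :=
  L2Time (asboolT (conj sX fX)).

Lemma l2time_smeas (X : l2time) : smeas a X.
Proof. by case: X => X /= /asboolP[]. Qed.

Lemma l2time_lty (X : l2time) : (sqint a I X < +oo)%E.
Proof. by case: X => X /= /asboolP[]. Qed.

(** Every form [b] dominated by [a] gives a form on functions of time. *)
Definition tip (b : V -> V -> R) (X Y : l2time) : R := \int[lambda]_(t in I) b (X t) (Y t).

Section form.
Variables (b : V -> V -> R) (c : R).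
Hypotheses (hb : semi_inner b) (hc : forall u v, `|b u v| <= c * ipnorm a u * ipnorm a v).

(** Young's inequality, pointwise in time. *)
Lemma tip_integrable (X Y : l2time) : lambda.-integrable I (EFin \o (fun t => b (X t) (Y t))).
Proof.
have mX := smeas_sq_measurable ha (l2time_smeas X).
have mY := smeas_sq_measurable ha (l2time_smeas Y).
have i2 (Z : l2time) : lambda.-integrable I (EFin \o (fun t => a (Z t) (Z t))).
  apply/integrableP; split; first exact: (smeas_sq_measurable ha (l2time_smeas Z)).
  by under eq_integral do rewrite /= ger0_norm ?sip_ge0//; exact: l2time_lty.
have iD : lambda.-integrable I (EFin \o (fun t => `|c| * (a (X t) (X t) + a (Y t) (Y t)))).
  have iXY := @integrableD _ _ R lambda I mI _ _ (i2 X) (i2 Y).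
  by have := @integrableZl _ _ R lambda I mI `|c| _ iXY; exact: eq_integrable.
apply: le_integrable iD => //.
  apply/measurable_EFinP; apply: measurable_funTS.
  apply: (smeas_measurable ha (c := c)) => //.
  - exact: sipBl.
  - exact: sipBr.
  - exact: l2time_smeas.
  - exact: l2time_smeas.
move=> t _ /=; rewrite lee_fin; apply: le_trans (hc _ _) _.
rewrite [leRHS]ger0_norm; last by rewrite mulr_ge0// addr_ge0// sip_ge0.
rewrite -mulrA; apply: (@le_trans _ _ (`|c| * (ipnorm a (X t) * ipnorm a (Y t)))).
  by rewrite ler_wpM2r ?ler_norm// mulr_ge0// ipnorm_ge0.
rewrite ler_wpM2l// -!(sqr_ipnorm ha).
by have := sqr_ge0 (ipnorm a (X t) - ipnorm a (Y t));
  have := sqr_ge0 (ipnorm a (X t) + ipnorm a (Y t)); nra.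
Qed.

Lemma tip_semi_inner : semi_inner (tip b).
Proof.
split=> [x X Y Z|X Y|X]; rewrite /tip.
- have i1 := tip_integrable X Z; have i2 := tip_integrable Y Z.
  rewrite -RintegralZl// -RintegralD//; last first.
    by have := @integrableZl _ _ R lambda I mI x _ i1; apply: eq_integrable.
  by apply: eq_Rintegral => t _; rewrite -sip_linear.
- by apply: eq_Rintegral => t _; rewrite sip_sym.
- by apply: Rintegral_ge0 => t _; exact: sip_ge0.
Qed.

End form.

Lemma sqint_tip (X : l2time) : sqint a I X = (tip a X X)%:E.
Proof.
rewrite /tip /Rintegral fineK// ge0_fin_numE; first exact: l2time_lty.
exact: sqint_ge0.
Qed.

End l2time.

(** * The space of square integrable functions *)
Section sqfun.
Context d (X : measurableType d) (R : realType) (m : {measure set X -> \bar R}).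

Definition sqfun_pred : {pred (X -> R)} := fun f => `[<sqi m f>].

Lemma sqfun_submod_closed : submod_closed sqfun_pred.
Proof.
split; first by apply/asboolP; exact: sqi0.
by move=> c f g /asboolP hf /asboolP hg; apply/asboolP; exact: sqi_linear.
Qed.

HB.instance Definition _ := GRing.isSubmodClosed.Build _ _ sqfun_pred sqfun_submod_closed.

Record sqfun := SqFun { sqfun_val :> X -> R; _ : sqfun_val \in sqfun_pred }.

HB.instance Definition _ := [isSub for sqfun_val].
HB.instance Definition _ := [Choice of sqfun by <:].
HB.instance Definition _ := [SubChoice_isSubLmodule of sqfun by <:].

Lemma sqfunP (f : sqfun) : sqi m f.
Proof. by case: f => f /= /asboolP. Qed.

Definition sqfun_elt f (sf : sqi m f) : sqfun := SqFun (asboolT sf).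

Definition sqip (f g : sqfun) : R := l2ip m f g.

Lemma sqip_semi_inner : semi_inner sqip.
Proof.
split=> [c f g h|f g|f].
- by rewrite -[LHS]/(l2ip m (fun x => c * f x + g x) h) l2ip_linear//; exact: sqfunP.
- exact: l2ipC.
- exact: l2ip_ge0.
Qed.

End sqfun.

(** * Cauchy sequences of exact solutions *)
Section approximations.
Context {R : realType} {V : lmodType R} (a h : V -> V -> R) (Cp T : R).
Hypotheses (ha : semi_inner a) (hh : semi_inner h) (ca : ip_complete a).
Hypotheses (Cp0 : 0 <= Cp) (hCp : forall u, h u u <= Cp * a u u) (T0 : 0 < T).
Local Notation lambda := (@lebesgue_measure R).
Local Notation I := (`]0, T[%classic : set R).

Let mI : measurable I. Proof. exact: measurable_itv. Qed.

Lemma sqint_itv_le (F : R -> V) (t : R) : smeas a F -> t <= T ->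
  (sqint a `[0%R, t] F <= sqint a I F)%E.
Proof.
move=> sF tT.
have mF := smeas_sq_measurable ha sF.
have -> : sqint a I F = sqint a `[0%R, T]%classic F.
  rewrite /sqint -[RHS](@integral_itv_bndo_bndc _ _ _ _ _) //.
    by rewrite -integral_itv_obnd_cbnd.
apply: ge0_subset_integral => //.
- exact: mF.
- by move=> x _; rewrite lee_fin sip_ge0.
- by move=> x /=; rewrite !in_itv/= => /andP[-> /le_trans]; exact.
Qed.

Lemma sqint_oo_le (F : R -> V) : smeas a F ->
  (sqint a I F <= sqint a `[0%R, T]%classic F)%E.
Proof.
move=> sF; apply: ge0_subset_integral => //.
- exact: smeas_sq_measurable.
- by move=> x _; rewrite lee_fin sip_ge0.
- by move=> x /=; rewrite !in_itv/= => /andP[/ltW -> /ltW].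
Qed.

Lemma resolvesN k v r : resolves a h k v r -> resolves a h k (- v) (- r).
Proof. by move=> hv w; rewrite !sipNl// hv mulrN opprD. Qed.

(** The equation is linear: the difference of two exact solutions is again one. *)
Lemma energy_le_diff m v r m' v' r' (t : R) :
  (forall k, resolves a h k.+1%:R (v k) (r k)) ->
  (forall k, resolves a h k.+1%:R (v' k) (r' k)) -> 0 <= t -> t <= T ->
  let D := fun t => expsum m v t - expsum m' v' t in
  is_true ((h (D t) (D t))%:E + sqint a `[0%R, t] D <= (h (D 0) (D 0))%:E +
    sqint a I (fun t => (expsum m r t - expsum m' r' t)%R))%E.
Proof.
move=> hv hv' t0 tT D.
pose M := maxn m m'.
pose pad n (c : nat -> V) k : V := if (k < n)%N then c k else 0.
pose w k := pad m v k - pad m' v' k.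
pose s k := pad m r k - pad m' r' k.
have hw k : resolves a h k.+1%:R (w k) (s k).
  apply: (resolvesD ha hh); last apply: resolvesN; rewrite /pad; case: ifP => _ //; exact: resolves0.
have padE c c' x : expsum M (fun k => pad m c k - pad m' c' k) x = expsum m c x - expsum m' c' x.
  by rewrite expsumD expsumN !expsum_pad ?leq_maxl ?leq_maxr.
have sqs : (sqint a `[0%R, t] (expsum M s) <=
    sqint a I (fun t => (expsum m r t - expsum m' r' t)%R))%E.
  have -> : expsum M s = fun x => expsum m r x - expsum m' r' x by apply/funext => x; exact: padE.
  by apply: sqint_itv_le => //; apply: smeasB => //; exact: smeas_expsum.
have := energy_le ha hh M hw t0.
have -> : expsum M w = D by apply/funext => x; exact: padE.
by move=> /le_trans; apply; apply: leeD.
Qed.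

(** The energy estimate for the difference of two approximations bounds it by the
difference of their data. *)
Lemma cauchy_approximations (p : nat -> V) (F : R -> V) :
  (forall k i, (k <= i)%N -> h (p i - p k) (p i - p k) <= 16^-1 ^+ k.+1) ->
  smeas a F -> (sqint a I F < +oo)%E ->
  exists (m : nat -> nat) (v r : nat -> nat -> V),
  [/\ forall k j, resolves a h j.+1%:R (v k j) (r k j),
      forall k, h (expsum (m k) (v k) 0 - p k) (expsum (m k) (v k) 0 - p k) <= 16^-1 ^+ k,
      forall k, (sqint a I (fun t => (expsum (m k) (r k) t - F t)%R) <= (16^-1 ^+ k)%:E)%E,
      forall k i t, (k <= i)%N -> 0 <= t -> t <= T ->
        h (expsum (m i) (v i) t - expsum (m k) (v k) t)
          (expsum (m i) (v i) t - expsum (m k) (v k) t) <= 16^-1 ^+ k &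
      forall k i, (k <= i)%N -> (sqint a I
        (fun t => (expsum (m i) (v i) t - expsum (m k) (v k) t)%R) <= (16^-1 ^+ k)%:E)%E].
Proof.
move=> hp sF fF.
(* the factor 1/64 leaves room for the errors of both approximations in their difference *)
have d0 k : 0 < 64^-1 * 16^-1 ^+ k :> R by rewrite mulr_gt0// exprn_gt0.
have ex k := exponential_density ha hh ca Cp0 hCp T0 (p k) sF fF (d0 k).
pose P k (q : nat * (nat -> V) * (nat -> V)) :=
  [/\ forall j, resolves a h j.+1%:R (q.1.2 j) (q.2 j),
    h (expsum q.1.1 q.1.2 0 - p k) (expsum q.1.1 q.1.2 0 - p k) <= 64^-1 * 16^-1 ^+ k &
    (sqint a I (fun t => (expsum q.1.1 q.2 t - F t)%R) <= (64^-1 * 16^-1 ^+ k)%:E)%E].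
have /choice[q hq] : forall k, exists q, P k q.
  by move=> k; have [m [v [r hvr]]] := ex k; exists (m, v, r).
pose m k := (q k).1.1; pose v k := (q k).1.2; pose r k := (q k).2.
have q1 k j : resolves a h j.+1%:R (v k j) (r k j) by have [] := hq k.
have q2 k : h (expsum (m k) (v k) 0 - p k) (expsum (m k) (v k) 0 - p k) <= 64^-1 * 16^-1 ^+ k.
  by have [] := hq k.
have q3 k : (sqint a I (fun t => (expsum (m k) (r k) t - F t)%R) <= (64^-1 * 16^-1 ^+ k)%:E)%E.
  by have [] := hq k.
have le16 k : 64^-1 * 16^-1 ^+ k <= 16^-1 ^+ k :> R.
  by rewrite ler_piMl ?exprn_ge0//; lra.
have mono k i : (k <= i)%N -> 16^-1 ^+ i <= 16^-1 ^+ k :> R.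
  by move=> ki; apply: ler_wiXn2l => //; lra.
have key k i t : (k <= i)%N -> 0 <= t -> t <= T ->
    let D := fun t => expsum (m i) (v i) t - expsum (m k) (v k) t in
    is_true ((h (D t) (D t))%:E + sqint a `[0%R, t] D <= (16^-1 ^+ k)%:E)%E.
  move=> ki t0 tT D; have := mono k i ki; set A := 16^-1 ^+ i; set B := 16^-1 ^+ k => AB.
  have B0 : 0 <= B by rewrite exprn_ge0.
  apply: le_trans (energy_le_diff (m i) (m k) (q1 i) (q1 k) t0 tT) _.
  have e1 : h (D 0) (D 0) <= 2^-1 * B.
    have -> : D 0 = (expsum (m i) (v i) 0 - p i) + ((p i - p k) - (expsum (m k) (v k) 0 - p k)).
      by rewrite opprB (addrA (p i - p k)) subrK addrA subrK.
    have s1 := sipD_le hh (expsum (m i) (v i) 0 - p i) ((p i - p k) - (expsum (m k) (v k) 0 - p k)).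
    have s2 := sipD_le hh (p i - p k) (- (expsum (m k) (v k) 0 - p k)).
    rewrite sipNl// sipNr// opprK in s2.
    have := q2 i; have := q2 k; have := hp k i ki; rewrite exprS -/A -/B.
    by move=> *; lra.
  have e2 : (sqint a I (fun t => (expsum (m i) (r i) t - expsum (m k) (r k) t)%R) <=
      (2 * (64^-1 * A) + 2 * (64^-1 * B))%:E)%E.
    apply: (sqint_trans ha mI _ sF _ (q3 i)); try exact: smeas_expsum.
    by rewrite sqintC//; exact: q3.
  apply: (@le_trans _ _ ((2^-1 * B)%:E + (2 * (64^-1 * A) + 2 * (64^-1 * B))%:E)%E).
    by apply: leeD; rewrite ?lee_fin.
  by rewrite -EFinD lee_fin; lra.
exists m, v, r; split => //.
- by move=> k; exact: le_trans (q2 k) (le16 k).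
- by move=> k; apply: le_trans (q3 k) _; rewrite lee_fin.
- move=> k i t ki t0 tT; rewrite -lee_fin; apply: le_trans (key k i t ki t0 tT).
  by rewrite leeDl// sqint_ge0.
- move=> k i ki; apply: le_trans (key k i T ki (ltW T0) (lexx T)).
  apply: (@le_trans _ _ (sqint a `[0%R, T]%classic (fun t => (expsum (m i) (v i) t - expsum (m k) (v k) t)%R))).
    by apply: sqint_oo_le; apply: smeasB => //; exact: smeas_expsum.
  by rewrite leeDr// lee_fin sip_ge0.
Qed.

End approximations.

(** * Square integrable classes in the sense of Bochner *)
Section lnorm2.
Context d (X : measurableType d) (R : realType) (m : {measure set X -> \bar R}).

Lemma Lnorm2_lty (f : X -> R) :
  (Lnorm m 2%:E (EFin \o f) < +oo)%E <-> (\int[m]_x (f x ^+ 2)%:E < +oo)%E.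
Proof.
have E : (Lnorm m 2%:E (EFin \o f) `^ 2 = \int[m]_x (f x ^+ 2)%:E)%E.
  rewrite poweR_Lnorm//; apply: eq_integral => x _ /=.
  by rewrite -(real_normK (num_real (f x))) -powR_mulrn.
split=> h; first by rewrite -E; exact: poweR_lty.
by apply: (@lty_poweRy _ _ 2) => //; rewrite E.
Qed.

End lnorm2.

Section bochner_rep.
Context {R : realType} {V : lmodType R} (a : V -> V -> R) (I : set R).
Variables (ha : semi_inner a) (mI : measurable I).
Context {W : zmodType} (D : set W) (nrm : W -> R).
Local Notation lambda := (@lebesgue_measure R).

Lemma bochner_norm (u : R -> W) (U : R -> V) :
  {ae lambda, forall t, I t -> nrm (u t) = ipnorm a (U t)} ->
  ((bochner_eL2norm nrm I u < +oo)%E <-> (sqint a I U < +oo)%E) /\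
  bochner_L2norm nrm I u ^+ 2 = fine (sqint a I U).
Proof.
move=> h.
have E : (\int[lambda]_t ((((nrm \o u) \_ I) t) ^+ 2)%:E = sqint a I U)%E.
  rewrite /sqint [RHS]integral_mkcond; apply: eq_integral_ae.
  apply: (ae_mono h) => t ht _; rewrite /patch; case: ifPn => [/set_mem It|_].
    by rewrite /= ht// sqr_ipnorm.
  by rewrite expr0n.
split; first by rewrite /bochner_eL2norm -E; exact: Lnorm2_lty.
by rewrite /bochner_L2norm /bochner_eL2norm sqr_fine_Lnorm2 E.
Qed.

(** A class is turned into a function defined everywhere and measurable everywhere, by
setting it to zero on the exceptional null set and outside [I]. *)
Lemma bochner_L2_rep (rep : W -> V) (u : R -> W) :
  (forall x, D x -> ipnorm a (rep x) = nrm x) ->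
  (forall x y, D x -> D y -> ipnorm a (rep x - rep y) = nrm (x - y)) ->
  bochner_L2 D nrm I u ->
  exists2 U : l2time ha mI, {ae lambda, forall t, I t -> D (u t) /\ U t = rep (u t)} &
    bochner_L2norm nrm I u ^+ 2 = tip a U U.
Proof.
move=> r1 r2 [[g sg [N [mN N0 hN]]] fu].
pose B := I `\` N; have mB : measurable B by exact: measurableD.
pose U t := if t \in B then rep (u t) else 0.
have good t : ~ N t -> I t -> D (u t) /\ nrm (g k t - u t) @[k --> \oo] --> (0 : R).
  by move=> Nt; apply: contrapT => ng; exact/Nt/hN.
have sU : smeas a U.
  exists (fun k t => if t \in B then (rep \o g k) t else 0).
    move=> k; apply: simple_restrict => //; apply: simple_comp.
    by have [? _ ?] := sg k.
  move=> t; rewrite /U; case: ifPn => [/set_mem[It Nt]|_]; last first.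
    by rewrite subrr ipnorm0//; exact: cvg_cst.
  have [Dt ct] := good t Nt It.
  rewrite (_ : (fun k => _) = fun k => nrm (g k t - u t))//.
  apply/funext => k; rewrite r2//; have [_ gD _] := sg k; apply: gD; by exists t.
have aeU : {ae lambda, forall t, I t -> D (u t) /\ U t = rep (u t)}.
  exists N; split=> // t /=; apply: contra_notP => Nt It.
  by have [Dt _] := good t Nt It; rewrite /U mem_set.
have aeN : {ae lambda, forall t, I t -> nrm (u t) = ipnorm a (U t)}.
  by apply: (ae_mono aeU) => t h It; have [Dt ->] := h It; rewrite r1.
have [fin nE] := bochner_norm aeN.
by exists (l2time_elt ha mI sU (fin.1 fu)); rewrite // nE -sqint_tip.
Qed.

Lemma bochner_L2_emb (emb : V -> W) (U : l2time ha mI) :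
  (forall v, D (emb v)) -> (forall v, nrm (emb v) = ipnorm a v) ->
  (forall v w, nrm (emb v - emb w) = ipnorm a (v - w)) ->
  bochner_L2 D nrm I (emb \o U) /\ bochner_L2norm nrm I (emb \o U) ^+ 2 = tip a U U.
Proof.
move=> eD e1 e2.
have aeN : {ae lambda, forall t, I t -> nrm ((emb \o U) t) = ipnorm a (U t)}.
  by exists set0; split=> // t /=; apply: contra_notP.
have [fin nE] := bochner_norm aeN.
split; last by rewrite nE sqint_tip.
split; last exact/fin/l2time_lty.
have [g sg cg] := l2time_smeas U.
exists (fun k => emb \o g k).
  move=> k; have [fg mg] := simple_comp emb (sg k); split => //.
  by move=> _ [t _ <-]; exact: eD.
exists set0; split=> // t /=; apply: contra_notP => _ It; split => //=.
by under eq_fun do rewrite e2; exact: cg.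
Qed.

End bochner_rep.

Section dual.
Context {R : realType} (d : nat) (Omega : set 'rV[R]_d) (s : R).
Local Notation E := 'rV[R]_d.
Local Notation mu := (lebesgue_rV d).
Local Notation V := (hs0 Omega s).
Local Notation aV := (@gagliardo R d Omega s).
Local Notation Hms := (Hms Omega s).
Hypotheses (ha : semi_inner aV) (ca : ip_complete aV).

Definition to_hs0 (u : E -> R) : V :=
  if pselect (Hs0 Omega s u) is left hu then Hs0_elt hu else 0.

Lemma to_hs0E u : Hs0 Omega s u -> to_hs0 u = u :> (E -> R).
Proof. by rewrite /to_hs0; case: pselect. Qed.

Definition riesz_functional (v : V) : (E -> R) -> R := fun u => Fs s v u.

Lemma riesz_functionalE (v w : V) : riesz_functional v w = aV v w.
Proof. by []. Qed.

(** The supremum is attained at the multiple of [v] of norm one, unless [v] has norm zero. *)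
Lemma Hms_normE (F : (E -> R) -> R) (v : V) : (forall w : V, F w = aV v w) ->
  Hms_norm Omega s F = ipnorm aV v.
Proof.
move=> hF; rewrite /Hms_norm.
set A := [set _ | _ in _].
have ubA : ubound A (ipnorm aV v).
  move=> _ [u [Hu u1] <-]; rewrite -(to_hs0E Hu) hF.
  apply: le_trans (normr_sip_le ha _ _) _.
  rewrite -[leRHS]mulr1 ler_wpM2l ?ipnorm_ge0//.
  by rewrite -(to_hs0E Hu) in u1.
have A0 : A !=set0.
  exists `|F (0 : V)|; exists (0 : V) => //; split; first exact: hs0P.
  by rewrite -[Hs0_norm _ _]/(ipnorm aV 0) ipnorm0.
apply/eqP; rewrite eq_le; apply/andP; split; first exact: ge_sup.
have [->|v0] := eqVneq (ipnorm aV v) 0.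
  have [x Ax] := A0; apply: le_trans (ub_le_sup _ Ax); last by exists (ipnorm aV v).
  by case: Ax => u _ <-.
have vp : 0 < ipnorm aV v by rewrite lt_neqAle eq_sym v0 ipnorm_ge0.
apply: ub_le_sup; first by exists (ipnorm aV v).
pose w : V := (ipnorm aV v)^-1 *: v.
exists w.
  split; first exact: hs0P.
  by rewrite -[Hs0_norm _ _]/(ipnorm aV w) ipnormZ// ger0_norm ?invr_ge0 ?ipnorm_ge0// mulVf.
rewrite hF /w sipZr// -sqr_ipnorm// expr2 mulKf// ger0_norm ?ipnorm_ge0//.
Qed.

Lemma riesz_functional_Hms v : Hms (riesz_functional v).
Proof.
split=> [c u w Hu Hw|].
  rewrite -(to_hs0E Hu) -(to_hs0E Hw) -hs0_linearE !riesz_functionalE.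
  by rewrite (sipDr ha) (sipZr ha).
exists (ipnorm aV v) => u Hu; rewrite -(to_hs0E Hu) riesz_functionalE.
exact: normr_sip_le.
Qed.

Lemma Hms_riesz F : Hms F -> exists v : V, forall w : V, F w = aV v w.
Proof.
move=> [lF [M hM]].
have [v hv] := @riesz _ _ aV aV ha ca 1 (fun w : V => F w) M ler01
  (fun u => lexx _) (fun u => ltac:(by rewrite mul1r))
  (fun c u w => lF c u w (hs0P u) (hs0P w)) (fun u => hM u (hs0P u)).
by exists v => w; rewrite hv.
Qed.

(** A total function, as functions of time are composed with it; its value outside the dual
space is arbitrary. *)
Definition representer (F : (E -> R) -> R) : V :=
  if pselect (exists v : V, forall w : V, F w = aV v w) is left hF then projT1 (cid hF) else 0.

Lemma representerE F (w : V) : Hms F -> F w = aV (representer F) w.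
Proof.
move=> /Hms_riesz hF; rewrite /representer; case: pselect => // hF'.
exact: (projT2 (cid hF')).
Qed.

Variables (T : R) (I : set R) (mI : measurable I).

Lemma bochner_hs0_rep (u : R -> E -> R) :
  bochner_L2 (Hs0 Omega s) (Hs0_norm s) I u ->
  exists2 U : l2time ha mI,
    {ae @lebesgue_measure R, forall t, I t -> U t = u t :> (E -> R)} &
    bochner_L2norm (Hs0_norm s) I u ^+ 2 = tip aV U U.
Proof.
move=> hu; have [||U aeU nU] := bochner_L2_rep ha mI (rep := to_hs0) _ _ hu.
- by move=> v Hv; rewrite /ipnorm /gagliardo to_hs0E.
- by move=> v w Hv Hw; rewrite /ipnorm /gagliardo hs0B !to_hs0E.
exists U => //; apply: (ae_mono aeU) => t h It.
by have [Hu ->] := h It; rewrite to_hs0E.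
Qed.

Lemma bochner_Hms_rep (f : R -> (E -> R) -> R) :
  bochner_L2 Hms (Hms_norm Omega s) I f ->
  exists2 F : l2time ha mI,
    {ae @lebesgue_measure R, forall t, I t -> forall w : V, f t w = aV (F t) w} &
    bochner_L2norm (Hms_norm Omega s) I f ^+ 2 = tip aV F F.
Proof.
move=> hf; have [||F aeF nF] := bochner_L2_rep ha mI (rep := representer) _ _ hf.
- by move=> f1 Hf; apply/esym/Hms_normE => w; exact: representerE.
- move=> f1 f2 H1 H2; apply/esym/Hms_normE => w.
  by rewrite sipBl// -!representerE.
exists F => //; apply: (ae_mono aeF) => t h It w.
by have [Hf ->] := h It; rewrite representerE.
Qed.

Lemma bochner_hs0_emb (U : l2time ha mI) :
  bochner_L2 (Hs0 Omega s) (Hs0_norm s) I (fun t => U t : E -> R) /\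
  bochner_L2norm (Hs0_norm s) I (fun t => U t : E -> R) ^+ 2 = tip aV U U.
Proof. by apply: bochner_L2_emb => // v; exact: hs0P. Qed.

Lemma bochner_Hms_emb (U : l2time ha mI) :
  bochner_L2 Hms (Hms_norm Omega s) I (fun t => riesz_functional (U t)) /\
  bochner_L2norm (Hms_norm Omega s) I (fun t => riesz_functional (U t)) ^+ 2 = tip aV U U.
Proof.
apply: (bochner_L2_emb (emb := riesz_functional)) => [v|v|v w].
- exact: riesz_functional_Hms.
- by apply: Hms_normE => w; exact: riesz_functionalE.
- by apply: Hms_normE => z; rewrite sipBl.
Qed.

End dual.

(** * Passing to the limit *)
Section sqip_tools.
Context {R : realType} (d : nat) (Omega : set 'rV[R]_d).
Local Notation mu := (lebesgue_rV d).
Hypothesis mO : measurable Omega.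

Lemma L2norm_le (f : 'rV[R]_d -> R) : sqi mu f -> L2norm Omega f <= Num.sqrt (l2ip mu f f).
Proof.
move=> sf; have sfO := sqi_patch mO sf.
have -> : L2norm Omega f = Num.sqrt (L2norm Omega f ^+ 2).
  by rewrite sqrtr_sqr ger0_norm// fine_ge0// Lnorm_ge0.
rewrite ler_wsqrtr// sqr_L2norm L2prodE -lee_fin !l2ipE//.
apply: ge0_le_integral => //.
- by move=> x _; rewrite lee_fin sqr_ge0.
- by apply/measurable_EFinP; apply: measurable_funX; exact: sfO.1.
- by apply/measurable_EFinP; apply: measurable_funX; exact: sf.1.
- move=> x _; rewrite lee_fin /patch; case: ifP => // _.
  by rewrite expr0n/= sqr_ge0.
Qed.

End sqip_tools.

Section l2time_tools.
Context {R : realType} {V : lmodType R} (a : V -> V -> R) (T : R).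
Local Notation I := (`]0, T[%classic : set R).
Variables (ha : semi_inner a) (mI : measurable I).
Local Notation lambda := (@lebesgue_measure R).

Lemma normr_sip_le1 u v : `|a u v| <= 1 * ipnorm a u * ipnorm a v.
Proof. by rewrite mul1r; exact: normr_sip_le. Qed.

Lemma smeas_affine (sigma c : R) X : smeas a X -> smeas a (fun t => X (sigma * t + c)).
Proof.
move=> [g sg cg]; exists (fun k t => g k (sigma * t + c)) => [k|t]; last exact: cg.
have [fg mg] := sg k; split.
  by apply: sub_finite_set fg => _ [t _ <-]; exists (sigma * t + c).
move=> v; have mt : measurable_fun setT (fun t : R => sigma * t + c).
  by apply: continuous_measurable_fun => t; apply: cvgD; [exact: mulrl_continuous|exact: cvg_cst].
by have := mt measurableT _ (mg v); rewrite setTI.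
Qed.

Lemma sqint_continuous_lty X : continuous (fun t : R => a (X t) (X t)) -> (sqint a I X < +oo)%E.
Proof.
move=> cX; have /integrableP[_] := @continuous_integrable_oo R T _ cX.
by under eq_integral do rewrite /= ger0_norm ?sip_ge0//.
Qed.

(** Testing with [theta t *: w] turns scalar integrals against [theta] into values of the
forms on functions of time, whose continuity then does the limits. *)
Definition ctime (theta : R -> R) (ct : continuous theta) (w : V) : l2time ha mI.
Proof.
apply: (@l2time_elt _ _ a I ha mI (fun t => theta t *: w)).
  apply: smeasZfun => //; first exact: continuous_measurable_fun.
  by apply: simple_smeas => //; exact: simple_cst.
apply: sqint_continuous_lty => t; under eq_fun do rewrite sipZl// sipZr//.
by apply: cvgM; [exact: ct|apply: cvgMl; exact: ct].
Defined.

Lemma tip_ctime (b : V -> V -> R) theta (ct : continuous theta) w (X : l2time ha mI) :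
  semi_inner b -> tip b X (ctime ct w) = \int[lambda]_(t in I) (theta t * b (X t) w).
Proof. by move=> hb; apply: eq_Rintegral => t _; rewrite /= sipZr. Qed.

Lemma tip_dom (h : V -> V -> R) (Cp : R) : semi_inner h -> 0 <= Cp ->
  (forall u, h u u <= Cp * a u u) -> forall X : l2time ha mI, tip h X X <= Cp * tip a X X.
Proof.
move=> hh Cp0 hCp X.
have bh := normr_hle hh Cp0 hCp.
rewrite /tip -RintegralZl//; last exact: tip_integrable ha normr_sip_le1 _ _.
apply: le_Rintegral => //; first exact: tip_integrable hh bh _ _.
  have i1 := tip_integrable ha normr_sip_le1 X X.
  by have := @integrableZl _ _ R lambda I mI Cp _ i1; apply: eq_integrable.
Qed.

Lemma tip_self : semi_inner (@tip _ _ _ _ ha mI a).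
Proof. exact: tip_semi_inner ha normr_sip_le1. Qed.

End l2time_tools.

Section time_limit.
Context {R : realType} (d : nat) (Omega : set 'rV[R]_d) (s T : R).
Local Notation E := 'rV[R]_d.
Local Notation mu := (lebesgue_rV d).
Local Notation lambda := (@lebesgue_measure R).
Local Notation V := (hs0 Omega s).
Local Notation aV := (@gagliardo R d Omega s).
Local Notation aH := (@pivot R d Omega s).
Local Notation I := (`]0, T[%classic : set R).
Hypotheses (mO : measurable Omega) (ha : semi_inner aV) (ca : ip_complete aV).
Variables (Cp : R) (Cp0 : 0 <= Cp) (hCp : forall u : V, aH u u <= Cp * aV u u).
Hypotheses (T0 : 0 < T) (mI : measurable I).
Local Notation L2V := (l2time ha mI).
Let hh : semi_inner aH := pivot_semi_inner Omega s.

Let bh u v : `|aH u v| <= Cp * ipnorm aV u * ipnorm aV v.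
Proof. exact: normr_hle. Qed.

Let tH : semi_inner (@tip _ _ _ _ ha mI aH) := tip_semi_inner ha mI hh bh.
Let tV : semi_inner (@tip _ _ _ _ ha mI aV) := tip_self ha mI.

Lemma tip_pivot_cvg (X : nat -> L2V) (Y : L2V) :
  ipnorm (tip aV) (X k - Y) @[k --> \oo] --> (0 : R) ->
  ipnorm (tip aH) (X k - Y) @[k --> \oo] --> (0 : R).
Proof.
move=> h; apply: (@cvg_dist_le _ _ (fun k => Num.sqrt Cp * ipnorm (tip aV) (X k - Y))).
  move=> k; rewrite subr0 ger0_norm ?ipnorm_ge0//.
  by apply: ipnorm_dom => // Z; exact: tip_dom.
suff : (fun k => Num.sqrt Cp * ipnorm (tip aV) (X k - Y)) @ \oo --> Num.sqrt Cp * 0.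
  by rewrite mulr0.
exact: cvgMr.
Qed.

Variables (sigma c : R) (m : nat -> nat) (v r : nat -> nat -> V).
Hypothesis hvr : forall k j, resolves aV aH j.+1%:R (v k j) (r k j).
Let X k (t : R) : V := expsum (m k) (v k) (sigma * t + c).
Let Y k (t : R) : V := expsum (m k) (r k) (sigma * t + c).

Let continuous_tau : continuous (fun t : R => sigma * t + c).
Proof. by move=> t; apply: cvgD; [exact: mulrl_continuous|exact: cvg_cst]. Qed.

Let continuous_comp_tau (f : R -> R) : continuous f -> continuous (fun t : R => f (sigma * t + c)).
Proof.
move=> cf t; have h1 : {for sigma * t + c, continuous f} by exact: cf.
by apply: (@cvg_comp _ _ _ (fun t : R => sigma * t + c) f); [exact: continuous_tau|exact: h1].
Qed.

Let expsum_elt (n : nat) (w : nat -> V) : L2V.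
Proof.
apply: (@l2time_elt _ _ aV I ha mI (fun t => expsum n w (sigma * t + c))).
  by apply: smeas_affine; exact: smeas_expsum.
apply: sqint_continuous_lty => // t.
apply: (@continuous_comp_tau (fun x => aV (expsum n w x) (expsum n w x))).
exact: (@continuous_ip_expsum _ _ aV n w w ha).
Defined.

Let Xs k : L2V := expsum_elt (m k) (v k).
Let Ys k : L2V := expsum_elt (m k) (r k).

Lemma is_derive_tau_pairing k (w : V) (t : R) : is_derive t 1 (fun t => aH (X k t) w)
  (sigma * (aV (Y k t) w - aV (X k t) w)).
Proof.
have d1 : is_derive t 1 (fun t : R => sigma * t + c) sigma.
  by apply: is_derive_eq; rewrite addr0 /GRing.scale/= mulr1.
have d2 := is_derive_pairing ha hh (m k) (hvr k) (sigma * t + c) w.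
rewrite mulrC; exact: (@is_derive1_comp R (fun x : R => aH (expsum (m k) (v k) x) w)
  (fun t : R => sigma * t + c) t _ _ d2 d1).
Qed.

Let continuous_X k (w : V) : continuous (fun t : R => aH (X k t) w).
Proof. by move=> t; exact: is_derive_continuous (is_derive_tau_pairing k w t). Qed.

Let continuous_aV n (u : nat -> V) (w : V) :
  continuous (fun t : R => aV (expsum n u (sigma * t + c)) w).
Proof.
apply: (@continuous_comp_tau (fun x => aV (expsum n u x) w)) => x.
have -> : (fun x => aV (expsum n u x) w) =
    fun x : R => \sum_(i < n) expR (i.+1%:R * x) * aV (u i) w.
  apply/funext => y; rewrite /expsum (sip_suml ha); apply: eq_bigr => i _.
  by rewrite (sipZl ha).
have dx (i : 'I_n) : is_derive x 1 (fun y : R => expR (i.+1%:R * y) * aV (u i) w)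
    (i.+1%:R * expR (i.+1%:R * x) * aV (u i) w).
  have h1 := is_derive_expRM (i.+1%:R) x.
  by apply: is_derive_eq; rewrite /GRing.scale/=; ring.
exact: is_derive_continuous (is_derive_bigsum dx).
Qed.

Lemma test_fun_is_derive theta (t : R) : test_fun T theta -> is_derive t 1 theta (derive1 theta t).
Proof.
by move=> [/(_ 0%N t) dtheta _]; rewrite derive1E; exact/derivableP.
Qed.

Lemma test_fun_continuous theta : test_fun T theta -> continuous theta.
Proof. by move=> h t; exact: is_derive_continuous (test_fun_is_derive t h). Qed.

Lemma test_fun_derive_continuous theta : test_fun T theta -> continuous (derive1 theta).
Proof.
by move=> [dtheta _] t; have /derivableP := dtheta 1%N t; exact: is_derive_continuous.
Qed.

Lemma Rintegral_oo_cc (f : R -> R) : continuous f ->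
  \int[lambda]_(t in I) f t = \int[lambda]_(t in `[0%R, T]) f t.
Proof.
move=> cf; have mf (D : set R) : measurable_fun D (EFin \o f).
  by apply/measurable_EFinP; apply: measurable_funTS; exact: continuous_measurable_fun.
rewrite /Rintegral -[in RHS](@integral_itv_bndo_bndc _ _ _ _ (mf _)).
by rewrite -(@integral_itv_obnd_cbnd _ _ _ _ (mf _)).
Qed.

(** An exact integration by parts: the approximations are differentiable and [theta]
vanishes at both ends. *)
Lemma time_derivative_approx k theta (w : V) : test_fun T theta ->
  \int[lambda]_(t in I) (derive1 theta t * aH (X k t) w) =
  - \int[lambda]_(t in I) (theta t * (sigma * (aV (Y k t) w - aV (X k t) w))).
Proof.
move=> ht; have [_ [x [y [x0 yT theta0]]]] := ht.
pose dh t := sigma * (aV (Y k t) w - aV (X k t) w).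
have cdh : continuous dh.
  by move=> t; apply: cvgMr; apply: cvgB; exact: continuous_aV.
have ch := @continuous_X k w.
have ct := test_fun_continuous ht; have cdt := test_fun_derive_continuous ht.
have c1 : continuous (fun t => derive1 theta t * aH (X k t) w).
  by move=> t; apply: cvgM; [exact: cdt|exact: ch].
have c2 : continuous (fun t => theta t * dh t).
  by move=> t; apply: cvgM; [exact: ct|exact: cdh].
have c12 : continuous (fun t => derive1 theta t * aH (X k t) w + theta t * dh t).
  by move=> t; apply: cvgD; [exact: c1|exact: c2].
have dp (t : R) : is_derive t 1 (fun t => theta t * aH (X k t) w)
    (derive1 theta t * aH (X k t) w + theta t * dh t).
  have h1 := test_fun_is_derive t ht; have h2 := is_derive_tau_pairing k w t.
  by apply: is_derive_eq; rewrite /dh /GRing.scale/=; ring.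
have f0 := FTC2_continuous (ltW T0) c12 dp.
have t0 : theta 0 = 0 by apply: theta0 => /andP[]; rewrite leNgt x0.
have tT : theta T = 0 by apply: theta0 => /andP[_]; rewrite leNgt yT.
have g0 (p q : R) : theta T * p - theta 0 * q = 0 by rewrite t0 tT !mul0r subrr.
have := etrans (Rintegral_oo_cc c12) (etrans f0 (g0 _ _)).
rewrite RintegralD//; last 2 first.
- exact: continuous_integrable_oo.
- exact: continuous_integrable_oo.
by move/eqP; rewrite addr_eq0 => /eqP.
Qed.

Hypothesis Xcauchy : forall k i t, (k <= i)%N -> 0 <= t -> t <= T ->
  aH (X i t - X k t) (X i t - X k t) <= 16^-1 ^+ k.
Hypothesis Xsqint : forall k i, (k <= i)%N ->
  (sqint aV I (fun t => (X i t - X k t)%R) <= (16^-1 ^+ k)%:E)%E.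
Variable F : L2V.
Hypothesis Ycvg : forall k, (sqint aV I (fun t => (Y k t - F t)%R) <= (16^-1 ^+ k)%:E)%E.

Lemma limit_exists : exists Xinf : L2V,
  forall k, tip aV (Xs k - Xinf) (Xs k - Xinf) <= 4 * 16^-1 ^+ k.
Proof.
have [rho srho hrho] := @sqint_complete _ _ aV ha I mI ca (fun k => Xs k)
  (fun k => l2time_smeas (Xs k)) (fun k => l2time_lty (Xs k)) Xsqint.
have sD k : smeas aV (fun t => Xs k t - rho t) by apply: smeasB => //; exact: l2time_smeas.
have fD k := le_lt_trans (hrho k) (ltry (4 * 16^-1 ^+ k)).
exists (Xs 0%N - l2time_elt ha mI (sD 0%N) (fD 0%N)) => k.
rewrite -lee_fin -sqint_tip; apply: le_trans (hrho k).
rewrite le_eqVlt; apply/orP; left; apply/eqP; congr sqint; apply/funext => t /=.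
by change (X k t - (X 0%N t - (X 0%N t - rho t)) = X k t - rho t); rewrite subKr.
Qed.

Variable Xinf : L2V.
Hypothesis Xrate : forall k, tip aV (Xs k - Xinf) (Xs k - Xinf) <= 4 * 16^-1 ^+ k.

Lemma Xs_cvg : ipnorm (tip aV) (Xs k - Xinf) @[k --> \oo] --> (0 : R).
Proof. exact: ipnorm_cvg0_geometric Xrate. Qed.

Lemma Ys_cvg : ipnorm (tip aV) (Ys k - F) @[k --> \oo] --> (0 : R).
Proof.
apply: (ipnorm_cvg0_geometric tV (c := 1)) => k; rewrite mul1r -lee_fin -sqint_tip.
exact: Ycvg.
Qed.

Lemma limit_time_derivative : is_time_derivative Omega s T (fun t => Xinf t : E -> R)
  (fun t => riesz_functional (sigma *: (F - Xinf) t)).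
Proof.
move=> theta ht w0 /to_hs0E <-; set w := to_hs0 Omega s w0.
have ct := test_fun_continuous ht; have cdt := test_fun_derive_continuous ht.
pose W0 := ctime ha mI ct w; pose W1 := ctime ha mI cdt w.
have e1 : \int[lambda]_(t in I) (derive1 theta t * L2prod Omega (Xinf t) w) = tip aH Xinf W1.
  by rewrite tip_ctime.
have e2 : \int[lambda]_(t in I) (theta t * riesz_functional (sigma *: (F - Xinf) t) w) =
    tip aV (sigma *: (F - Xinf)) W0 by rewrite tip_ctime.
rewrite e1 e2.
have c1 := @sip_cvgl _ _ _ tH _ _ W1 (tip_pivot_cvg Xs_cvg).
have c2 : - tip aV (sigma *: (Ys k - Xs k)) W0 @[k --> \oo] --> - tip aV (sigma *: (F - Xinf)) W0.
  apply: cvgN; rewrite (sipZl tV) (sipBl tV).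
  under eq_fun => k do rewrite (sipZl tV) (sipBl tV).
  by apply: cvgMr; apply: cvgB; apply: (sip_cvgl tV); [exact: Ys_cvg|exact: Xs_cvg].
move: c1; rewrite (_ : (fun k => tip aH (Xs k) W1) = fun k => - tip aV (sigma *: (Ys k - Xs k)) W0).
  by move=> c3; move: c2; move: c3; exact: cvg_unique.
apply/funext => k; rewrite !tip_ctime// (time_derivative_approx k w ht); congr (- _).
by apply: eq_Rintegral => t _ /=; rewrite (sipZl ha) (sipBl ha).
Qed.

(** The approximations converge uniformly in time for the pivot form, which gives a
continuous limit; for almost every time they also converge for the energy form to
[Xinf], because their distances to it decrease geometrically in square mean. *)
Lemma limit_continuous_rep : exists Xc : R -> E -> R,
  continuous_rep Omega T (fun t => Xinf t : E -> R) Xc /\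
  forall t, 0 <= t -> t <= T -> sqi mu (Xc t) /\
    forall k, l2ip mu (fun x => X k t x - Xc t x) (fun x => X k t x - Xc t x) <= 16^-1 ^+ k.
Proof.
have ex t : exists f : E -> R, 0 <= t -> t <= T -> sqi mu f /\
    forall k, l2ip mu (fun x => X k t x - f x) (fun x => X k t x - f x) <= 16^-1 ^+ k.
  have [t0|] := leP 0 t; last by exists (fun=> 0).
  have [tT|] := leP t T; last by exists (fun=> 0).
  have cX k i : (k <= i)%N -> l2ip mu (fun x => X i t x - X k t x) (fun x => X i t x - X k t x) <= 16^-1 ^+ k.
    by move=> ki; rewrite -hs0B -pivotE; exact: Xcauchy.
  have [f [sf _ hf]] := sqi_complete (fun k => hs0_sqi (X k t)) cX.
  by exists f.
have [Xc hXc] := choice ex.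
exists Xc; split; last by move=> t t0 tT; exact: hXc.
have inT t : t \in `[0, T] -> 0 <= t /\ t <= T by rewrite in_itv => /andP.
have sXc t : t \in `[0, T] -> sqi mu (Xc t) by move=> /inT[t0 tT]; have [] := hXc t t0 tT.
have hs := @sqip_semi_inner _ _ R mu.
have near_Xc k t (ti : t \in `[0, T]) :
    ipnorm (@sqip _ _ _ mu) (sqfun_elt (hs0_sqi (X k t)) - sqfun_elt (sXc t ti)) <= 4^-1 ^+ k.
  rewrite ipnorm_le ?exprn_ge0// exprAC (_ : 4^-1 ^+ 2 = 16^-1); last by field.
  by have [t0 tT] := inT t ti; have [_] := hXc t t0 tT; apply.
have dist_X k t x : ipnorm (@sqip _ _ _ mu) (sqfun_elt (hs0_sqi (X k x)) - sqfun_elt (hs0_sqi (X k t)))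
    = ipnorm aH (X k x - X k t) by rewrite /ipnorm pivotE.
split; first split.
- by move=> t ti; apply/L2P; apply: sqi_patch => //; exact: (sXc t ti).
- move=> t ti; apply/cvgrPdist_le => e e0.
  have [k hk] : exists k, 4^-1 ^+ k <= e / 3.
    have : 4^-1 ^+ k @[k --> \oo] --> (0 : R) by apply: cvg_expr; rewrite ger0_norm; lra.
    move=> /cvgrPdist_le/(_ (e / 3)) []; first by rewrite divr_gt0.
    by move=> k _ /(_ k (leqnn k)); rewrite /= sub0r normrN ger0_norm ?exprn_ge0//; exists k.
  have cX : (fun x => aH (X k x - X k t) (X k x - X k t)) x @[x --> t] --> (0 : R).
    rewrite (_ : (fun x => _) = fun x => aH (X k x) (X k x) - 2 * aH (X k x) (X k t) + aH (X k t) (X k t)).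
      rewrite (_ : 0 = aH (X k t) (X k t) - 2 * aH (X k t) (X k t) + aH (X k t) (X k t)); last by ring.
      apply: cvgD; last exact: cvg_cst.
      apply: cvgB; last by apply: cvgMr; exact: continuous_X.
      by apply: (@continuous_comp_tau (fun x => aH (expsum (m k) (v k) x) (expsum (m k) (v k) x)));
        exact: (@continuous_ip_expsum _ _ aH (m k) (v k) (v k) hh).
    by apply/funext => x; exact: sip_sub_sq.
  have near_t : \forall x \near t, ipnorm aH (X k x - X k t) <= e / 3.
    move/cvgrPdist_le : cX => /(_ ((e / 3) ^+ 2)).
    move=> /(_ (exprn_gt0 _ (divr_gt0 e0 (ltr0n _ 3)))); apply: filterS => x.
    by rewrite sub0r normrN ger0_norm ?(sip_ge0 hh)// ipnorm_le// divr_ge0// ltW.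
  near=> x.
  have xi : x \in `[0, T] by near: x; exact: withinT.
  rewrite sub0r normrN ger0_norm; last by rewrite fine_ge0// Lnorm_ge0.
  apply: le_trans (L2norm_le mO (sqiB (sXc x xi) (sXc t ti))) _.
  change (ipnorm (@sqip _ _ _ mu) (sqfun_elt (sXc x xi) - sqfun_elt (sXc t ti)) <= e).
  rewrite (_ : sqfun_elt (sXc x xi) - sqfun_elt (sXc t ti) =
    (sqfun_elt (sXc x xi) - sqfun_elt (hs0_sqi (X k x))) +
    ((sqfun_elt (hs0_sqi (X k x)) - sqfun_elt (hs0_sqi (X k t))) +
     (sqfun_elt (hs0_sqi (X k t)) - sqfun_elt (sXc t ti)))); last first.
    by rewrite addrA [X in _ = X + _]addrA subrK addrA subrK.
  apply: le_trans (ipnormD hs _ _) _.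
  rewrite [leRHS](_ : e = e / 3 + (e / 3 + e / 3)); last by field.
  apply: lerD; first by rewrite ipnormB//; exact: le_trans (near_Xc k x xi) hk.
  apply: le_trans (ipnormD hs _ _) _; apply: lerD; last exact: le_trans (near_Xc k t ti) hk.
  by rewrite dist_X; near: x; apply: cvg_within; exact: near_t.
have mh k : measurable_fun I (fun t => ipnorm aV (Xs k t - Xinf t)).
  apply: measurable_funTS; apply: (smeas_ipnorm_measurable ha).
  exact: l2time_smeas (Xs k - Xinf).
have ih k : (\int[lambda]_(t in I) (ipnorm aV (Xs k t - Xinf t) ^+ 2)%:E <= (4 * 16^-1 ^+ k)%:E)%E.
  apply: (@le_trans _ _ (sqint aV I (Xs k - Xinf))).
    rewrite le_eqVlt; apply/orP; left; apply/eqP.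
    by apply: eq_integral => t _; rewrite (sqr_ipnorm ha).
  by rewrite sqint_tip lee_fin.
have [N [mN N0 hN]] := @ae_geometric _ _ R lambda I mI
  (fun k t => ipnorm aV (Xs k t - Xinf t)) 4 (ltW (ltr0n _ 4)) mh ih.
exists N; split=> // t /=; apply: contra_notP => Nt ti.
have [S hS] := hN t ti Nt.
have tc : t \in `[0, T] by move: ti; rewrite !in_itv/= => /andP[/ltW -> /ltW ->].
have e0 : ipnorm (@sqip _ _ _ mu) (sqfun_elt (sXc t tc) - sqfun_elt (hs0_sqi (Xinf t))) = 0.
  apply: (@le_geometric_eq0 _ _ (1 + Num.sqrt Cp * S)) => k.
  rewrite ger0_norm ?ipnorm_ge0//.
  rewrite (_ : sqfun_elt (sXc t tc) - sqfun_elt (hs0_sqi (Xinf t)) =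
    (sqfun_elt (sXc t tc) - sqfun_elt (hs0_sqi (X k t))) +
    (sqfun_elt (hs0_sqi (X k t)) - sqfun_elt (hs0_sqi (Xinf t)))); last by rewrite addrA subrK.
  apply: le_trans (ipnormD hs _ _) _; rewrite mulrDl mul1r; apply: lerD.
    rewrite ipnormB//; apply: le_trans (near_Xc k t tc) _.
    by apply: lerXn2r; rewrite ?nnegrE//; lra.
  apply: (@le_trans _ _ (ipnorm aH (Xs k t - Xinf t))); first by rewrite /ipnorm pivotE.
  apply: le_trans (ipnorm_dom Cp0 hCp _) _; rewrite -mulrA ler_wpM2l ?sqrtr_ge0//.
  by apply: le_trans (hS k); exact: ler_norm.
have sD := sqiB (sXc t tc) (hs0_sqi (Xinf t)).
have l0 : l2ip mu (fun x => Xc t x - Xinf t x) (fun x => Xc t x - Xinf t x) = 0.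
  by have := sqr_ipnorm hs (sqfun_elt (sXc t tc) - sqfun_elt (hs0_sqi (Xinf t)));
    rewrite e0 expr0n/= => h; exact: (esym h).
apply: (ae_mono (l2ip_eq0 sD l0)) => x /eqP; rewrite subr_eq0 => /eqP xe _; exact: xe.
Unshelve. all: end_near.
Qed.

End time_limit.

(** * Continuous functions of time with values in the pivot space *)
Section clamp.
Context {R : realType} (T : R) (T0 : 0 < T).
Local Notation lambda := (@lebesgue_measure R).

(** Composition with this projection of the line onto [`[0, T]] extends functions of
time that are continuous on the interval to continuous functions on the line. *)
Definition clamp (t : R) : R := (`|t| - `|t - T| + T) / 2.

Lemma clamp_in (t : R) : clamp t \in `[0, T].
Proof.
have T1 := T0.
have h1 : 0 <= clamp t.
  by rewrite /clamp; case: (ger0P t) => k1; case: (ger0P (t - T)) => k2; lra.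
have h2 : clamp t <= T.
  by rewrite /clamp; case: (ger0P t) => k1; case: (ger0P (t - T)) => k2; lra.
by rewrite in_itv/= h1.
Qed.

Lemma clampK t : t \in `[0, T] -> clamp t = t.
Proof.
rewrite in_itv/= => /andP[t0 tT]; rewrite /clamp ger0_norm// ler0_norm ?subr_le0//; by field.
Qed.

Lemma continuous_clamp : continuous clamp.
Proof.
move=> t; apply: cvgMl; apply: cvgD; last exact: cvg_cst.
apply: cvgB; first exact: norm_continuous.
by apply: (@cvg_norm _ _ _ _ _ (fun x : R => x - T)); apply: cvgB; [exact: cvg_id|exact: cvg_cst].
Qed.

(** A null set contains no interval with endpoint [0]. *)
Lemma continuous_ae_le0 (K : R -> R) : continuous K ->
  {ae lambda, forall t, t \in `]0, T[ -> K t <= 0} -> K 0 <= 0.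
Proof.
move=> cK [N [mN N0 hN]]; rewrite leNgt; apply/negP => K0.
have /cvgrPdist_lt/(_ (K 0) K0)/nbhs_ballP[e /= e0 he] := cK 0.
have sub : `]0, Num.min e T[%classic `<=` N.
  move=> t /=; rewrite in_itv/= lt_min => /and3P[t0 te tT]; apply: hN => /= h.
  have := h; rewrite in_itv/= t0 tT => /(_ isT) Kt.
  have := he t; rewrite /ball/= sub0r normrN ger0_norm ?(ltW t0)// => /(_ te).
  by rewrite ltNge => /negP; apply; apply: le_trans (ler_norm _); lra.
have m0 : 0 < Num.min e T by rewrite lt_min e0.
have : (lambda `]0%R, Num.min e T[%classic <= lambda N)%E.
  by apply: le_measure => //; rewrite inE.
rewrite N0 lebesgue_measure_itv/= lte_fin m0 -EFinB subr0.
by rewrite lee_fin leNgt m0.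
Qed.

End clamp.

Section continuous_time.
Context {R : realType} (d : nat) (Omega : set 'rV[R]_d) (T : R) (T0 : 0 < T).
Local Notation E := 'rV[R]_d.
Local Notation mu := (lebesgue_rV d).
Local Notation lambda := (@lebesgue_measure R).
Implicit Types u v w : E -> R.

Lemma L2norm_ge0 u : 0 <= L2norm Omega u.
Proof. by rewrite fine_ge0// Lnorm_ge0. Qed.

Lemma L2norm_ip u (hu : L2 Omega u) :
  L2norm Omega u = ipnorm (@sqip _ _ _ mu) (sqfun_elt ((L2P Omega u).1 hu)).
Proof.
have -> : L2norm Omega u = Num.sqrt (L2norm Omega u ^+ 2).
  by rewrite sqrtr_sqr ger0_norm// L2norm_ge0.
by rewrite sqr_L2norm L2prodE.
Qed.

Lemma normr_L2prod_le u v : L2 Omega u -> L2 Omega v ->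
  `|L2prod Omega u v| <= L2norm Omega u * L2norm Omega v.
Proof.
move=> hu hv; rewrite L2prodE !L2norm_ip//.
exact: normr_sip_le (@sqip_semi_inner _ _ R mu) (sqfun_elt _) (sqfun_elt _).
Qed.

Lemma patchB u v : (fun x => u x - v x) \_ Omega = (fun x => (u \_ Omega) x - (v \_ Omega) x).
Proof. by apply/funext => x; rewrite /patch; case: ifP; rewrite ?subr0. Qed.

Lemma L2B u v : L2 Omega u -> L2 Omega v -> L2 Omega (fun x => u x - v x).
Proof. by move=> /L2P hu /L2P hv; apply/L2P; rewrite patchB; exact: sqiB. Qed.

Lemma L2prodBl u v w : L2 Omega u -> L2 Omega v -> L2 Omega w ->
  L2prod Omega (fun x => u x - v x) w = L2prod Omega u w - L2prod Omega v w.
Proof.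
move=> /L2P hu /L2P hv /L2P hw; rewrite !L2prodE patchB.
exact: sipBl (@sqip_semi_inner _ _ R mu) (sqfun_elt hu) (sqfun_elt hv) (sqfun_elt hw).
Qed.

Lemma L2prodC u v : L2prod Omega u v = L2prod Omega v u.
Proof. by rewrite !L2prodE l2ipC. Qed.

Lemma ae_L2prod u u' w : {ae mu, forall x, Omega x -> u x = u' x} ->
  L2prod Omega u w = L2prod Omega u' w.
Proof. by move=> h; apply: eq_Rintegral_ae; apply: (ae_mono h) => x hx Ox; rewrite hx. Qed.

Lemma ae_L2norm u u' : {ae mu, forall x, Omega x -> u x = u' x} ->
  L2norm Omega u = L2norm Omega u'.
Proof.
move=> h.
have e x : L2norm Omega x = Num.sqrt (L2norm Omega x ^+ 2).
  by rewrite sqrtr_sqr ger0_norm// L2norm_ge0.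
by rewrite e [RHS]e !sqr_L2norm (ae_L2prod _ h) L2prodC (ae_L2prod _ h).
Qed.

Lemma L2norm_dist u v : L2 Omega u -> L2 Omega v ->
  `|L2norm Omega u - L2norm Omega v| <= L2norm Omega (fun x => u x - v x).
Proof.
move=> hu hv; have hs := @sqip_semi_inner _ _ R mu.
rewrite (L2norm_ip hu) (L2norm_ip hv); apply: le_trans (ipnorm_dist hs _ _) _.
rewrite (L2norm_ip (L2B hu hv)) le_eqVlt; apply/orP; left; apply/eqP.
congr Num.sqrt; rewrite /sqip /=.
by congr l2ip; apply/funext => x; rewrite patchB.
Qed.

Lemma CL2_dist_continuous (z : R -> E -> R) (K : R -> R) (c : R) : CL2 Omega T z ->
  (forall t x, `|K (clamp T t) - K (clamp T x)| <= c * L2norm Omega (z (clamp T x) - z (clamp T t))) ->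
  continuous (fun t => K (clamp T t)).
Proof.
move=> [hz cz] hK t.
have ct := cz _ (clamp_in T0 t).
have hc : clamp T x @[x --> t] --> within `[0, T] (nbhs (clamp T t)).
  move=> A /= hA.
  have h : \forall x \near t, `[0, T]%classic (clamp T x) -> A (clamp T x).
    exact: (@continuous_clamp R T t _ hA).
  change (\forall x \near t, A (clamp T x)).
  by apply: filterS h => x; apply; exact: (clamp_in T0).
have h := cvg_comp _ _ hc ct.
apply/cvgrPdist_le => e e0.
have c1 : 0 < `|c| + 1 by rewrite ltr_wpDl.
move/cvgrPdist_le : h => /(_ (e / (`|c| + 1)) (divr_gt0 e0 c1)).
apply: filterS => x /=; rewrite sub0r normrN ger0_norm ?L2norm_ge0// => h.
apply: le_trans (hK t x) _; apply: (@le_trans _ _ ((`|c| + 1) * (e / (`|c| + 1)))).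
  apply: (@le_trans _ _ ((`|c| + 1) * L2norm Omega (z (clamp T x) - z (clamp T t)))).
    by rewrite ler_wpM2r ?L2norm_ge0//; have := ler_norm c; lra.
  by rewrite ler_wpM2l// ltW.
by rewrite mulrC divfK// gt_eqF.
Qed.

Lemma L2prod_continuous (z : R -> E -> R) v : CL2 Omega T z -> L2 Omega v ->
  continuous (fun t => L2prod Omega (z (clamp T t)) v).
Proof.
move=> cz hv; have [hz _] := cz.
apply: (@CL2_dist_continuous z (fun t => L2prod Omega (z t) v) (L2norm Omega v)) => // t x.
have h1 := hz _ (clamp_in T0 t); have h2 := hz _ (clamp_in T0 x).
rewrite distrC -L2prodBl// mulrC; apply: normr_L2prod_le => //; exact: L2B.
Qed.

Lemma L2norm_continuous (z : R -> E -> R) : CL2 Omega T z ->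
  continuous (fun t => L2norm Omega (z (clamp T t))).
Proof.
move=> cz; have [hz _] := cz.
apply: (@CL2_dist_continuous z (fun t => L2norm Omega (z t)) 1) => // t x.
by rewrite mul1r distrC; apply: L2norm_dist; exact/hz/clamp_in.
Qed.

(** Both sides are continuous functions of time for the continuous representative. *)
Lemma initial_le (z zc : R -> E -> R) v (c : R) : continuous_rep Omega T z zc -> L2 Omega v ->
  {ae lambda, forall t, t \in `]0, T[ -> `|L2prod Omega (z t) v| <= c * L2norm Omega (z t)} ->
  `|L2prod Omega (zc 0) v| <= c * L2norm Omega (zc 0).
Proof.
move=> [cz az] hv hae; rewrite -subr_le0.
have c0 : clamp T 0 = 0 by apply: clampK; rewrite in_itv/= lexx ltW.
rewrite -{1 2}c0.
pose K t := `|L2prod Omega (zc (clamp T t)) v| - c * L2norm Omega (zc (clamp T t)).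
rewrite -[X in X <= 0]/(K 0); apply: (continuous_ae_le0 T0).
  move=> t; apply: cvgB; first by apply: cvg_norm; exact: L2prod_continuous.
  by apply: cvgMr; exact: L2norm_continuous.
apply: (ae_mono (ae_and az hae)) => t [h1 h2] ti.
rewrite /K clampK; last by move: ti; rewrite !in_itv/= => /andP[/ltW -> /ltW].
by rewrite (ae_L2prod _ (h1 ti)) (ae_L2norm (h1 ti)) subr_le0 h2.
Qed.

End continuous_time.

(** * The weak formulation *)
Section weak_form.
Context {R : realType} (d : nat) (Omega : set 'rV[R]_d) (s T : R).
Local Notation E := 'rV[R]_d.
Local Notation mu := (lebesgue_rV d).
Local Notation lambda := (@lebesgue_measure R).
Local Notation V := (hs0 Omega s).
Local Notation aV := (@gagliardo R d Omega s).
Local Notation aH := (@pivot R d Omega s).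
Local Notation I := (`]0, T[%classic : set R).
Hypotheses (mO : measurable Omega) (ha : semi_inner aV) (ca : ip_complete aV).
Variables (Cp : R) (Cp0 : 0 <= Cp) (hCp : forall u : V, aH u u <= Cp * aV u u).
Hypotheses (T0 : 0 < T) (mI : measurable I).
Local Notation L2V := (l2time ha mI).
Let hh : semi_inner aH := pivot_semi_inner Omega s.
Let bh u v : `|aH u v| <= Cp * ipnorm aV u * ipnorm aV v.
Proof. exact: normr_hle. Qed.
Let tV : semi_inner (@tip _ _ _ _ ha mI aV) := tip_self ha mI.
Let tH : semi_inner (@tip _ _ _ _ ha mI aH) := tip_semi_inner ha mI hh bh.

Lemma hs0_L2 (v : V) : L2 Omega v.
Proof. by apply/L2P; apply: sqi_patch => //; exact: hs0_sqi. Qed.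

Section one_test.
Variables (phi : R -> E -> R) (phit : R -> (E -> R) -> R) (phic : R -> E -> R) (Phi Psi : L2V).
Hypotheses (hphi : HQ Omega s T phi phit phic)
  (aePhi : {ae lambda, forall t, I t -> Phi t = phi t :> (E -> R)})
  (aePsi : {ae lambda, forall t, I t -> forall w : V, phit t w = aV (Psi t) w}).

(** A scalar integration by parts, of [expR (k * t)] against the pairing of the test
function with the fixed element [v]; its weak derivative is [aV (Psi t) v]. *)
Lemma weak_form_exp (k : R) (v r : V) : resolves aV aH k v r ->
  \int[lambda]_(t in I) (expR (k * t) * aV (Psi t) v) =
  - L2prod Omega (phic 0) v -
  (\int[lambda]_(t in I) (expR (k * t) * aV (Phi t) r) -
   \int[lambda]_(t in I) (expR (k * t) * aV (Phi t) v)).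
Proof.
move=> hvr.
have [[_ _ dphi] [cphi aec] phiT] := hphi.
have ce : continuous (fun t : R => expR (k * t)).
  by move=> t; exact: is_derive_continuous (is_derive_expRM k t).
have iexp w : lambda.-integrable I (EFin \o (fun t => expR (k * t) * aV (Phi t) w)).
  have := tip_integrable ha (normr_sip_le1 ha) Phi (ctime ha mI ce w).
  by apply: eq_integrable => // t _ /=; rewrite (sipZr ha).
have c1 : continuous (fun _ : R => 1 : R) by move=> t; exact: cvg_cst.
have iw : lambda.-integrable I (EFin \o (fun t => aV (Psi t) v)).
  have := tip_integrable ha (normr_sip_le1 ha) Psi (ctime ha mI c1 v).
  by apply: eq_integrable => // t _ /=; rewrite (sipZr ha) mul1r.
have clampI t : I t -> clamp T t = t.
  by move=> /=; rewrite in_itv/= => /andP[t0 tT]; apply: clampK; rewrite in_itv/= !ltW.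
have hL := hs0_L2 v.
have aeh : {ae lambda, forall t, I t -> L2prod Omega (phi t) v = L2prod Omega (phic (clamp T t)) v}.
  by apply: (ae_mono aec) => t ht It; rewrite clampI// (ae_L2prod _ (ht It)).
have wd theta : test_fun T theta -> \int[lambda]_(t in I) (derive1 theta t * L2prod Omega (phi t) v) =
    - \int[lambda]_(t in I) (theta t * aV (Psi t) v).
  move=> ht; rewrite (dphi theta ht v (hs0P v)); congr (- _).
  by apply: eq_Rintegral_ae; apply: (ae_mono aePsi) => t h It; rewrite h.
have := weak_integration_by_parts T0 (L2prod_continuous T0 cphi hL) iw aeh wd
  (smooth_exp k) (is_derive_expRM k) (fun t => cvgMr (ce t)).
move=> ->.
have -> : clamp T T = T by apply: clampK; rewrite in_itv/= lexx ltW.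
have -> : clamp T 0 = 0 by apply: clampK; rewrite in_itv/= lexx ltW.
have -> : L2prod Omega (phic T) v = 0.
  rewrite (ae_L2prod (u' := fun=> 0) _ phiT) L2prodE.
  rewrite -[RHS](_ : l2ip mu (fun=> 0) (v \_ Omega) = 0); last first.
    by rewrite /l2ip /Rintegral integral0_eq// => x _; rewrite mul0r.
  by congr l2ip; apply/funext => x; rewrite /patch; case: ifP.
rewrite !mulr0 !(mulr0, expR0, mul1r) sub0r; congr (_ - _).
rewrite -RintegralB//.
apply: eq_Rintegral_ae; apply: (ae_mono (ae_and aeh aePhi)) => t [h1 h2] It.
rewrite -h1// -h2// -[L2prod _ _ _]/(aH (Phi t) v) (sip_sym ha _ r) hvr.
by rewrite (sip_sym hh v) (sip_sym ha v); ring.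
Qed.

Lemma expsum_eltE n (u : nat -> V) (ce : forall k : nat, continuous (fun t : R => expR (k.+1%:R * t)))
    (X : L2V) : (X = expsum n u :> (R -> V)) ->
  X = \sum_(k < n) ctime ha mI (ce k) (u k).
Proof.
move=> XE; apply: val_inj => /=; rewrite XE; apply/funext => t.
by rewrite [RHS](big_morph (fun Z : L2V => (Z : R -> V) t) (fun _ _ => erefl) erefl).
Qed.

Lemma weak_form_expsum n (v r : nat -> V) (X Y : L2V) :
  (forall k, resolves aV aH k.+1%:R (v k) (r k)) ->
  X = expsum n v :> (R -> V) -> Y = expsum n r :> (R -> V) ->
  - tip aV Psi X + tip aV X Phi = tip aV Y Phi + L2prod Omega (phic 0) (expsum n v 0).
Proof.
move=> hvr XE YE.
have ce k : continuous (fun t : R => expR (k.+1%:R * t)).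
  by move=> t; exact: is_derive_continuous (is_derive_expRM _ t).
rewrite (expsum_eltE ce XE) (expsum_eltE ce YE).
rewrite (sip_sumr tV) !(sip_suml tV).
have hc : L2 Omega (phic 0).
  have [_ [[h _] _] _] := hphi; apply: h; by rewrite in_itv/= lexx ltW.
have -> : L2prod Omega (phic 0) (expsum n v 0) = \sum_(k < n) L2prod Omega (phic 0) (v k).
  rewrite expsum_at0.
  have hq := (L2P Omega (phic 0)).1 hc.
  have L2prodV (w : V) : L2prod Omega (phic 0) w = l2ip mu w (phic 0 \_ Omega).
    by rewrite L2prodC L2prodE; apply: eq_l2ip; [exact: hs0_patch|
      exists set0; split=> // x /=; apply: contra_notP].
  have D : {morph (fun w : V => L2prod Omega (phic 0) w) : u w / u + w >-> u + w}.
    move=> u w; rewrite !L2prodV.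
    have := @l2ip_linear _ _ R mu 1 u w _ (hs0_sqi u) (hs0_sqi w) hq; rewrite mul1r => <-.
    by congr l2ip; apply/funext => x; rewrite mul1r.
  apply: (big_morph (fun w : V => L2prod Omega (phic 0) w) D).
  by have /eqP := D 0 0; rewrite addr0 -subr_eq0 opprD addrA subrr sub0r oppr_eq0 => /eqP.
rewrite -sumrN -!big_split/=; apply: eq_bigr => k _.
have := weak_form_exp (hvr k).
have e (w : V) (Z : L2V) := tip_ctime (ce k) w Z ha.
rewrite -!e => ->.
rewrite (sip_sym tV (ctime ha mI (ce k) (v k))) (sip_sym tV (ctime ha mI (ce k) (r k))).
move: (tip aV Phi _) (tip aV Phi _) (L2prod _ _ _) => x y z; ring.
Qed.

(** All the terms are continuous for the energy norm of functions of time, except the initial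
value, whose convergence is a hypothesis. *)
Lemma weak_form_limit (n : nat -> nat) (v r : nat -> nat -> V) (Xs Ys : nat -> L2V)
    (X Y : L2V) (rho0 : E -> R) :
  (forall k j, resolves aV aH j.+1%:R (v k j) (r k j)) ->
  (forall k, Xs k = expsum (n k) (v k) :> (R -> V)) ->
  (forall k, Ys k = expsum (n k) (r k) :> (R -> V)) ->
  ipnorm (tip aV) (Xs k - X) @[k --> \oo] --> (0 : R) ->
  ipnorm (tip aV) (Ys k - Y) @[k --> \oo] --> (0 : R) ->
  L2prod Omega (phic 0) (expsum (n k) (v k) 0) @[k --> \oo] --> L2prod Omega (phic 0) rho0 ->
  - tip aV Psi X + tip aV X Phi = tip aV Y Phi + L2prod Omega (phic 0) rho0.
Proof.
move=> hvr XE YE cX cY c0.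
have l : - tip aV Psi (Xs k) + tip aV (Xs k) Phi @[k --> \oo] --> - tip aV Psi X + tip aV X Phi.
  have c1 := @sip_cvgr _ _ _ tV _ _ Psi cX; have c2 := @sip_cvgl _ _ _ tV _ _ Phi cX.
  by apply: cvgD; [apply: cvgN; exact: c1|exact: c2].
have r' : tip aV (Ys k) Phi + L2prod Omega (phic 0) (expsum (n k) (v k) 0) @[k --> \oo] -->
    tip aV Y Phi + L2prod Omega (phic 0) rho0.
  have c1 := @sip_cvgl _ _ _ tV _ _ Phi cY.
  by apply: cvgD; [exact: c1|exact: c0].
move: r'; rewrite -(_ : (fun k => - tip aV Psi (Xs k) + tip aV (Xs k) Phi) = fun k =>
  tip aV (Ys k) Phi + L2prod Omega (phic 0) (expsum (n k) (v k) 0)).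
  by move: l; exact: cvg_unique.
by apply/funext => k; exact: (weak_form_expsum (hvr k) (XE k) (YE k)).
Qed.

End one_test.
End weak_form.

(** * The evolution problem forwards and backwards in time *)
Section evolution.
Context {R : realType} (d : nat) (Omega : set 'rV[R]_d) (s T : R).
Local Notation E := 'rV[R]_d.
Local Notation mu := (lebesgue_rV d).
Local Notation lambda := (@lebesgue_measure R).
Local Notation V := (hs0 Omega s).
Local Notation aV := (@gagliardo R d Omega s).
Local Notation aH := (@pivot R d Omega s).
Local Notation I := (`]0, T[%classic : set R).
Hypotheses (mO : measurable Omega) (ha : semi_inner aV) (ca : ip_complete aV).
Variables (Cp : R) (Cp0 : 0 <= Cp) (hCp : forall u : V, aH u u <= Cp * aV u u).
Hypotheses (T0 : 0 < T) (mI : measurable I).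
Local Notation L2V := (l2time ha mI).
Let hh : semi_inner aH := pivot_semi_inner Omega s.
Let tV : semi_inner (@tip _ _ _ _ ha mI aV) := tip_self ha mI.

Section direction.
Variables (sigma c : R) (tauE : (sigma = 1 /\ c = 0) \/ (sigma = - 1 /\ c = T)).

Let tauK (t : R) : sigma * (sigma * t + c) + c = t.
Proof. by case: tauE => -[-> ->]; ring. Qed.

Let tau_in (t : R) : 0 <= t -> t <= T -> 0 <= sigma * t + c /\ sigma * t + c <= T.
Proof. by move=> t0 tT; case: tauE => -[-> ->]; split; lra. Qed.

Let sqint_tau (W : R -> V) : smeas aV W ->
  sqint aV I (fun t => W (sigma * t + c)) = sqint aV I W.
Proof.
move=> sW; case: tauE => -[-> ->].
  by congr sqint; apply/funext => t; rewrite mul1r addr0.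
rewrite /sqint -[RHS](@ge0_integral_reflect R T (fun t => aV (W t) (W t))).
- by apply: eq_integral => t _; rewrite mulN1r addrC.
- exact: smeas_ip_measurable.
- by move=> t; exact: sip_ge0.
Qed.

(** Forwards ([sigma = 1]) and backwards ([sigma = -1]) in time at once, with
[tau t = sigma * t + c] an involution of [0, T].  The approximations are kept in the
conclusion because bounds and weak formulation are proved for them first. *)
Lemma evolution (p : nat -> V) (F : L2V) :
  (forall k i, (k <= i)%N -> aH (p i - p k) (p i - p k) <= 16^-1 ^+ k.+1) ->
  exists m (v r : nat -> nat -> V) (Xs Ys : nat -> L2V) (X : L2V) (Xc : R -> E -> R),
  [/\ (forall k j, resolves aV aH j.+1%:R (v k j) (r k j)) /\
      (forall k, aH (expsum (m k) (v k) 0 - p k) (expsum (m k) (v k) 0 - p k) <= 16^-1 ^+ k),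
      (forall k, Xs k = (fun t => expsum (m k) (v k) (sigma * t + c)) :> (R -> V)) /\
      (forall k, Ys k = (fun t => expsum (m k) (r k) (sigma * t + c)) :> (R -> V)),
      (ipnorm (tip aV) (Xs k - X) @[k --> \oo] --> (0 : R)) /\
      (ipnorm (tip aV) (Ys k - F) @[k --> \oo] --> (0 : R)),
      is_time_derivative Omega s T (fun t => X t : E -> R)
        (fun t => riesz_functional (sigma *: (F - X) t)) &
      continuous_rep Omega T (fun t => X t : E -> R) Xc /\
      forall t, 0 <= t -> t <= T -> sqi mu (Xc t) /\
        forall k, l2ip mu (fun x => expsum (m k) (v k) (sigma * t + c) x - Xc t x)
          (fun x => expsum (m k) (v k) (sigma * t + c) x - Xc t x) <= 16^-1 ^+ k].
Proof.
move=> hp.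
have sF := smeas_affine sigma c (l2time_smeas F).
have fF : (sqint aV I (fun t => F (sigma * t + c)%R) < +oo)%E.
  by rewrite sqint_tau; [exact: l2time_lty|exact: l2time_smeas].
have [m [v [r [hvr h0 hY hXc hX]]]] := cauchy_approximations ha hh ca Cp0 hCp T0 hp sF fF.
have sq k u : smeas aV (expsum k u) by exact: smeas_expsum.
have Xcauchy k i t : (k <= i)%N -> 0 <= t -> t <= T ->
    aH (expsum (m i) (v i) (sigma * t + c) - expsum (m k) (v k) (sigma * t + c))
       (expsum (m i) (v i) (sigma * t + c) - expsum (m k) (v k) (sigma * t + c)) <= 16^-1 ^+ k.
  by move=> ki t0 tT; have [h1 h2] := tau_in t0 tT; exact: hXc.
have Xsqint k i : (k <= i)%N -> (sqint aV I (fun t => (expsum (m i) (v i) (sigma * t + c) -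
    expsum (m k) (v k) (sigma * t + c))%R) <= (16^-1 ^+ k)%:E)%E.
  move=> ki; rewrite (sqint_tau (W := fun t => expsum (m i) (v i) t - expsum (m k) (v k) t)).
    exact: hX.
  exact: smeasB.
have Ycvg k : (sqint aV I (fun t => (expsum (m k) (r k) (sigma * t + c) - F t)%R) <= (16^-1 ^+ k)%:E)%E.
  pose W x := expsum (m k) (r k) x - F (sigma * x + c).
  have sW : smeas aV W by exact: smeasB.
  rewrite (_ : (fun t => _) = fun t => W (sigma * t + c)); first by rewrite (sqint_tau sW); exact: hY.
  by apply/funext => t; rewrite /W tauK.
have [X Xrate] := limit_exists ha ca mI Xsqint.
have Xcv := Xs_cvg Xrate.
have Ycv := Ys_cvg Ycvg.
have dX := limit_time_derivative Cp0 hCp T0 hvr Ycvg Xrate.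
have [Xc [cX hXc']] := limit_continuous_rep mO Cp0 hCp hvr Xcauchy Xrate.
by do 7 eexists; split; [|split|split; [exact: Xcv|exact: Ycv]|exact: dX|split; [exact: cX|exact: hXc']].
Qed.

End direction.
End evolution.

(** * Existence and estimates *)
Section existence.
Context {R : realType} (d : nat) (Omega : set 'rV[R]_d) (s T : R).
Local Notation E := 'rV[R]_d.
Local Notation mu := (lebesgue_rV d).
Local Notation lambda := (@lebesgue_measure R).
Local Notation V := (hs0 Omega s).
Local Notation aV := (@gagliardo R d Omega s).
Local Notation aH := (@pivot R d Omega s).
Local Notation I := (`]0, T[%classic : set R).
Hypotheses (mO : measurable Omega) (ha : semi_inner aV) (ca : ip_complete aV).
Variables (Cp : R) (Cp0 : 0 <= Cp) (hCp : forall u : V, aH u u <= Cp * aV u u).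
Hypotheses (T0 : 0 < T) (mI : measurable I).
Local Notation L2V := (l2time ha mI).
Let hh : semi_inner aH := pivot_semi_inner Omega s.
Let tV : semi_inner (@tip _ _ _ _ ha mI aV) := tip_self ha mI.

Lemma L2norm_hs0 (w : V) : L2norm Omega w = ipnorm aH w.
Proof.
have -> : L2norm Omega w = Num.sqrt (L2norm Omega w ^+ 2).
  by rewrite sqrtr_sqr ger0_norm// L2norm_ge0.
by rewrite sqr_L2norm.
Qed.

(** The initial value is replaced by almost Riesz representatives, for the pivot form, of
the functional that it defines on [V].  What is lost is orthogonal to [V], and is seen by
no test function; the norm increases by at most the error of representation. *)
Lemma initial_data (rho0 : E -> R) : L2 Omega rho0 -> exists p : nat -> V,
  [/\ forall k i, (k <= i)%N -> aH (p i - p k) (p i - p k) <= 16^-1 ^+ k.+1,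
      forall k (w : V), `|aH (p k) w - L2prod Omega rho0 w| <= 4^-1 ^+ k * ipnorm aH w &
      forall k, ipnorm aH (p k) <= L2norm Omega rho0 + 4^-1 ^+ k].
Proof.
move=> h0; have hL (w : V) := hs0_L2 mO w.
have linL x (u v : V) : L2prod Omega rho0 (x *: u + v : V) =
    x * L2prod Omega rho0 u + L2prod Omega rho0 v.
  rewrite !(L2prodC Omega rho0) !L2prodE -l2ip_linear; last 3 first.
  - exact/L2P.
  - exact/L2P.
  - exact/L2P.
  congr l2ip; apply/funext => y; rewrite /patch; case: ifP => // _.
  by rewrite mulr0 addr0.
have bdL (u : V) : `|L2prod Omega rho0 u| <= L2norm Omega rho0 * ipnorm aH u.
  by rewrite -L2norm_hs0; exact: normr_L2prod_le.
have e0 k : 0 < 4^-1 ^+ k.+1 / 2 :> R by rewrite divr_gt0// exprn_gt0.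
have [p hp] := choice (fun k => almost_riesz hh linL bdL (e0 k)).
have le4 k : 4^-1 ^+ k.+1 / 2 <= 4^-1 ^+ k :> R.
  have x0 : 0 <= 4^-1 ^+ k :> R by rewrite exprn_ge0.
  by rewrite exprS; move: (4^-1 ^+ k) x0 => x x0; lra.
have h4 k (w : V) : `|aH (p k) w - L2prod Omega rho0 w| <= 4^-1 ^+ k * ipnorm aH w.
  by apply: le_trans (hp k w) _; rewrite ler_wpM2r ?ipnorm_ge0.
have cancel x y : 0 <= x -> x ^+ 2 <= y * x -> 0 <= y -> x <= y :> R.
  move=> x0 xy y0; have [->//|xn] := eqVneq x 0.
  by move: xy; rewrite expr2 ler_pM2r// lt_neqAle eq_sym xn.
exists p; split => //.
- move=> k i ki.
  have mono : 4^-1 ^+ i.+1 <= 4^-1 ^+ k.+1 :> R by apply: ler_wiXn2l => //; lra.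
  have h : ipnorm aH (p i - p k) <= 4^-1 ^+ k.+1.
    apply: cancel; rewrite ?ipnorm_ge0 ?exprn_ge0// sqr_ipnorm//.
    rewrite {1}sipBl// (_ : aH (p i) _ - _ = (aH (p i) (p i - p k) - L2prod Omega rho0 (p i - p k)) -
      (aH (p k) (p i - p k) - L2prod Omega rho0 (p i - p k))); last by ring.
    apply: le_trans (ler_norm _) _; apply: le_trans (ler_normB _ _) _.
    apply: le_trans (lerD (hp i _) (hp k _)) _; rewrite -mulrDl ler_wpM2r ?ipnorm_ge0//.
    by lra.
  move: h; rewrite ipnorm_le ?exprn_ge0// exprAC (_ : 4^-1 ^+ 2 = 16^-1)//.
  by field.
- move=> k; apply: cancel; rewrite ?ipnorm_ge0// ?addr_ge0 ?L2norm_ge0 ?exprn_ge0//.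
  rewrite sqr_ipnorm// mulrDl -lerBlDl.
  have := h4 k (p k); have := bdL (p k); rewrite !ler_norml => /andP[_ b1] /andP[_ b2].
  by apply: le_trans b2; rewrite lerD2l lerN2.
Qed.

(** The convergence against elements of [V] is uniform on bounded sets of the pivot space.
The initial value of a test function need not belong to [V], but its values at almost all
times do, and [initial_le] transfers the bound to it. *)
Lemma initial_convergence (rho0 : E -> R) (p u0 : nat -> V) phi phit phic (Phi : L2V) :
  L2 Omega rho0 ->
  (forall k (w : V), `|aH (p k) w - L2prod Omega rho0 w| <= 4^-1 ^+ k * ipnorm aH w) ->
  (forall k, aH (u0 k - p k) (u0 k - p k) <= 16^-1 ^+ k) ->
  HQ Omega s T phi phit phic ->
  {ae lambda, forall t, I t -> Phi t = phi t :> (E -> R)} ->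
  L2prod Omega (phic 0) (u0 k) @[k --> \oo] --> L2prod Omega (phic 0) rho0.
Proof.
move=> h0 hp hu [_ cr _] aePhi.
have hc : L2 Omega (phic 0) by case: cr => [[h _] _]; apply: h; rewrite in_itv/= lexx ltW.
have hD k : L2 Omega (fun x => u0 k x - rho0 x) by apply: L2B => //; exact: hs0_L2.
apply: (@cvg_dist_le _ _ (fun k => 2 * 4^-1 ^+ k * L2norm Omega (phic 0))); last first.
  rewrite -[X in _ --> X](mul0r (L2norm Omega (phic 0))); apply: cvgMl.
  rewrite -[X in _ --> X](mulr0 (2 : R)); apply: cvgMr.
  by apply: cvg_expr; rewrite ger0_norm; lra.
move=> k; rewrite !(L2prodC Omega (phic 0)) -L2prodBl//; last exact: hs0_L2.
rewrite L2prodC; apply: (initial_le T0 cr (hD k)).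
apply: (ae_mono aePhi) => t h It; rewrite -(h It) L2norm_hs0 L2prodC.
have hL (w : V) := hs0_L2 mO w.
rewrite L2prodBl// (_ : L2prod Omega (u0 k) (Phi t) = aH (u0 k) (Phi t))//.
rewrite (_ : _ - _ = aH (u0 k - p k) (Phi t) + (aH (p k) (Phi t) - L2prod Omega rho0 (Phi t))); last first.
  by rewrite sipBl//; ring.
apply: le_trans (ler_normD _ _) _; rewrite -mulrA mulr_natl mulr2n; apply: lerD => //.
apply: le_trans (normr_sip_le hh _ _) _; rewrite ler_wpM2r ?ipnorm_ge0//.
rewrite ipnorm_le ?exprn_ge0// exprAC (_ : 4^-1 ^+ 2 = 16^-1)//.
by field.
Qed.

End existence.

Section solutions.
Context {R : realType} (d : nat) (Omega : set 'rV[R]_d) (s T : R).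
Local Notation E := 'rV[R]_d.
Local Notation mu := (lebesgue_rV d).
Local Notation lambda := (@lebesgue_measure R).
Local Notation V := (hs0 Omega s).
Local Notation aV := (@gagliardo R d Omega s).
Local Notation aH := (@pivot R d Omega s).
Local Notation I := (`]0, T[%classic : set R).
Hypotheses (mO : measurable Omega) (ha : semi_inner aV) (ca : ip_complete aV).
Variables (Cp : R) (Cp0 : 0 <= Cp) (hCp : forall u : V, aH u u <= Cp * aV u u).
Hypotheses (T0 : 0 < T) (mI : measurable I).
Local Notation L2V := (l2time ha mI).
Let hh : semi_inner aH := pivot_semi_inner Omega s.
Let bh u v : `|aH u v| <= Cp * ipnorm aV u * ipnorm aV v.
Proof. exact: normr_hle. Qed.
Let tV : semi_inner (@tip _ _ _ _ ha mI aV) := tip_self ha mI.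

Let geometric4 : 2 * 4^-1 ^+ k @[k --> \oo] --> (0 : R).
Proof.
rewrite -[X in _ --> X](mulr0 (2 : R)); apply: cvgMr.
by apply: cvg_expr; rewrite ger0_norm; lra.
Qed.

Lemma expsum_energy m v r (t : R) (Y : L2V) : (forall k, resolves aV aH k.+1%:R (v k) (r k)) ->
  Y = expsum m r :> (R -> V) -> 0 <= t -> t <= T ->
  aH (expsum m v t) (expsum m v t) <= aH (expsum m v 0) (expsum m v 0) + tip aV Y Y.
Proof.
move=> hvr YE t0 tT; have := energy_le ha hh m hvr t0.
have sG : smeas aV (expsum m r) by exact: smeas_expsum.
have h1 : (sqint aV `[0%R, t]%classic (expsum m r) <= (tip aV Y Y)%:E)%E.
  by rewrite -sqint_tip YE; exact: sqint_itv_le.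
move=> h; rewrite -lee_fin EFinD; apply: le_trans (le_trans _ h) _.
  by rewrite leeDl// sqint_ge0.
exact: leeD (lexx _) h1.
Qed.

Lemma expsum_energy_integral m v r (X Y : L2V) :
  (forall k, resolves aV aH k.+1%:R (v k) (r k)) ->
  X = expsum m v :> (R -> V) -> Y = expsum m r :> (R -> V) ->
  tip aV X X <= aH (expsum m v 0) (expsum m v 0) + tip aV Y Y.
Proof.
move=> hvr XE YE; have := energy_le ha hh m hvr (ltW T0).
have sU : smeas aV (expsum m v) by exact: smeas_expsum.
have sG : smeas aV (expsum m r) by exact: smeas_expsum.
have h1 : (sqint aV `[0%R, T]%classic (expsum m r) <= (tip aV Y Y)%:E)%E.
  by rewrite -sqint_tip YE; exact: sqint_itv_le.
have h2 : ((tip aV X X)%:E <= sqint aV `[0%R, T]%classic (expsum m v))%E.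
  by rewrite -sqint_tip XE; exact: sqint_oo_le.
move=> h; rewrite -lee_fin EFinD; apply: le_trans (le_trans _ h) _.
  by apply: (le_trans h2); rewrite leeDr// lee_fin sip_ge0.
exact: leeD (lexx _) h1.
Qed.

Lemma forward_solution (F : L2V) (rho0 : E -> R) : L2 Omega rho0 ->
  exists (X : L2V) (Xc : R -> E -> R),
  [/\ is_time_derivative Omega s T (fun t => X t : E -> R) (fun t => riesz_functional ((F - X) t)),
      continuous_rep Omega T (fun t => X t : E -> R) Xc,
      forall t, 0 <= t -> t <= T ->
        L2norm Omega (Xc t) ^+ 2 <= L2norm Omega rho0 ^+ 2 + tip aV F F,
      tip aV X X <= L2norm Omega rho0 ^+ 2 + tip aV F F &
      forall phi phit phic (Phi Psi : L2V), HQ Omega s T phi phit phic ->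
        {ae lambda, forall t, I t -> Phi t = phi t :> (E -> R)} ->
        {ae lambda, forall t, I t -> forall w : V, phit t w = aV (Psi t) w} ->
        - tip aV Psi X + tip aV X Phi = tip aV F Phi + L2prod Omega (phic 0) rho0].
Proof.
move=> h0; have [p [hp1 hp2 hp3]] := initial_data s mO h0.
have [m [v [r [Xs [Ys [X [Xc [[hvr hu0] [XE YE] [cX cY] dX [cr hXc]]]]]]]]] :=
  @evolution R d Omega s T mO ha ca Cp Cp0 hCp T0 mI 1 0 (or_introl (conj erefl erefl)) p F hp1.
have XE1 k : Xs k = expsum (m k) (v k) :> (R -> V).
  by rewrite XE; apply/funext => t; rewrite mul1r addr0.
have YE1 k : Ys k = expsum (m k) (r k) :> (R -> V).
  by rewrite YE; apply/funext => t; rewrite mul1r addr0.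
have u0le k : aH (expsum (m k) (v k) 0) (expsum (m k) (v k) 0) <=
    (L2norm Omega rho0 + 2 * 4^-1 ^+ k) ^+ 2.
  have x0 : 0 <= 4^-1 ^+ k :> R by rewrite exprn_ge0.
  rewrite -ipnorm_le ?addr_ge0 ?L2norm_ge0 ?mulr_ge0//.
  rewrite -[expsum _ _ 0](subrK (p k)); apply: le_trans (ipnormD hh _ _) _.
  have h1 : ipnorm aH (expsum (m k) (v k) 0 - p k) <= 4^-1 ^+ k.
    by rewrite ipnorm_le// exprAC (_ : 4^-1 ^+ 2 = 16^-1)//; field.
  by have := hp3 k; move: (ipnorm aH (p k)) (4^-1 ^+ k) x0 h1 => q x x0 h1 h2; lra.
have cbound : (L2norm Omega rho0 + 2 * 4^-1 ^+ k) ^+ 2 + tip aV (Ys k) (Ys k) @[k --> \oo] -->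
    L2norm Omega rho0 ^+ 2 + tip aV F F.
  have c1 := sip_cvg_sq tV cY; apply: cvgD; last exact: c1.
  apply: cvg_sqr; rewrite -[X in _ --> X]addr0.
  by apply: cvgD; [exact: cvg_cst|exact: geometric4].
exists X, Xc; split.
- move: dX; congr is_time_derivative; apply/funext => t; congr riesz_functional.
  by rewrite scale1r.
- exact: cr.
- move=> t t0 tT; have [sXt hXt] := hXc t t0 tT.
  apply: (@le_trans _ _ (l2ip mu (Xc t) (Xc t))).
    have := L2norm_le mO sXt; rewrite -ler_sqr ?nnegrE ?L2norm_ge0 ?sqrtr_ge0//.
    by rewrite sqr_sqrtr// l2ip_ge0.
  have hs := @sqip_semi_inner _ _ R mu.
  pose q k := sqfun_elt (hs0_sqi (expsum (m k) (v k) (1 * t + 0))).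
  have cq : ipnorm (@sqip _ _ _ mu) (q k - sqfun_elt sXt) @[k --> \oo] --> (0 : R).
    apply: (ipnorm_cvg0_geometric hs (c := 1)) => k; rewrite mul1r; exact: hXt.
  have cq2 := sip_cvg_sq hs cq.
  apply: (ler_cvg_to cq2 cbound); apply: nearW => k.
  rewrite /q /sqip -pivotE; apply: (@le_trans _ _ (aH (expsum (m k) (v k) 0) (expsum (m k) (v k) 0)
      + tip aV (Ys k) (Ys k))); last by rewrite lerD2r.
  by rewrite mul1r addr0; apply: (expsum_energy (hvr k) (YE1 k)).
- have c1 := sip_cvg_sq tV cX.
  apply: (ler_cvg_to c1 cbound); apply: nearW => k.
  apply: (@le_trans _ _ (aH (expsum (m k) (v k) 0) (expsum (m k) (v k) 0)
      + tip aV (Ys k) (Ys k))); last by rewrite lerD2r.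
  exact: (expsum_energy_integral (hvr k) (XE1 k) (YE1 k)).
- move=> phi phit phic Phi Psi hphi aePhi aePsi.
  apply: (weak_form_limit mO T0 hphi aePhi aePsi hvr XE1 YE1 cX cY).
  exact: (initial_convergence mO T0 h0 hp2 hu0 hphi aePhi).
Qed.

(** The Riesz representation for [aV] of the functionals [aH u]. *)
Lemma pivot_operator : exists K : V -> V, (forall u w, aV (K u) w = aH u w) /\
  forall u v, ipnorm aV (K u - K v) <= Cp * ipnorm aV (u - v).
Proof.
have ex u : exists v : V, forall w, aV v w = aH u w.
  have b1 (w : V) : `|aH u w| <= Cp * ipnorm aV u * ipnorm aV w by exact: bh.
  have l1 x (w1 w2 : V) : aH u (x *: w1 + w2) = x * aH u w1 + aH u w2.
    by rewrite sipDr// sipZr.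
  have d1 (w : V) : aV w w <= 1 * aV w w by rewrite mul1r.
  exact: (@riesz _ _ aV aV ha ca 1 (aH u) _ ler01 (fun w => lexx _) d1 l1 b1).
have [K hK] := choice ex; exists K; split => // u v.
have e : ipnorm aV (K u - K v) ^+ 2 <= Cp * ipnorm aV (u - v) * ipnorm aV (K u - K v).
  rewrite sqr_ipnorm// {1}sipBl// !hK -sipBl//.
  by apply: le_trans (ler_norm _) _; exact: bh.
have [->|n0] := eqVneq (ipnorm aV (K u - K v)) 0; first by rewrite mulr_ge0 ?ipnorm_ge0.
by move: e; rewrite expr2 ler_pM2r// lt_neqAle eq_sym n0 ipnorm_ge0.
Qed.

Lemma tip_pivot_operator (Z : L2V) : exists KZ : L2V, forall W : L2V, tip aV KZ W = tip aH Z W.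
Proof.
have [K [hK hKB]] := pivot_operator.
have [g sg cg] := l2time_smeas Z.
have sKZ : smeas aV (fun t => K (Z t)).
  exists (fun k => K \o g k) => [k|t]; first exact: simple_comp.
  apply: (@cvg_dist_le _ _ (fun k => Cp * ipnorm aV (g k t - Z t))).
    by move=> k; rewrite subr0 ger0_norm ?ipnorm_ge0//; exact: hKB.
  by rewrite -[X in _ --> X](mulr0 Cp); apply: cvgMr; exact: cg.
have K0 u : ipnorm aV (K u) <= Cp * ipnorm aV u.
  have e : ipnorm aV (K u) ^+ 2 <= Cp * ipnorm aV u * ipnorm aV (K u).
    by rewrite sqr_ipnorm// {1}hK; apply: le_trans (ler_norm _) _; exact: bh.
  have [->|n0] := eqVneq (ipnorm aV (K u)) 0; first by rewrite mulr_ge0 ?ipnorm_ge0.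
  by move: e; rewrite expr2 ler_pM2r// lt_neqAle eq_sym n0 ipnorm_ge0.
have fKZ : (sqint aV I (fun t => K (Z t)) < +oo)%E.
  apply: (@le_lt_trans _ _ (sqint aV I (Cp *: Z))); last exact: l2time_lty.
  apply: ge0_le_integral => //.
  - by move=> t _; rewrite lee_fin sip_ge0.
  - exact: (smeas_sq_measurable ha sKZ).
  - exact: (smeas_sq_measurable ha (l2time_smeas (Cp *: Z))).
  - move=> t _; rewrite lee_fin.
    have -> : (Cp *: Z : L2V) t = Cp *: Z t by [].
    rewrite -!(sqr_ipnorm ha) ler_sqr ?nnegrE ?ipnorm_ge0// ipnormZ// ger0_norm//.
by exists (l2time_elt ha mI sKZ fKZ) => W; apply: eq_Rintegral => t _; exact: hK.
Qed.

(** The evolution problem with source [F] and value zero at time [T], run backwards.  For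
the source [K z] this is the test function of the duality argument. *)
Lemma backward_solution (F : L2V) : exists (Phi : L2V) (phic : R -> E -> R),
  HQ Omega s T (fun t => Phi t : E -> R) (fun t => riesz_functional ((Phi - F) t)) phic.
Proof.
have hp1 k i : (k <= i)%N -> aH (0 - 0) (0 - 0) <= 16^-1 ^+ k.+1.
  by move=> _; rewrite subrr sip0l// exprn_ge0.
have [m [v [r [Xs [Ys [X [Xc [[hvr hu0] _ _ dX [cr hXc]]]]]]]]] :=
  @evolution R d Omega s T mO ha ca Cp Cp0 hCp T0 mI (-1) T (or_intror (conj erefl erefl)) (fun=> 0) F hp1.
exists X, Xc; split; [|exact: cr|].
  split.
  - by have [] := bochner_hs0_emb X.
  - by have [] := bochner_Hms_emb (X - F).
  - move: dX; congr is_time_derivative; apply/funext => t; congr riesz_functional.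
    by rewrite scaleN1r opprB.
have [sXT hXT] := hXc T (ltW T0) (lexx T).
have hs := @sqip_semi_inner _ _ R mu.
have e0 : ipnorm (@sqip _ _ _ mu) (sqfun_elt sXT) = 0.
  apply: (@le_geometric_eq0 _ _ 2) => k; rewrite ger0_norm ?ipnorm_ge0//.
  pose q := sqfun_elt (hs0_sqi (expsum (m k) (v k) (- 1 * T + T))).
  rewrite -[sqfun_elt sXT](subrK q); apply: le_trans (ipnormD hs _ _) _.
  have h1 : ipnorm (@sqip _ _ _ mu) (q - sqfun_elt sXT) <= 4^-1 ^+ k.
    rewrite ipnorm_le ?exprn_ge0// exprAC (_ : 4^-1 ^+ 2 = 16^-1); last by field.
    exact: hXT.
  have h2 : ipnorm (@sqip _ _ _ mu) q <= 4^-1 ^+ k.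
    rewrite ipnorm_le ?exprn_ge0// exprAC (_ : 4^-1 ^+ 2 = 16^-1); last by field.
    rewrite /q /sqip -pivotE mulN1r addNr.
    by have := hu0 k; rewrite subr0.
  have h3 : 4^-1 ^+ k <= 2^-1 ^+ k :> R by apply: lerXn2r; rewrite ?nnegrE//; lra.
  rewrite ipnormB//; move: (ipnorm _ _) (ipnorm _ _) h1 h2 => x y h1 h2; lra.
have l0 : l2ip mu (Xc T) (Xc T) = 0.
  by have := sqr_ipnorm hs (sqfun_elt sXT); rewrite e0 expr0n/= => h; exact: (esym h).
by apply: (ae_mono (l2ip_eq0 sXT l0)) => x h _.
Qed.

End solutions.

(** * Uniqueness and conclusion *)
Section tip_eq0.
Context {R : realType} (d : nat) (Omega : set 'rV[R]_d) (s : R) (I : set R).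
Local Notation V := (hs0 Omega s).
Local Notation aV := (@gagliardo R d Omega s).
Local Notation aH := (@pivot R d Omega s).
Local Notation lambda := (@lebesgue_measure R).
Variables (ha : semi_inner aV) (mI : measurable I).
Variables (Cp : R) (Cp0 : 0 <= Cp) (hCp : forall u : V, aH u u <= Cp * aV u u).
Let hh : semi_inner aH := pivot_semi_inner Omega s.

Lemma tip_pivot_eq0 (Z : l2time ha mI) : tip aH Z Z = 0 ->
  {ae lambda, forall t, I t -> aH (Z t) (Z t) = 0}.
Proof.
move=> Z0; have iZ := tip_integrable hh (normr_hle hh Cp0 hCp) Z Z.
have /integrableP[mZ fZ] := iZ.
have E : (\int[lambda]_(t in I) `|(aH (Z t) (Z t))%:E| = 0)%E.
  have := fZ; rewrite -[(\int[_]_(_ in _) _)%E]fineK; last first.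
    by rewrite ge0_fin_numE; [exact: fZ|exact: integral_ge0].
  move=> _; congr EFin; rewrite -[RHS]Z0 /tip /Rintegral; congr fine.
  by apply: eq_integral => t _; rewrite gee0_abs// lee_fin sip_ge0.
move/ae_eq_integral_abs : E => /(_ mI mZ) h.
by apply: (ae_mono h) => t ht It; have [] := ht It.
Qed.

End tip_eq0.

(** With [p] a test function, [p - k] its time derivative, and [x], [y] two weak solutions
for the same data [c], only the pairing of [k] with the difference survives. *)
Lemma dual_identity (R : realType) (V : lmodType R) (b : V -> V -> R) (hb : semi_inner b)
    (p k x y : V) (c : R) :
  - b (p - k) x + b x p = c -> - b (p - k) y + b y p = c -> b k (y - x) = 0.
Proof.
rewrite !(sipBl hb) !(sipBr hb) (sip_sym hb x p) (sip_sym hb y p); lra.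
Qed.

Theorem proposition3p5 (R : realType) (n : nat) (Omega : set 'rV[R]_n.+1)
    (s T : R)
    (Omega_neq0 : Omega !=set0) (Omega_open : open Omega)
    (Omega_connected : connected Omega) (Omega_bounded : bounded_set Omega)
    (Omega_lipschitz : lipschitz_boundary Omega)
    (s_gt0 : 0 < s) (s_lt1 : s < 1) (T_gt0 : 0 < T) :
  exists2 C : R, 0 < C &
  forall (f : R -> ('rV[R]_n.+1 -> R) -> R) (rho0 : 'rV[R]_n.+1 -> R),
  L2Hms Omega s T f -> L2 Omega rho0 ->
  exists (rho : R -> 'rV[R]_n.+1 -> R) (rhot : R -> ('rV[R]_n.+1 -> R) -> R)
      (rhoc : R -> 'rV[R]_n.+1 -> R),
    (weak_solution Omega s T f rho0 rho /\
     forall rho', weak_solution Omega s T f rho0 rho' ->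
       {ae @lebesgue_measure R, forall t, t \in `]0, T[ ->
         {ae lebesgue_rV n.+1, forall x, rho' t x = rho t x}}) /\
    (W Omega s T rho rhot /\ continuous_rep Omega T rho rhoc) /\
    [/\ CL2_norm Omega T rhoc ^+ 2 <=
          L2norm Omega rho0 ^+ 2 + L2Hms_norm Omega s T f ^+ 2,
        L2Hs0_norm s T rho ^+ 2 <=
          L2norm Omega rho0 ^+ 2 + L2Hms_norm Omega s T f ^+ 2 &
        W_norm Omega s T rho rhot ^+ 2 <=
          C * (L2norm Omega rho0 ^+ 2 + L2Hms_norm Omega s T f ^+ 2)].
Proof.
have mO := open_measurable_rV Omega_open.
have C0 := C_Ns_gt0 n.+1 s_gt0 s_lt1.
have [Cp Cp0 hp] := poincare (ltn0Sn n) mO Omega_bounded s_gt0 s_lt1.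
have hCp (u : hs0 Omega s) : pivot u u <= Cp * gagliardo u u.
  by rewrite /pivot L2prodE; exact: hp (hs0P u).
have ha : semi_inner (@gagliardo R n.+1 Omega s) := gagliardo_semi_inner Omega C0.
have ca := gagliardo_complete C0 Cp0 hCp.
have mI : measurable (`]0, T[%classic : set R) by exact: measurable_itv.
have Cp1 := ltW Cp0.
have tV := tip_self ha mI.
have tH := tip_semi_inner ha mI (pivot_semi_inner Omega s)
  (normr_hle (pivot_semi_inner Omega s) Cp1 hCp).
(* one for the energy norm of the solution, four for its time derivative F - X *)
exists 5 => // f rho0 Lf L0.
have [F aeF nF] := bochner_Hms_rep ha ca mI Lf.
have [X [Xc [dX cX hXc hX wX]]] := forward_solution mO ca Cp1 hCp T_gt0 F L0.
have [LX nX] := bochner_hs0_emb X.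
have [LFX nFX] := bochner_Hms_emb (F - X).
have WX : W Omega s T (fun t => X t : _ -> R) (fun t => riesz_functional ((F - X) t)).
  by split.
exists (fun t => X t : _ -> R), (fun t => riesz_functional ((F - X) t)), Xc.
have Fint (Phi : l2time ha mI) (phi : R -> 'rV[R]_n.+1 -> R) :
    {ae @lebesgue_measure R, forall t, `]0, T[%classic t -> Phi t = phi t :> (_ -> R)} ->
    \int[@lebesgue_measure R]_(t in `]0, T[) f t (phi t) = tip (@gagliardo R n.+1 Omega s) F Phi.
  move=> aeP; apply: eq_Rintegral_ae; apply: (ae_mono (ae_and aeP aeF)) => t [h1 h2] It.
  by rewrite -h1// h2.
split; [split|split; [split => //|]].
- split; first by exists (fun t => riesz_functional ((F - X) t)).
  move=> phi phit phic hphi; have [[Lphi Lphit _] _ _] := hphi.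
  have [Phi aePhi _] := bochner_hs0_rep ha mI Lphi.
  have [Psi aePsi _] := bochner_Hms_rep ha ca mI Lphit.
  have := wX phi phit phic Phi Psi hphi aePhi aePsi.
  have q1 : \int[@lebesgue_measure R]_(t in `]0, T[) phit t (X t) =
      tip (@gagliardo R n.+1 Omega s) Psi X.
    by apply: eq_Rintegral_ae; apply: (ae_mono aePsi) => t h It; rewrite h.
  have q2 : \int[@lebesgue_measure R]_(t in `]0, T[) Fs s (X t) (phi t) =
      tip (@gagliardo R n.+1 Omega s) X Phi.
    by apply: eq_Rintegral_ae; apply: (ae_mono aePhi) => t h It; rewrite -h.
  by rewrite (Fint Phi phi aePhi) (L2prodC Omega rho0) q1 q2.
- move=> rho' [[rhot' [Lrho' _ _]] wrho'].
  have [X' aeX' _] := bochner_hs0_rep ha mI Lrho'.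
  have [KZ hKZ] := tip_pivot_operator ca Cp1 hCp (X' - X).
  have [Phi [phic hphi]] := backward_solution mO ca Cp1 hCp T_gt0 KZ.
  have aePhi : {ae @lebesgue_measure R, forall t, `]0, T[%classic t -> Phi t = Phi t :> (_ -> R)}.
    by exists set0; split=> // t /=; apply: contra_notP.
  have aePsi : {ae @lebesgue_measure R, forall t, `]0, T[%classic t -> forall w : hs0 Omega s,
      riesz_functional ((Phi - KZ) t) w = gagliardo ((Phi - KZ) t) w}.
    by exists set0; split=> // t /=; apply: contra_notP.
  have e1 := wX _ _ _ Phi (Phi - KZ) hphi aePhi aePsi.
  have e2 : - tip (@gagliardo R n.+1 Omega s) (Phi - KZ) X' + tip (@gagliardo R n.+1 Omega s) X' Phi =
      tip (@gagliardo R n.+1 Omega s) F Phi + L2prod Omega (phic 0) rho0.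
    have q1 : \int[@lebesgue_measure R]_(t in `]0, T[) riesz_functional ((Phi - KZ) t) (rho' t) =
        tip (@gagliardo R n.+1 Omega s) (Phi - KZ) X'.
      by apply: eq_Rintegral_ae; apply: (ae_mono aeX') => t h It; rewrite -h.
    have q2 : \int[@lebesgue_measure R]_(t in `]0, T[) Fs s (rho' t) (Phi t) =
        tip (@gagliardo R n.+1 Omega s) X' Phi.
      by apply: eq_Rintegral_ae; apply: (ae_mono aeX') => t h It; rewrite -h.
    by have := wrho' _ _ _ hphi; rewrite (Fint Phi _ aePhi) (L2prodC Omega rho0) q1 q2.
  have Z0 : tip (@pivot R n.+1 Omega s) (X' - X) (X' - X) = 0.
    rewrite -hKZ.
    have e := dual_identity tV e1 e2.
    exact: e.
  have aeZ := tip_pivot_eq0 Cp1 hCp Z0.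
  apply: (ae_mono (ae_and aeX' aeZ)) => t [h1 h2] It.
  have := h2 It; rewrite pivotE => /(l2ip_eq0 (hs0_sqi _)) h.
  apply: (ae_mono h) => x /eqP; rewrite -(h1 It) => hx.
  by apply/eqP; rewrite -subr_eq0.
- have nf : L2Hms_norm Omega s T f ^+ 2 = tip (@gagliardo R n.+1 Omega s) F F := nF.
  rewrite nf; set B := L2norm Omega rho0 ^+ 2 + _.
  have B0 : 0 <= B by rewrite addr_ge0 ?sqr_ge0// (sip_ge0 tV).
  have nx : L2Hs0_norm s T (fun t => X t : _ -> R) ^+ 2 = tip (@gagliardo R n.+1 Omega s) X X := nX.
  split.
  + have ubB : ubound [set L2norm Omega (Xc t) | t in `[0, T]] (Num.sqrt B).
      move=> y [t /= ti <-]; have := ti; rewrite in_itv/= => /andP[t0 tT].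
      rewrite -ler_sqr ?nnegrE ?sqrtr_ge0 ?L2norm_ge0// sqr_sqrtr//.
      exact: (hXc t t0 tT).
    have A0 : [set L2norm Omega (Xc t) | t in `[0, T]] (L2norm Omega (Xc 0)).
      by exists 0 => //=; rewrite in_itv/= lexx ltW.
    rewrite -[leRHS]sqr_sqrtr// ler_sqr ?nnegrE ?sqrtr_ge0//; last first.
      by apply: le_trans (L2norm_ge0 _ _) (ub_le_sup _ A0); exists (Num.sqrt B).
    by apply: ge_sup => //; exists (L2norm Omega (Xc 0)).
  + by rewrite nx.
  + rewrite /W_norm sqr_sqrtr; last by rewrite addr_ge0 ?sqr_ge0.
    rewrite nx [X in _ + X](_ : _ = tip (@gagliardo R n.+1 Omega s) (F - X) (F - X)); last exact: nFX.
    have h1 := sipD_le tV F (- X); rewrite (sipNl tV) (sipNr tV) opprK in h1.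
    have h2 : tip (@gagliardo R n.+1 Omega s) F F <= B by rewrite lerDr sqr_ge0.
    move: h1 hX h2; rewrite -/B; move: (tip _ F F) (tip _ X X) (tip _ (F - X) _) (B) => x y z b h1 h2 h3.
    by clear -h1 h2 h3; lra.
Qed.
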